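(* Let $(M,P,S)$ be a locally Lagrangian Poisson manifold. Then the symplectic leaves of $P$ are locally Lagrangian symplectic manifolds; that is, for every symplectic leaf $\mathcal S$ of $P$, the endomorphism $S$ preserves $T\mathcal S$, its restriction to $T\mathcal S$ is a tangent structure on $\mathcal S$, and together with the symplectic form $\omega_{\mathcal S}$ of the leaf it makes $\mathcal S$ a locally Lagrangian symplectic manifold.
   Context: Everything is $C^\infty$. A locally Lagrangian Poisson manifold is a triple $(M,P,S)$ where $P$ is a Poisson bivector field on the manifold $M$ and $S\in\Gamma\,\mathrm{End}(TM)$ satisfies, for all $1$-forms $\alpha,\beta$ on $M$ and all $x\in M$, $$P(\alpha,\beta\circ S)=P(\beta,\alpha\circ S),\qquad P(\alpha\circ S,\beta\circ S)=0,$$ $$\operatorname{rank}_x\big(S|_{\operatorname{im}\sharp_P}\big)=\tfrac12\operatorname{rank}_xP,\qquad \mathcal N_S(X,Y)=0\quad\forall X,Y\in\Gamma(\operatorname{im}\sharp_P),$$ where $\sharp_P:T^*M\to TM$ is defined by $\langle\sharp_P\alpha,\beta\rangle=P(\alpha,\beta)$, $(\alpha\circ S)(X)=\alpha(SX)$, and $\mathcal N_S(X,Y)=[SX,SY]-S[SX,Y]-S[X,SY]+S^2[X,Y]$ is the Nijenhuis tensor of $S$. The symplectic leaves of $P$ are the leaves of the generalized foliation $\operatorname{im}\sharp_P$; the symplectic form of a leaf $\mathcal S$ is $\omega_{\mathcal S}(\sharp_P\alpha,\sharp_P\beta)=-P(\alpha,\beta)$. A tangent structure on a manifold $N$ is $F\in\Gamma\,\mathrm{End}(TN)$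 with $F^2=0$, $\operatorname{im}F=\ker F$ and vanishing Nijenhuis tensor (equivalently, around every point there are local coordinates $(q^i,u^i)$ with $F(\partial/\partial q^i)=\partial/\partial u^i$, $F(\partial/\partial u^i)=0$). A locally Lagrangian symplectic manifold is a triple $(N,F,\omega)$ with $F$ a tangent structure and $\omega$ a symplectic form on $N$ such that every point of $N$ has an open neighborhood $U$ and a function $\mathcal L\in C^\infty(U)$ with $\omega|_U=d(d\mathcal L\circ F)$. *)

(* Defs.v *)
From HB Require Import structures.
From mathcomp Require Import all_boot all_order all_algebra.
From mathcomp Require Import all_classical all_reals all_analysis.
Set Implicit Arguments.
Unset Strict Implicit.
Unset Printing Implicit Defensive.
Import Order.TTheory GRing.Theory Num.Theory.
Import numFieldNormedType.Exports.
Local Open Scope classical_set_scope.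
Local Open Scope ring_scope.

(** * Smooth functions on open subsets of R^n *)

Definition partial (R : realType) (n : nat) (i : 'I_n) (f : 'rV[R]_n -> R) :
  'rV[R]_n -> R := 'D_(delta_mx 0 i) f.

(* Only meaningful for [U] open: continuity and derivability at the points of
   [U] are taken in R^n, so they depend only on the values of [f] on [U]. *)
Fixpoint C_ (R : realType) (n k : nat) (U : set 'rV[R]_n) (f : 'rV[R]_n -> R)
    : Prop :=
  (forall u, U u -> {for u, continuous f}) /\
  if k is k'.+1 then
    forall i : 'I_n,
      (forall u, U u -> derivable f u (delta_mx 0 i)) /\ C_ k' U (partial i f)
  else True.

Definition smooth (R : realType) (n : nat) (U : set 'rV[R]_n)
  (f : 'rV[R]_n -> R) : Prop := forall k, C_ k U f.

(** * Manifolds *)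

Record chart (R : realType) (n : nat) (M : topologicalType) := Chart {
  dom : set M;
  coord : M -> 'rV[R]_n;
  param : 'rV[R]_n -> M;  (* inverse of [coord] on [coord @` dom] *)
  dom_open : open dom;
  codom_open : open (coord @` dom);
  coordK : forall x, dom x -> param (coord x) = x;
  coord_continuous : forall x, dom x -> {for x, continuous coord};
  param_continuous : forall u, (coord @` dom) u -> {for u, continuous param} }.

(* [dchart a f x] is the column of the partial derivatives of [f], at [x], with
   respect to the coordinates [a]: the components of the covector df. *)
Definition dchart (R : realType) (n : nat) (M : topologicalType)
    (a : chart R n M) (f : M -> R) (x : M) : 'cV[R]_n :=
  \col_i partial i (f \o param a) (coord a x).

(* A second countable Hausdorff smooth manifold, all of whose charts have
   dimension [n]. The atlas is indexed and need not be maximal. *)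
Record manifold (R : realType) (n : nat) := Manifold {
  points :> topologicalType;
  atlas : Type;
  chart_of : atlas -> chart R n points;
  points_hausdorff : hausdorff_space points;
  points_second_countable : @second_countable points;
  atlas_cover : forall x, exists a, dom (chart_of a) x;
  atlas_smooth : forall (a b : atlas) (j : 'I_n),
    smooth (coord (chart_of a) @` (dom (chart_of a) `&` dom (chart_of b)))
      (fun u => coord (chart_of b) (param (chart_of a) u) 0 j) }.

Coercion chart_of : atlas >-> chart.

Definition smooth_on (R : realType) (n : nat) (M : manifold R n) (U : set M)
    (f : M -> R) : Prop :=
  forall a : atlas M, smooth (coord a @` (dom a `&` U)) (f \o param a).

Definition smooth_mx_on (R : realType) (n : nat) (M : manifold R n) (U : set M)
    (p q : nat) (A : M -> 'M[R]_(p, q)) : Prop :=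
  forall i j, smooth_on U (fun x => A x i j).

(* The matrix of the differential at [y] of [f : N -> M] in the charts [b] and
   [a]; it acts on tangent vectors, which are rows, on the right. *)
Definition differential (R : realType) (k n : nat) (N : manifold R k)
    (M : manifold R n) (f : N -> M) (b : atlas N) (a : atlas M) (y : N)
    : 'M[R]_(k, n) :=
  \matrix_(i, j) dchart b (fun z => coord a (f z) 0 j) y i 0.

Definition jac (R : realType) (n : nat) (M : manifold R n) (a b : atlas M)
  (x : M) : 'M[R]_n := differential (fun z : M => z) a b x.

Definition smooth_map (R : realType) (k n : nat) (N : manifold R k)
    (M : manifold R n) (f : N -> M) : Prop :=
  continuous f /\
  forall (a : atlas M) (j : 'I_n),
    smooth_on (f @^-1` dom a) (fun y => coord a (f y) 0 j).

(** * Tensor fields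

   A tensor field is given by its components in each chart, which are smooth
   on the domain of the chart and follow the tensor transformation law; the
   values of the components in a chart outside of its domain are irrelevant.
   Tangent vectors are rows and covectors are columns, so that:
   - the pairing of a covector [al] with a vector [v] is [v *m al];
   - an endomorphism [S] maps [v] to [v *m S], and [al \o S] is [S *m al];
   - a bivector [P] maps [al, be] to [al^T *m P *m be], so that sharp_P maps
     [al] to [al^T *m P], and its image is the row space of [P];
   - a 2-form [w] maps [u, v] to [u *m w *m v^T]. *)

Record vector_field (R : realType) (n : nat) (M : manifold R n) := VectorField {
  vf :> atlas M -> M -> 'rV[R]_n;
  vf_smooth : forall a : atlas M, smooth_mx_on (dom a) (vf a);
  vf_compat : forall (a b : atlas M) x, dom a x -> dom b x ->
    vf b x = vf a x *m jac a b x }.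

Record one_form (R : realType) (n : nat) (M : manifold R n) := OneForm {
  of1 :> atlas M -> M -> 'cV[R]_n;
  of1_smooth : forall a : atlas M, smooth_mx_on (dom a) (of1 a);
  of1_compat : forall (a b : atlas M) x, dom a x -> dom b x ->
    of1 a x = jac a b x *m of1 b x }.

Record endo_field (R : realType) (n : nat) (M : manifold R n) := EndoField {
  ef :> atlas M -> M -> 'M[R]_n;
  ef_smooth : forall a : atlas M, smooth_mx_on (dom a) (ef a);
  ef_compat : forall (a b : atlas M) x, dom a x -> dom b x ->
    ef a x *m jac a b x = jac a b x *m ef b x }.

Record bivector_field (R : realType) (n : nat) (M : manifold R n) :=
    BivectorField {
  bf :> atlas M -> M -> 'M[R]_n;
  bf_smooth : forall a : atlas M, smooth_mx_on (dom a) (bf a);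
  bf_skew : forall (a : atlas M) x, dom a x -> (bf a x)^T = - bf a x;
  bf_compat : forall (a b : atlas M) x, dom a x -> dom b x ->
    bf b x = (jac a b x)^T *m bf a x *m jac a b x }.

Record two_form (R : realType) (n : nat) (M : manifold R n) := TwoForm {
  tf :> atlas M -> M -> 'M[R]_n;
  tf_smooth : forall a : atlas M, smooth_mx_on (dom a) (tf a);
  tf_skew : forall (a : atlas M) x, dom a x -> (tf a x)^T = - tf a x;
  tf_compat : forall (a b : atlas M) x, dom a x -> dom b x ->
    tf a x = jac a b x *m tf b x *m (jac a b x)^T }.

(* Components of the Lie bracket: [X, Y]^j = X(Y^j) - Y(X^j). *)
Definition lie_bracket (R : realType) (n : nat) (M : manifold R n)
    (X Y : atlas M -> M -> 'rV[R]_n) (a : atlas M) (x : M) : 'rV[R]_n :=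
  \row_j ((X a x *m dchart a (fun y => Y a y 0 j) x) 0 0
        - (Y a x *m dchart a (fun y => X a y 0 j) x) 0 0).

Definition apply_endo (R : realType) (n : nat) (M : manifold R n)
    (S : atlas M -> M -> 'M[R]_n) (X : atlas M -> M -> 'rV[R]_n)
    (a : atlas M) (x : M) : 'rV[R]_n := X a x *m S a x.

Definition nijenhuis (R : realType) (n : nat) (M : manifold R n)
    (S : atlas M -> M -> 'M[R]_n) (X Y : atlas M -> M -> 'rV[R]_n)
    (a : atlas M) (x : M) : 'rV[R]_n :=
  let SX := apply_endo S X in
  let SY := apply_endo S Y in
  lie_bracket SX SY a x
  - apply_endo S (lie_bracket SX Y) a x
  - apply_endo S (lie_bracket X SY) a x
  + apply_endo S (apply_endo S (lie_bracket X Y)) a x.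

(** * Locally Lagrangian Poisson manifolds *)

(* {f, g} = P(df, dg), computed in the chart [a]. *)
Definition poisson_bracket (R : realType) (n : nat) (M : manifold R n)
    (P : atlas M -> M -> 'M[R]_n) (a : atlas M) (f g : M -> R) (x : M) : R :=
  ((dchart a f x)^T *m P a x *m dchart a g x) 0 0.

Definition is_poisson (R : realType) (n : nat) (M : manifold R n)
    (P : bivector_field M) : Prop :=
  forall f g h : M -> R,
    smooth_on setT f -> smooth_on setT g -> smooth_on setT h ->
  forall (a : atlas M) (x : M), dom a x ->
    poisson_bracket P a f (poisson_bracket P a g h) x
    + poisson_bracket P a g (poisson_bracket P a h f) x
    + poisson_bracket P a h (poisson_bracket P a f g) x = 0.

Definition section_of_im_sharp (R : realType) (n : nat) (M : manifold R n)
    (P : bivector_field M) (X : vector_field M) : Prop :=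
  forall (a : atlas M) (x : M), dom a x -> (X a x <= P a x)%MS.

Record locally_lagrangian_poisson (R : realType) (n : nat) (M : manifold R n)
    (P : bivector_field M) (S : endo_field M) : Prop :=
    LocallyLagrangianPoisson {
  llp_poisson : is_poisson P;
  llp_sym : forall (al be : one_form M) (a : atlas M) (x : M), dom a x ->
    (al a x)^T *m P a x *m (S a x *m be a x)
    = (be a x)^T *m P a x *m (S a x *m al a x);
  llp_isotropic : forall (al be : one_form M) (a : atlas M) (x : M),
    dom a x ->
    (S a x *m al a x)^T *m P a x *m (S a x *m be a x) = 0;
  (* the image of im sharp_P under S is the row space of [P *m S] *)
  llp_rank : forall (a : atlas M) (x : M), dom a x ->
    (\rank (P a x *m S a x)%R).*2 = \rank (P a x);
  llp_nijenhuis : forall X Y : vector_field M,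
    section_of_im_sharp P X -> section_of_im_sharp P Y ->
    forall (a : atlas M) (x : M), dom a x -> nijenhuis S X Y a x = 0 }.

(** * Symplectic leaves *)

(* A connected injectively immersed manifold, whose tangent spaces are the
   fibres of the generalized distribution im sharp_P. *)
Record integral_manifold (R : realType) (n : nat) (M : manifold R n)
    (P : bivector_field M) (k : nat) (N : manifold R k) (i : N -> M) : Prop :=
    IntegralManifold {
  im_nonempty : [set: N] !=set0;
  im_connected : connected [set: N];
  im_smooth : smooth_map i;
  im_injective : injective i;
  im_immersion : forall (b : atlas N) (a : atlas M) (y : N),
    dom b y -> dom a (i y) -> row_free (differential i b a y);
  im_tangent : forall (b : atlas N) (a : atlas M) (y : N),
    dom b y -> dom a (i y) -> (differential i b a y == P a (i y))%MS }.

(* The leaves of im sharp_P are its maximal integral manifolds. *)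
Definition symplectic_leaf (R : realType) (n : nat) (M : manifold R n)
    (P : bivector_field M) (k : nat) (N : manifold R k) (i : N -> M) : Prop :=
  integral_manifold P i /\
  forall (k' : nat) (N' : manifold R k') (i' : N' -> M),
    integral_manifold P i' -> range i `<=` range i' -> range i' `<=` range i.

Definition preserves_tangent (R : realType) (n : nat) (M : manifold R n)
    (S : endo_field M) (k : nat) (N : manifold R k) (i : N -> M) : Prop :=
  forall (b : atlas N) (a : atlas M) (y : N), dom b y -> dom a (i y) ->
    (differential i b a y *m S a (i y) <= differential i b a y)%MS.

Definition restricts_to (R : realType) (n : nat) (M : manifold R n)
    (S : endo_field M) (k : nat) (N : manifold R k) (i : N -> M)
    (F : endo_field N) : Prop :=
  forall (b : atlas N) (a : atlas M) (y : N), dom b y -> dom a (i y) ->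
    F b y *m differential i b a y = differential i b a y *m S a (i y).

(* omega(sharp_P al, sharp_P be) = - P(al, be) at every point of the leaf. *)
Definition leaf_form (R : realType) (n : nat) (M : manifold R n)
    (P : bivector_field M) (k : nat) (N : manifold R k) (i : N -> M)
    (omega : two_form N) : Prop :=
  forall (b : atlas N) (a : atlas M) (y : N), dom b y -> dom a (i y) ->
  forall (al be : 'cV[R]_n) (v w : 'rV[R]_k),
    v *m differential i b a y = al^T *m P a (i y) ->
    w *m differential i b a y = be^T *m P a (i y) ->
    v *m omega b y *m w^T = - (al^T *m P a (i y) *m be).

(** * Locally Lagrangian symplectic manifolds *)

Record tangent_structure (R : realType) (k : nat) (N : manifold R k)
    (F : endo_field N) : Prop := TangentStructure {
  ts_square : forall (b : atlas N) (y : N), dom b y -> F b y *m F b y = 0;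
  ts_im_ker : forall (b : atlas N) (y : N), dom b y ->
    (F b y == kermx (F b y))%MS;
  ts_nijenhuis : forall (X Y : vector_field N) (b : atlas N) (y : N),
    dom b y -> nijenhuis F X Y b y = 0 }.

(* The exterior derivative of a 1-form:
   d theta (d_i, d_j) = d_i theta_j - d_j theta_i. *)
Definition ext_d1 (R : realType) (k : nat) (N : manifold R k)
    (theta : atlas N -> N -> 'cV[R]_k) (b : atlas N) (y : N) : 'M[R]_k :=
  \matrix_(i, j) (dchart b (fun z => theta b z j 0) y i 0
                - dchart b (fun z => theta b z i 0) y j 0).

(* The last clause of [symplectic] is d omega = 0, in components. *)
Record symplectic (R : realType) (k : nat) (N : manifold R k)
    (omega : two_form N) : Prop := Symplectic {
  symplectic_nondegenerate : forall (b : atlas N) (y : N), dom b y ->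
    omega b y \in unitmx;
  symplectic_closed : forall (b : atlas N) (y : N), dom b y ->
    forall p q r : 'I_k,
      dchart b (fun z => omega b z q r) y p 0
      + dchart b (fun z => omega b z r p) y q 0
      + dchart b (fun z => omega b z p q) y r 0 = 0 }.

(* dL o F *)
Definition d_comp (R : realType) (k : nat) (N : manifold R k) (L : N -> R)
    (F : endo_field N) (b : atlas N) (z : N) : 'cV[R]_k :=
  F b z *m dchart b L z.

Record locally_lagrangian_symplectic (R : realType) (k : nat)
    (N : manifold R k) (F : endo_field N) (omega : two_form N) : Prop :=
    LocallyLagrangianSymplectic {
  lls_tangent : tangent_structure F;
  lls_symplectic : symplectic omega;
  lls_lagrangian : forall y : N, exists (U : set N) (L : N -> R),
    [/\ open U, U y, smooth_on U L &
        forall (b : atlas N) (z : N), dom b z -> U z ->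
          omega b z = ext_d1 (d_comp L F) b z] }.

(* Main.v *)
From HB Require Import structures.
From mathcomp Require Import all_boot all_order all_algebra.
From mathcomp Require Import all_classical all_reals all_analysis.
From mathcomp Require Import ring lra.
Require Import Defs.
Set Implicit Arguments.
Unset Strict Implicit.
Unset Printing Implicit Defensive.
Import Order.TTheory GRing.Theory Num.Theory.
Import numFieldNormedType.Exports.
Local Open Scope classical_set_scope.
Local Open Scope ring_scope.

(** At a point of the leaf let D be the Jacobian matrix of the immersion. The
   symmetry of P S gives D S <= rowspace P = rowspace D, so S restricts to F
   with F D = D S, and P = D^T Q D with Q invertible and skew. The algebraic
   conditions on (P, S) become F^2 = 0, 2 rank F = k and symmetry of F Q^-1; the
   Jacobi identity becomes d(Q^-1) = 0. The hypotheses quantify over global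
   forms, fields and functions, and bump functions give them at each point.

   Locally the closed form w = Q^-1 is d th. Since N_F = 0, im F has a local
   frame Z_a = X_a F of commuting fields dual to constant covectors. As w
   vanishes on im F, so does d th, and transport along the flows of the Z_a
   yields f with Z_a f = - th(Z_a). Now th' = th + df vanishes on im F = ker F.
   Symmetry of F w and vanishing of N_F make th'(X_a) satisfy the
   compatibility conditions for Z_a L = th'(X_a), solved by a second transport.
   Then dL o F and th' agree on the X_a and on im F, so w = d(dL o F). *)

(** * Smooth functions *)

(** All local existence statements reduce to one equation, Z f = g with f = 0 on a hyperplane
    transverse to Z. Its germ exists and is unique by means of the flow of Z, which must therefore
    be smooth in the initial point and in time. Uniqueness drives the inductions over components: a
    component already killed stays zero after the next correction, because for a different from r
    the field Z_a commutes with Z_r and is tangent to the hyperplane used for Z_r.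

    The Z_a commute by linear algebra: N_F = 0 and F^2 = 0 put [Z_a, Z_b] in im F; the constant
    covectors take constant values on the frame, so they annihilate the bracket, and together they
    are injective on im F. On the leaf, tensors are defined by matrix identities with the row free
    Jacobian D. These identities determine the restricted tensor, which makes it independent of
    charts, and it is smooth because D has a right inverse given by a smooth formula. Second
    derivatives of the immersion cancel by symmetry, so the Nijenhuis and Jacobi conditions pass to
    the leaf pointwise. *)

Section Calculus.
Context {R : realType}.

Lemma normr_coord n (x : 'rV[R]_n) j : `|x 0 j| <= `|x|.
Proof.
rewrite [leRHS]mx_normrE.
exact: (le_bigmax _ (fun ij => `|x ij.1 ij.2|) (ord0, j)).
Qed.

Lemma normr_le_coord n (x : 'rV[R]_n) (c : R) : 0 <= c ->
  (forall j, `|x 0 j| <= c) -> `|x| <= c.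
Proof.
move=> c0 xc; rewrite [leLHS]mx_normrE; apply/bigmax_leP; split => //.
by move=> [i j] _ /=; rewrite ord1.
Qed.

Lemma continuous_entry n (j : 'I_n) : continuous (fun x : 'rV[R]_n => x 0 j).
Proof. by move=> x; exact/differentiable_continuous/differentiable_coord. Qed.

Section DerivativeRules.
Variables (V : normedModType R) (x v : V).
Implicit Types f g : V -> R.

Lemma is_derive_add f g df dg : is_derive x v f df -> is_derive x v g dg ->
  is_derive x v (fun y => f y + g y) (df + dg).
Proof. exact: is_deriveD. Qed.

Lemma is_derive_opp f df : is_derive x v f df ->
  is_derive x v (fun y => - f y) (- df).
Proof. exact: is_deriveN. Qed.

Lemma is_derive_sub f g df dg : is_derive x v f df -> is_derive x v g dg ->
  is_derive x v (fun y => f y - g y) (df - dg).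
Proof. exact: is_deriveB. Qed.

Lemma is_derive_mul f g df dg : is_derive x v f df -> is_derive x v g dg ->
  is_derive x v (fun y => f y * g y) (df * g x + f x * dg).
Proof.
move=> Hf Hg; have H := is_deriveM Hf Hg.
by apply: (is_derive_eq H); rewrite addrC; congr (_ + _); rewrite /GRing.scale /= mulrC.
Qed.

Lemma is_derive_bigsum (I : Type) (r : seq I) (f : I -> V -> R) df :
  (forall i, is_derive x v (f i) (df i)) ->
  is_derive x v (fun y => \sum_(i <- r) f i y) (\sum_(i <- r) df i).
Proof.
move=> H; elim: r => [|a r IH].
  under eq_fun do rewrite big_nil; rewrite big_nil; exact: is_derive_cst.
under eq_fun do rewrite big_cons; rewrite big_cons; exact: is_derive_add.
Qed.

End DerivativeRules.

Lemma is_derive_line (V : normedModType R) (f : V -> R) (u v : V) (s : R) df :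
  is_derive (u + s *: v) v f df ->
  is_derive s (1 : R) (fun s : R => f (u + s *: v)) df.
Proof.
move=> [fd <-].
have E : (fun h : R => h^-1 *: (f (h *: v + (u + s *: v)) - f (u + s *: v))) =
  (fun h : R => h^-1 *: (f (u + (h *: (1 : R) + s) *: v) - f (u + s *: v))).
  apply/funext => h; congr (_ *: (f _ - _)).
  by rewrite scalerDl addrCA [h *: 1]mulr1.
by split; rewrite /derivable /derive -E.
Qed.

(** In the sup norm, the path from [x] to [y] that changes one coordinate at a time stays in the
    ball of radius |y - x|, so the one-variable mean value theorem applies on each of its edges. *)
Lemma mvt_box n (f : 'rV[R]_n -> R) (x y : 'rV[R]_n) :
  (forall z, `|z - x| <= `|y - x| -> forall j, derivable f z (delta_mx 0 j)) ->
  exists xi : 'I_n -> 'rV[R]_n, (forall j, `|xi j - x| <= `|y - x|) /\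
    f y - f x = \sum_j (y 0 j - x 0 j) * partial j f (xi j).
Proof.
move=> fd.
pose w m : 'rV[R]_n := \row_j if (j < m)%N then y 0 j else x 0 j.
have step (j : 'I_n) : exists xi, `|xi - x| <= `|y - x| /\
    f (w j.+1) - f (w j) = (y 0 j - x 0 j) * partial j f xi.
  pose d := y 0 j - x 0 j.
  have in_box (s : R) : 0 <= s <= 1 -> `|w j + (s * d) *: delta_mx 0 j - x| <= `|y - x|.
    move=> /andP[s0 s1]; apply: normr_le_coord => // i; rewrite !mxE eqxx /=.
    have := normr_coord (y - x) i; rewrite !mxE => H.
    case: ltnP => ij; first by rewrite (_ : (i == j) = false) ?mulr0 ?addr0 //; apply/eqP => e; move: ij; rewrite e ltnn.
    have [->|ne] := eqVneq i j; last by rewrite mulr0 addr0 subrr normr0.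
    rewrite mulr1 addrAC subrr add0r normrM (ger0_norm s0).
    apply: le_trans (normr_coord (y - x) j); rewrite !mxE.
    by rewrite ler_piMl.
  (* Running the edge over [0, 1] with speed [d] treats both signs of [d] at once. *)
  pose g (s : R) := f (w j + (s * d) *: delta_mx 0 j).
  have dg (s : R) : 0 <= s <= 1 -> is_derive s 1 g
      (partial j f (w j + (s * d) *: delta_mx 0 j) * d).
    move=> s01.
    have D := derivableP (fd _ (in_box _ s01) j).
    have := is_derive_line D => {}D.
    have M : is_derive s 1 (fun s => s * d) d.
      have := is_derive_mul (is_derive_id s (1 : R)) (is_derive_cst d s (1 : R)).
      by move=> H; apply: (is_derive_eq H); rewrite /= mul1r mulr0 addr0.
    exact: (@is_derive1_comp R (fun s => f (w j + s *: delta_mx 0 j)) (fun s => s * d) s _ _ D M).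
  have cg : {within `[0, 1], continuous g}.
    apply: derivable_within_continuous => s; rewrite in_itv /= => s01.
    by have [] := dg s s01.
  have [||c c01 Hc] := @MVT_segment R g (fun s => partial j f (w j + (s * d) *: delta_mx 0 j) * d) 0 1 _ _ cg.
  - exact: ler01.
  - by move=> s; rewrite in_itv /= => /andP[s0 s1]; apply: dg; rewrite !ltW.
  exists (w j + (c * d) *: delta_mx 0 j); split.
    by apply: in_box; rewrite in_itv in c01.
  rewrite mulrC -/d -[RHS]mulr1 -[X in _ * _ * X]subr0 -Hc /g mul0r scale0r addr0 mul1r.
  congr (f _ - _); apply/rowP => i; rewrite !mxE eqxx /= ltnS leq_eqVlt.
  have [->|ne] := eqVneq i j; first by rewrite eqxx ltnn /= mulr1 /d addrCA subrr addr0.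
  by rewrite (negbTE (ne : (i : nat) != j)) /= mulr0 addr0.
have [xi Hxi] := choice step.
exists xi; split; first by move=> j; have [] := Hxi j.
under eq_bigr => j _ do rewrite -(proj2 (Hxi j)).
rewrite -(big_mkord xpredT (fun j => f (w j.+1) - f (w j))) telescope_sumr //.
by congr (f _ - f _); apply/rowP => j; rewrite !mxE ?ltn_ord.
Qed.

(** The candidate differential in [near_diff_C1], with [c] the partial derivatives; it is made
    linear so that uniqueness of the differential applies to it. *)
Definition row_form n (c : 'I_n -> R) (h : 'rV[R]_n) : R := \sum_j h 0 j * c j.

Fact row_form_is_linear n (c : 'I_n -> R) : linear (row_form c).
Proof.
move=> a u v; rewrite /row_form scaler_sumr -big_split; apply: eq_bigr => j _.
by rewrite !mxE mulrDl -mulrA.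
Qed.

HB.instance Definition _ n (c : 'I_n -> R) :=
  GRing.isLinear.Build R 'rV[R]_n R _ (row_form c) (row_form_is_linear c).

Lemma continuous_row_form n (c : 'I_n -> R) : continuous (row_form c).
Proof.
move=> x; apply: differentiable_continuous.
rewrite (_ : row_form c = \sum_j (fun h : 'rV[R]_n => h 0 j * c j)); last first.
  by apply/funext => h; rewrite fct_sumE.
apply: differentiable_sum => j.
apply: (@differentiableM _ _ (fun h : 'rV[R]_n => h 0 j) (cst (c j))) => //.
exact: differentiable_coord.
Qed.

Lemma near_all (T : topologicalType) (x : T) (I : finType) (P : I -> T -> Prop) :
  (forall i, \forall z \near x, P i z) -> \forall z \near x, forall i, P i z.
Proof. by move=> H; apply: (@filter_forall _ _ P (nbhs x) _ H). Qed.

Lemma diff_linear_approx (V W : normedModType R) (f : V -> W) (df : {linear V -> W}) x :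
  continuous df ->
  (forall e : R, 0 < e -> \forall h \near (0 : V), `|f (h + x) - f x - df h| <= e * `|h|) ->
  differentiable f x.
Proof.
move=> dfc H.
have E : f \o shift x = cst (f x) + df +o_ 0 id.
  apply/eqaddoP => e e0; apply: filterS (H e e0) => h.
  by rewrite /= !fctE opprD addrA.
apply/diff_locallyP.
by rewrite (diff_unique dfc E); split.
Qed.

(** By [mvt_box] the increment is a combination of partial derivatives at points that tend to [u],
    where they are close to their values at [u] by continuity. *)
Lemma near_diff_C1 n (f : 'rV[R]_n -> R) (u : 'rV[R]_n) :
  (\forall z \near u, forall j, derivable f z (delta_mx 0 j)) ->
  (forall j, {for u, continuous (partial j f)}) ->
  differentiable f u.
Proof.
move=> fd fc.
apply: (@diff_linear_approx _ _ _ (row_form (fun j => partial j f u))).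
- exact: continuous_row_form.
- move=> e e0.
  (* The sum has [n] terms; [n.+1] keeps the quotient meaningful in dimension 0. *)
  pose eps := e / n.+1%:R.
  have eps0 : 0 < eps by rewrite divr_gt0.
  have /nbhs_ballP [d d0 Hd] : \forall z \near u, (forall j, derivable f z (delta_mx 0 j)) /\
     (forall j, `|partial j f u - partial j f z| < eps).
    apply: filterI => //.
    apply: (@near_all _ _ _ (fun j z => `|partial j f u - partial j f z| < eps)) => j.
    by move: (fc j) => /cvgrPdist_lt/(_ _ eps0).
  apply/nbhs_ballP; exists d => //= h; rewrite -ball_normE /= sub0r normrN => hd.
  have [|xi [xi1 xi2]] := @mvt_box n f u (h + u).
    move=> z; rewrite addrK => zh j.
    have [] := Hd z; last by move=> + _; apply.
    rewrite -ball_normE /= distrC.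
    exact: le_lt_trans hd.
  rewrite xi2 /row_form -sumrB.
  apply: le_trans (ler_norm_sum _ _ _) _.
  have : \sum_(j < n) `|(((h + u) 0 j - u 0 j) * partial j f (xi j)) - h 0 j * partial j f u| <= \sum_(j < n) (`|h| * eps).
    apply: ler_sum => j _; rewrite !mxE addrK -mulrBr normrM distrC.
    apply: ler_pM => //; first exact: normr_coord.
    apply/ltW; have [] := Hd (xi j); last by move=> _; apply.
    rewrite -ball_normE /= distrC; apply: le_lt_trans hd.
    by have := xi1 j; rewrite addrK.
  move/le_trans; apply.
  rewrite sumr_const card_ord -mulr_natr -mulrA mulrC ler_wpM2r // /eps.
  by rewrite -mulrA ler_piMr ?(ltW e0) // mulrC ler_pdivrMr // mul1r ler_nat.
Qed.

Lemma derive_partial n (f : 'rV[R]_n -> R) (u v : 'rV[R]_n) :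
  differentiable f u -> 'D_v f u = \sum_j v 0 j * partial j f u.
Proof.
move=> fd; rewrite deriveE // {1}[v]row_sum_delta linear_sum; apply: eq_bigr => j _.
by rewrite linearZ /= /partial deriveE.
Qed.

Lemma derivable_diff n (f : 'rV[R]_n -> R) (u v : 'rV[R]_n) :
  differentiable f u -> derivable f u v.
Proof. exact: diff_derivable. Qed.

Lemma is_derive_curve n (f : 'rV[R]_n -> R) (c : R -> 'rV[R]_n) (t : R) (dc : 'I_n -> R) :
  (forall j, is_derive t (1 : R) (fun s => c s 0 j) (dc j)) ->
  differentiable f (c t) ->
  is_derive t (1 : R) (fun s => f (c s)) (\sum_j dc j * partial j f (c t)).
Proof.
move=> cd fd.
have C : derivable c t (1 : R).
  by apply/derivable_mxP => i j; rewrite ord1; have [] := cd j.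
have C' : differentiable c t by apply/derivable1_diffP.
have D : differentiable (f \o c) t by exact: differentiable_comp.
split; first exact: diff_derivable.
rewrite deriveE // diff_comp //= -!deriveE // derive_partial //.
apply: eq_bigr => j _; congr (_ * _).
by rewrite derive_mx // mxE; apply: derive_val.
Qed.

(** A directional derivative is a derivative at 0 along the line [x + s *: v], which reduces the
    chain rule to curves. *)
Lemma is_derive_chain (V : normedModType R) n (f : 'rV[R]_n -> R) (p : V -> 'rV[R]_n) (x v : V) (dp : 'I_n -> R) :
  (forall j, is_derive x v (fun y => p y 0 j) (dp j)) ->
  differentiable f (p x) ->
  is_derive x v (fun y => f (p y)) (\sum_j dp j * partial j f (p x)).
Proof.
move=> pd fd.
have E (W : normedModType R) (g : V -> W) : (fun h : R => h^-1 *: (g (h *: v + x) - g x)) =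
  (fun h : R => h^-1 *: ((fun s : R => g (x + s *: v)) (h *: (1 : R) + 0) - (fun s : R => g (x + s *: v)) 0)).
  apply/funext => h; congr (_ *: (g _ - g _)); last by rewrite scale0r addr0.
  by rewrite addr0 addrC [h *: 1]mulr1.
have := @is_derive_curve n f (fun s => p (x + s *: v)) 0 dp.
rewrite scale0r addr0 => H.
have [|H1 H2] := H _ fd.
  move=> j; apply: (@is_derive_line _ (fun y => p y 0 j)).
  by rewrite scale0r addr0.
split; first by rewrite /derivable (E R (fun y => f (p y))).
by rewrite -H2 /derive (E R (fun y => f (p y))).
Qed.

End Calculus.

(** * Functions of class C^k: closure properties and symmetry of second derivatives *)

Section ClassC.
Context {R : realType}.

Lemma C_lt n k (U : set 'rV[R]_n) f : C_ k.+1 U f -> C_ k U f.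
Proof.
elim: k f => [|k IH] f; first by case.
by move=> [fc fd]; split => // i; have [fi ki] := fd i; split => //; exact: IH.
Qed.

Lemma C_cont n k (U : set 'rV[R]_n) f u : C_ k U f -> U u -> {for u, continuous f}.
Proof. by case: k => [|k] [fc _]; exact: fc. Qed.

Lemma C_derivable n k (U : set 'rV[R]_n) f u i : C_ k.+1 U f -> U u ->
  derivable f u (delta_mx 0 i).
Proof. by move=> [_ fd]; have [+ _] := fd i; exact. Qed.

Lemma C_partial n k (U : set 'rV[R]_n) f i : C_ k.+1 U f -> C_ k U (partial i f).
Proof. by move=> [_ fd]; have [_ +] := fd i; exact. Qed.

Lemma smooth_partial n (U : set 'rV[R]_n) f i : smooth U f -> smooth U (partial i f).
Proof. by move=> fs k; exact: C_partial (fs k.+1). Qed.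

(** Continuity and derivability are taken in the ambient space, so the class is a condition on germs
    at the points of [U]. This allows gluing, and it underlies the notion [smooth_at]. *)
Lemma C_pointwise n k (U : set 'rV[R]_n) f :
  C_ k U f <-> forall u, U u -> C_ k [set u] f.
Proof.
elim: k f => [|k IH] f; split.
- by move=> [fc _] u Uu; split => // v ->; exact: fc.
- by move=> H; split => // u /H [+ _]; exact.
- move=> [fc fd] u Uu; split; first by move=> v ->; exact: fc.
  move=> i; have [fi ki] := fd i; split; first by move=> v ->; exact: fi.
  by apply: (proj1 (IH _) ki).
- move=> H; split; first by move=> u /H [+ _]; exact.
  move=> i; split; first by move=> u /H [_ /(_ i)[+ _]]; exact.
  by apply/IH => u /H [_ /(_ i)[]].
Qed.

Lemma smooth_pointwise n (U : set 'rV[R]_n) f :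
  smooth U f <-> forall u, U u -> smooth [set u] f.
Proof.
split=> [H u Uu k|H k]; first by have /C_pointwise := H k; exact.
by apply/C_pointwise => u /H; exact.
Qed.

Lemma smooth_subset n (U V : set 'rV[R]_n) f : U `<=` V -> smooth V f -> smooth U f.
Proof.
by move=> UV /smooth_pointwise H; apply/smooth_pointwise => u /UV; exact: H.
Qed.

Lemma near_partial_eq n (f g : 'rV[R]_n -> R) i (u : 'rV[R]_n) :
  (\forall z \near u, f z = g z) -> \forall z \near u, partial i f z = partial i g z.
Proof.
move=> /nbhs_interior fg; apply: filterS fg => z fg.
exact: near_eq_derive.
Qed.

Lemma near_continuous_eq (T : topologicalType) (u : T) (f g : T -> R) :
  (\forall z \near u, f z = g z) -> {for u, continuous f} -> {for u, continuous g}.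
Proof.
move=> fg fc; rewrite /prop_for /continuous_at -(nbhs_singleton fg).
apply: cvg_trans fc; apply: near_eq_cvg.
by apply: filterS fg => z ->.
Qed.

Lemma continuous_rV (T : topologicalType) n (u : T) (p : T -> 'rV[R]_n) :
  (forall j, {for u, continuous (fun z => p z 0 j)}) -> {for u, continuous p}.
Proof.
move=> H; apply/cvgrPdist_le => e e0.
have /filterS : \forall z \near u, forall j, `|p u 0 j - p z 0 j| <= e.
  apply: near_all => j; move: (H j) => /cvgrPdist_le; exact.
apply => z Hz; apply: normr_le_coord; first exact: ltW.
by move=> j; rewrite !mxE.
Qed.

Lemma is_derive_shift (V : normedModType R) (f : V -> R) (z w v : V) df :
  is_derive (z + w) v f df -> is_derive z v (fun y => f (y + w)) df.
Proof.
move=> [fd <-].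
have E : (fun h : R => h^-1 *: (f (h *: v + z + w) - f (z + w))) =
  (fun h : R => h^-1 *: (f (h *: v + (z + w)) - f (z + w))).
  by apply/funext => h; rewrite addrA.
by split; rewrite /derivable /derive E.
Qed.

Lemma C_near_eq n k (u : 'rV[R]_n) (f g : 'rV[R]_n -> R) :
  (\forall z \near u, f z = g z) -> C_ k [set u] f -> C_ k [set u] g.
Proof.
elim: k f g => [|k IH] f g fg [fc fd]; (split=> [v -> //|]).
- exact: near_continuous_eq (fc u erefl).
- by [].
- exact: near_continuous_eq (fc u erefl).
- move=> i; have [fi ki] := fd i; split.
    move=> v ->; apply: near_eq_derivable (fi u erefl) => //.
  by apply: (IH (partial i f)) => //; exact: near_partial_eq.
Qed.

Lemma C_eq n k (U : set 'rV[R]_n) (f g : 'rV[R]_n -> R) : open U ->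
  (forall u, U u -> f u = g u) -> C_ k U f -> C_ k U g.
Proof.
move=> oU fg /C_pointwise H; apply/C_pointwise => u Uu.
apply: C_near_eq (H u Uu); have : nbhs u U by exact: open_nbhs_nbhs.
by apply: filterS => z; exact: fg.
Qed.

Lemma smooth_eq n (U : set 'rV[R]_n) (f g : 'rV[R]_n -> R) : open U ->
  (forall u, U u -> f u = g u) -> smooth U f -> smooth U g.
Proof. by move=> oU fg fs k; exact: C_eq (fs k). Qed.

Lemma C_diff n k (U : set 'rV[R]_n) f u : open U -> C_ k.+1 U f -> U u ->
  differentiable f u.
Proof.
move=> oU fC Uu; apply: near_diff_C1.
  have : nbhs u U by exact: open_nbhs_nbhs.
  by apply: filterS => z Uz j; exact: C_derivable fC Uz.
by move=> j; apply: C_cont Uu; apply: C_partial fC.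
Qed.

Lemma smooth_diff n (U : set 'rV[R]_n) f u : open U -> smooth U f -> U u ->
  differentiable f u.
Proof. by move=> oU fs; exact: (C_diff (k := 0) oU (fs 1)). Qed.

Lemma C_cst n k (U : set 'rV[R]_n) c : C_ k U (fun=> c).
Proof.
elim: k c => [|k IH] c; (split; first by move=> u _; exact: cst_continuous) => //.
move=> i; split; first by move=> u _; exact: derivable_cst.
rewrite (_ : partial i _ = fun=> 0) //.
by apply/funext => u; rewrite /partial derive_cst.
Qed.

Lemma C_add n k (U : set 'rV[R]_n) f g : open U -> C_ k U f -> C_ k U g ->
  C_ k U (fun u => f u + g u).
Proof.
move=> oU; elim: k f g => [|k IH] f g fC gC.
  by split => // u Uu; apply: continuousD; [exact: C_cont fC Uu|exact: C_cont gC Uu].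
split=> [u Uu|i].
  by apply: continuousD; [exact: C_cont fC Uu|exact: C_cont gC Uu].
split=> [u Uu|].
  by apply: derivableD; [exact: C_derivable fC Uu|exact: C_derivable gC Uu].
apply: (@C_eq _ _ _ (fun u => partial i f u + partial i g u)) => //.
  move=> u Uu; rewrite [RHS]deriveD //.
    exact: C_derivable fC Uu.
  exact: C_derivable gC Uu.
by apply: IH; exact: C_partial.
Qed.

Lemma C_mul n k (U : set 'rV[R]_n) f g : open U -> C_ k U f -> C_ k U g ->
  C_ k U (fun u => f u * g u).
Proof.
move=> oU; elim: k f g => [|k IH] f g fC gC.
  by split => // u Uu; apply: continuousM; [exact: C_cont fC Uu|exact: C_cont gC Uu].
split=> [u Uu|i].
  by apply: continuousM; [exact: C_cont fC Uu|exact: C_cont gC Uu].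
have D u (Uu : U u) := is_derive_mul (derivableP (C_derivable (i := i) fC Uu))
  (derivableP (C_derivable (i := i) gC Uu)).
split=> [u Uu|]; first by case: (D u Uu).
apply: (@C_eq _ _ _ (fun u => partial i f u * g u + f u * partial i g u)) => //.
  by move=> u Uu; have [_ <-] := D u Uu.
by apply: C_add => //; apply: IH; (exact: C_partial || exact: C_lt).
Qed.

Lemma C_coord n k (U : set 'rV[R]_n) j : C_ k U (fun u : 'rV[R]_n => u 0 j).
Proof.
have D u i : is_derive u (delta_mx 0 i : 'rV[R]_n) (fun u : 'rV[R]_n => u 0 j : R) ((i == j)%:R).
  have dif : differentiable (fun u : 'rV[R]_n => u 0 j : R) u by exact: differentiable_coord.
  split; first exact: diff_derivable.
  rewrite /derive; apply: cvg_lim => //.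
  apply: (@cvg_trans _ ((fun=> (i == j)%:R) @ (0 : R)^')); last exact: cvg_cst.
  apply: near_eq_cvg; near=> h.
  have h0 : h != 0 by near: h; exact: nbhs_dnbhs_neq.
  by rewrite /= !mxE eqxx /= addrK eq_sym [h^-1 *: _]mulKf.
case: k => [|k].
  by split => // u _; exact: continuous_entry.
split=> [u _|i]; first exact: continuous_entry.
split=> [u _|]; first by case: (D u i).
rewrite (_ : partial i _ = fun=> (i == j)%:R); first exact: C_cst.
by apply/funext => u; case: (D u i).
Unshelve. all: by end_near. Qed.

Lemma C_opp n k (U : set 'rV[R]_n) f : open U -> C_ k U f -> C_ k U (fun u => - f u).
Proof.
move=> oU fC; apply: (@C_eq _ _ _ (fun u => -1 * f u)) => //.
  by move=> u _; rewrite mulN1r.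
by apply: C_mul => //; exact: C_cst.
Qed.

Lemma C_inv n k (U : set 'rV[R]_n) f : open U -> (forall u, U u -> f u != 0) ->
  C_ k U f -> C_ k U (fun u => (f u)^-1).
Proof.
move=> oU f0; elim: k => [|k IH] fC.
  by split => // u Uu; apply: continuousV; [exact: f0|exact: C_cont fC Uu].
split=> [u Uu|i].
  by apply: continuousV; [exact: f0|exact: C_cont fC Uu].
split=> [u Uu|].
  by apply: derivableV; [exact: f0|exact: C_derivable fC Uu].
apply: (@C_eq _ _ _ (fun u => - (partial i f u * ((f u)^-1 * (f u)^-1)))) => //.
  move=> u Uu; rewrite [RHS]deriveV; last 2 first.
  - exact: f0.
  - exact: C_derivable fC Uu.
  rewrite [RHS]scaleNr; congr (- _); rewrite /GRing.scale /= mulrC; congr (_ * _).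
  by rewrite -invfM -expr2.
apply: C_opp => //; apply: C_mul => //; first exact: C_partial.
by apply: C_mul => //; apply: IH; exact: C_lt.
Qed.

Lemma C_sum n k (U : set 'rV[R]_n) (I : Type) (r : seq I) (P : pred I) F : open U ->
  (forall i, P i -> C_ k U (F i)) -> C_ k U (fun u => \sum_(i <- r | P i) F i u).
Proof.
move=> oU FC; elim: r => [|a r IH].
  by under eq_fun do rewrite big_nil; exact: C_cst.
under eq_fun do rewrite big_cons.
by case: (boolP (P a)) => // Pa; apply: C_add => //; exact: FC.
Qed.

Lemma C_prod n k (U : set 'rV[R]_n) (I : Type) (r : seq I) (P : pred I) F : open U ->
  (forall i, P i -> C_ k U (F i)) -> C_ k U (fun u => \prod_(i <- r | P i) F i u).
Proof.
move=> oU FC; elim: r => [|a r IH].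
  by under eq_fun do rewrite big_nil; exact: C_cst.
under eq_fun do rewrite big_cons.
by case: (boolP (P a)) => // Pa; apply: C_mul => //; exact: FC.
Qed.

Lemma C_comp m n k (U : set 'rV[R]_m) (V : set 'rV[R]_n) (p : 'rV[R]_m -> 'rV[R]_n) f :
  open U -> open V -> (forall u, U u -> V (p u)) ->
  (forall j, C_ k U (fun u => p u 0 j)) -> C_ k V f -> C_ k U (fun u => f (p u)).
Proof.
move=> oU oV UV; elim: k f => [|k IH] f pC fC.
  split => // u Uu; apply: continuous_comp; last by apply: C_cont fC _; exact: UV.
  by apply: continuous_rV => j; exact: C_cont (pC j) Uu.
split.
  move=> u Uu; apply: continuous_comp; last by apply: C_cont fC _; exact: UV.
  by apply: continuous_rV => j; exact: C_cont (pC j) Uu.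
have D u i (Uu : U u) := is_derive_chain (fun j => derivableP (C_derivable (i := i) (pC j) Uu))
  (C_diff oV fC (UV _ Uu)).
move=> i; split=> [u Uu|]; first by case: (D u i Uu).
apply: (@C_eq _ _ _ (fun u => \sum_j partial i (fun u => p u 0 j) u * partial j f (p u))) => //.
  by move=> u Uu; have [_ <-] := D u i Uu.
apply: C_sum => // j _; apply: C_mul => //; first exact: C_partial.
apply: IH; last exact: C_partial.
by move=> l; exact: C_lt.
Qed.

Lemma mvt_line n (f : 'rV[R]_n -> R) (u v : 'rV[R]_n) (h : R) : 0 < h ->
  (forall s, 0 <= s <= h -> derivable f (u + s *: v) v) ->
  exists2 c, 0 <= c <= h & f (u + h *: v) - f u = 'D_v f (u + c *: v) * h.
Proof.
move=> h0 fd.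
have D (s : R) : 0 <= s <= h ->
    is_derive s (1 : R) (fun s : R => f (u + s *: v)) ('D_v f (u + s *: v)).
  by move=> sh; apply: is_derive_line; apply: derivableP; exact: fd.
have cg : {within `[0, h], continuous (fun s : R => f (u + s *: v))}.
  apply: derivable_within_continuous => s; rewrite in_itv /= => s01.
  by have [] := D s s01.
have [|c c01 Hc] := @MVT_segment R (fun s : R => f (u + s *: v)) (fun s => 'D_v f (u + s *: v)) 0 h (ltW h0) _ cg.
  by move=> s; rewrite in_itv /= => /andP[s0 s1]; apply: D; rewrite !ltW.
exists c; first by move: c01; rewrite in_itv.
by move: Hc; rewrite scale0r addr0 subr0.
Qed.

(** The mixed second difference over a square of side [h] is symmetric in the two directions. Two
    applications of the mean value theorem show that, divided by [h ^+ 2], it tends to either of the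
    mixed derivatives. *)
Lemma schwarz n (U : set 'rV[R]_n) (f : 'rV[R]_n -> R) u i j : open U -> U u ->
  C_ 2 U f -> partial i (partial j f) u = partial j (partial i f) u.
Proof.
move=> oU Uu fC.
have main (a b : 'I_n) e : 0 < e -> \forall h \near (0 : R)^'+,
    `|partial b (partial a f) u -
      (f (u + h *: delta_mx 0 a + h *: delta_mx 0 b) - f (u + h *: delta_mx 0 a)
       - f (u + h *: delta_mx 0 b) + f u) / h ^+ 2| < e.
  move=> e0.
  have cab : {for u, continuous (partial b (partial a f))}.
    by apply: C_cont Uu; do 2! apply: C_partial; exact: fC.
  have /nbhs_ballP[d d0 Hd] : \forall z \near u, U z /\
      `|partial b (partial a f) u - partial b (partial a f) z| < e.
    apply: filterI; first exact: open_nbhs_nbhs.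
    by move: cab => /cvgrPdist_lt/(_ _ e0).
  near=> h.
  have h0 : 0 < h by near: h; exact: nbhs_right_gt.
  have hd : h + h < d.
    suff : h < d / 2 by lra.
    by near: h; apply: nbhs_right_lt; rewrite divr_gt0.
  have nd (c : 'I_n) : `|delta_mx 0 c : 'rV[R]_n| <= 1.
    apply: normr_le_coord => // l; rewrite !mxE eqxx /=.
    by case: eqP => _; rewrite ?normr1 ?normr0.
  have inU s t : 0 <= s <= h -> 0 <= t <= h -> ball u d (u + s *: delta_mx 0 a + t *: delta_mx 0 b).
    move=> /andP[s0 sh] /andP[t0 th]; rewrite -ball_normE /= -addrA opprD addrA subrr sub0r normrN.
    apply: le_lt_trans hd; apply: le_trans (ler_normD _ _) _.
    apply: lerD; rewrite normrZ ger0_norm // -[leRHS]mulr1; exact: ler_pM.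
  have h01 : 0 <= h <= h by rewrite lexx ltW.
  have h00 : 0 <= (0 : R) <= h by rewrite lexx ltW.
  have inU0 s : 0 <= s <= h -> U (u + s *: delta_mx 0 a).
    by move=> sh; have := inU s 0 sh h00; rewrite scale0r addr0 => /Hd[].
  pose g z := f (z + h *: delta_mx 0 b) - f z.
  have dg s : 0 <= s <= h -> is_derive (u + s *: delta_mx 0 a) (delta_mx 0 a) g
     (partial a f (u + s *: delta_mx 0 a + h *: delta_mx 0 b) - partial a f (u + s *: delta_mx 0 a)).
    move=> sh; apply: is_derive_sub.
      apply: is_derive_shift; apply: derivableP; apply: C_derivable fC _.
      by have [] := Hd _ (inU s h sh h01).
    by apply: derivableP; apply: C_derivable fC _; exact: inU0.
  have [|c ch Hc] := mvt_line (f := g) (u := u) (v := delta_mx 0 a) h0.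
    by move=> s sh; case: (dg s sh).
  have [|c' ch' Hc'] := mvt_line (f := partial a f) (u := u + c *: delta_mx 0 a) (v := delta_mx 0 b) h0.
    have fa : C_ 1 U (partial a f) by exact: C_partial.
    move=> s sh; apply: (C_derivable fa).
    by have [] := Hd _ (inU c s ch sh).
  rewrite [X in X / _](_ : _ = g (u + h *: delta_mx 0 a) - g u); last first.
    by rewrite /g; ring.
  rewrite Hc; have [_ ->] := dg c ch; rewrite Hc' -mulrA -expr2 mulfK ?expf_neq0 ?gt_eqF //.
  by have [] := Hd _ (inU c c' ch ch').
apply/eqP; rewrite eq_sym -subr_eq0 -normr_le0; apply/ler_addgt0Pr => e e0; rewrite add0r.
have e20 : 0 < e / 2 by rewrite divr_gt0.
near (0 : R)^'+ => h.
have H1 : `|partial j (partial i f) u -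
      (f (u + h *: delta_mx 0 i + h *: delta_mx 0 j) - f (u + h *: delta_mx 0 i)
       - f (u + h *: delta_mx 0 j) + f u) / h ^+ 2| < e / 2 by near: h; exact: main.
have H2 : `|partial i (partial j f) u -
      (f (u + h *: delta_mx 0 j + h *: delta_mx 0 i) - f (u + h *: delta_mx 0 j)
       - f (u + h *: delta_mx 0 i) + f u) / h ^+ 2| < e / 2 by near: h; exact: main.
move: H1 H2; rewrite [u + _ + h *: delta_mx 0 i]addrAC.
set q := f (u + _ + _); set q1 := f (u + _ *: delta_mx 0 i); set q2 := f (u + _ *: delta_mx 0 j).
rewrite [q - q2 - q1]addrAC; set w := _ / _.
move: w (partial j _ u) (partial i _ u) => w x y xw yw.
apply: le_trans (ler_distD w x y) _.
by rewrite [e]splitr (distrC w); apply: lerD; exact: ltW.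
Unshelve. all: by end_near. Qed.

End ClassC.

(** * Flows *)

Section ODE.
Context {R : realType}.
Implicit Types (f g b : R -> R) (t s : R).

Lemma is_derive_continuous (f : R -> R) (t : R) df :
  is_derive t (1 : R) f df -> {for t, continuous f}.
Proof. by move=> [d _]; apply: differentiable_continuous; apply/derivable1_diffP. Qed.

Lemma is_derive_uniq (V W : normedModType R) (f : V -> W) x v df1 df2 :
  is_derive x v f df1 -> is_derive x v f df2 -> df1 = df2.
Proof. by move=> [_ <-] [_ <-]. Qed.

Lemma is_derive_reverse f (t df : R) :
  is_derive (- t) (1 : R) f df -> is_derive t (1 : R) (fun s => f (- s)) (- df).
Proof.
move=> H; have := @is_derive1_comp R f -%R t _ _ H (is_deriveNid t (1 : R)).
by rewrite mulrN1.
Qed.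

Lemma is_derive_scale f (c t df : R) :
  is_derive (c * t) (1 : R) f df -> is_derive t (1 : R) (fun s => f (c * s)) (c * df).
Proof.
move=> H; have L : is_derive t (1 : R) (fun s => c * s) c.
  have := is_derive_mul (is_derive_cst c t (1 : R)) (is_derive_id t (1 : R)).
  by move=> K; apply: (is_derive_eq K); rewrite /= mul0r add0r mulr1.
by have := @is_derive1_comp R f _ t _ _ H L; rewrite mulrC.
Qed.

Lemma le_of_derive (f df : R -> R) (a b : R) : a <= b ->
  (forall s, a <= s <= b -> is_derive s (1 : R) f (df s)) ->
  (forall s, a <= s <= b -> 0 <= df s) -> f a <= f b.
Proof.
move=> ab fd d0.
have cg : {within `[a, b], continuous f}.
  apply: derivable_within_continuous => s; rewrite in_itv /= => sab.
  by have [] := fd s sab.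
have [|c cab Hc] := @MVT_segment R f df a b ab _ cg.
  by move=> s; rewrite in_itv /= => /andP[s0 s1]; apply: fd; rewrite !ltW.
rewrite in_itv /= in cab.
by rewrite -subr_ge0 Hc mulr_ge0 ?subr_ge0 ?d0.
Qed.

(** Both [b - g] and [b + g] have nonnegative derivative. *)
Lemma mvt_compare (g b dg db : R -> R) (t : R) : 0 <= t ->
  (forall s, 0 <= s <= t -> is_derive s (1 : R) g (dg s)) ->
  (forall s, 0 <= s <= t -> is_derive s (1 : R) b (db s)) ->
  (forall s, 0 <= s <= t -> `|dg s| <= db s) ->
  `|g t - g 0| <= b t - b 0.
Proof.
move=> t0 gd bd gb.
have A : b 0 - g 0 <= b t - g t.
  apply: (@le_of_derive (fun s => b s - g s) (fun s => db s - dg s)) => // s st.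
    by apply: is_derive_sub; [exact: bd|exact: gd].
  by rewrite subr_ge0; apply: le_trans (gb s st); exact: ler_norm.
have B : b 0 + g 0 <= b t + g t.
  apply: (@le_of_derive (fun s => b s + g s) (fun s => db s + dg s)) => // s st.
    by apply: is_derive_add; [exact: bd|exact: gd].
  by rewrite -[dg s]opprK subr_ge0; apply: le_trans (gb s st); rewrite -normrN; exact: ler_norm.
by rewrite ler_norml; apply/andP; split; lra.
Qed.

Lemma eq_of_derive (f g df : R -> R) (t : R) :
  (forall s, `|s| <= `|t| -> is_derive s (1 : R) f (df s)) ->
  (forall s, `|s| <= `|t| -> is_derive s (1 : R) g (df s)) ->
  f 0 = g 0 -> f t = g t.
Proof.
move=> fd gd fg.
have H s : `|s| <= `|t| -> is_derive s (1 : R) (fun s => f s - g s) 0.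
  by move=> st; have := is_derive_sub (fd s st) (gd s st); rewrite subrr.
have key (F : R -> R) (r : R) : 0 <= r ->
    (forall s, 0 <= s <= r -> is_derive s (1 : R) F 0) -> F r = F 0.
  move=> r0 Fd; apply/eqP; rewrite -subr_eq0 -normr_le0.
  have /= := @mvt_compare F (cst 0) (cst 0) (cst 0) r r0 Fd (fun s _ => is_derive_cst 0 s 1).
  by rewrite subrr; apply => s _; rewrite normr0.
have fg0 : f 0 - g 0 = 0 by rewrite fg subrr.
apply/eqP; rewrite -subr_eq0 -fg0; apply/eqP; have [t0|t0] := leP 0 t.
  apply: (key (fun s => f s - g s)) => // s /andP[s0 st].
  by apply: H; rewrite !ger0_norm.
have := key (fun s => f (- s) - g (- s)) (- t); rewrite opprK oppr0; apply.
  by rewrite oppr_ge0 ltW.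
move=> s /andP[s0 st].
have := @is_derive_reverse (fun s => f s - g s) s 0; rewrite oppr0; apply.
by apply: H; rewrite normrN ger0_norm // ltr0_norm.
Qed.

Lemma antiderivative_bounded f (N : R) : continuous f ->
  exists F : R -> R, F 0 = 0 /\ forall t, `|t| < N -> is_derive t (1 : R) F (f t).
Proof.
move=> fc; have [N0|N0] := leP N 0.
  exists (cst 0); split => // t tN; have := le_lt_trans (normr_ge0 t) tN.
  by rewrite ltNge N0.
pose G (x : R) : R := (\int[lebesgue_measure]_(t in [set` `[(- N), x]%R]) f t)%R.
have Gd t : `|t| < N -> is_derive t (1 : R) G (f t).
  rewrite ltr_norml => /andP[t1 t2].
  have fi : (@lebesgue_measure R).-integrable `[(- N), N]%classic (EFin \o f).
    apply: continuous_compact_integrable; first exact: segment_compact.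
    by apply: continuous_subspaceT => x; exact: fc.
  have [H1 H2] := @continuous_FTC1_closed R f (- N) t N t2 fi t1 (fc t).
  rewrite derive1E in H2; exact: DeriveDef H1 H2.
exists (fun t => G t - G 0); split; first by rewrite subrr.
move=> t tN; have := is_derive_sub (Gd t tN) (is_derive_cst (G 0) t (1 : R)).
by rewrite subr0.
Qed.

(** Primitives on symmetric intervals, normalised at 0, agree on common intervals and therefore
    glue; at [t] an interval of integer radius beyond |t| is used. *)
Lemma antiderivative f : continuous f ->
  exists F : R -> R, F 0 = 0 /\ forall t, is_derive t (1 : R) F (f t).
Proof.
move=> fc.
have [G HG] := choice (fun N : nat => antiderivative_bounded N%:R fc).
have uniq N N' t : `|t| < N%:R -> `|t| < N'%:R -> G N t = G N' t.
  move=> tN tN'; have [G0 Gd] := HG N; have [G0' Gd'] := HG N'.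
  apply: (@eq_of_derive _ _ f) => [s st|s st|]; last by rewrite G0 G0'.
    by apply: Gd; exact: le_lt_trans tN.
  by apply: Gd'; exact: le_lt_trans tN'.
have bd t : `|t| < (Num.bound `|t|)%:R by exact: archi_boundP.
exists (fun t => G (Num.bound `|t|) t); split; first by have [] := HG (Num.bound `|0 : R|).
move=> t; pose N := Num.bound `|t|.
have [_ Gd] := HG N.
apply: near_eq_is_derive (Gd t (bd t)).
have : \forall s \near t, `|s| < N%:R.
  apply: (@open_nbhs_nbhs _ _ [set s | `|s| < N%:R]); split; last exact: bd.
  by apply: open_comp (@open_lt _ _) => x _; exact: norm_continuous.
by apply: filterS => s sN; exact: uniq.
Qed.

Lemma norm_derive_curve_continuous d (u : R -> 'rV[R]_d) du t :
  (forall j, is_derive t (1 : R) (fun s => u s 0 j) (du j)) -> {for t, continuous u}.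
Proof. by move=> ud; apply: continuous_rV => j; exact: is_derive_continuous (ud j). Qed.

Lemma is_derive_expR_scale (K t : R) : is_derive t (1 : R) (fun s => expR (K * s)) (K * expR (K * t)).
Proof. by apply: (@is_derive_scale expR); exact: is_derive_expR. Qed.

(** The norm of [u] need not be differentiable, so it is replaced by a primitive: |u| <= |u 0| + I
    with I' = K |u| + e. Then J = |u 0| + e / K + I satisfies J' <= K J, and [J s * expR (- K * s)]
    does not increase. *)
Lemma gronwall_pos d (u : R -> 'rV[R]_d) (du : R -> 'rV[R]_d) (K e T : R) : 0 < K -> 0 <= e ->
  (forall s j, is_derive s (1 : R) (fun s => u s 0 j) (du s 0 j)) ->
  (forall s, 0 <= s <= T -> `|du s| <= K * `|u s| + e) ->
  forall t, 0 <= t <= T -> `|u t| <= (`|u 0| + e / K) * expR (K * t).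
Proof.
move=> K0 e0 ud ub t /andP[t0 tT].
have uc : continuous u by move=> s; exact: norm_derive_curve_continuous (ud s).
have mc : continuous (fun s => K * `|u s| + e).
  move=> s; apply: (@continuousD _ _ _ (fun s => K * `|u s|) (cst e)); last exact: cst_continuous.
  apply: (@continuousM _ _ (cst K) (fun s => `|u s|)); first exact: cst_continuous.
  by apply: continuous_comp; [exact: uc|exact: norm_continuous].
have [I [I0 Id]] := antiderivative mc.
have uI s : 0 <= s <= T -> `|u s| <= `|u 0| + I s.
  move=> /andP[s0 sT].
  have I_ge0 : 0 <= I s.
    rewrite -I0; apply: (le_of_derive s0 (fun s _ => Id s)) => r _.
    by rewrite addr_ge0 // mulr_ge0 // ltW.
  apply: normr_le_coord; first by rewrite addr_ge0.
  move=> j; have /= := @mvt_compare (fun s => u s 0 j) I (fun s => du s 0 j) _ s s0 (fun r _ => ud r j) (fun r _ => Id r).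
  rewrite I0 subr0 => H.
  have {}H : `|u s 0 j - u 0 0 j| <= I s.
    apply: H => r /andP[r0 rs]; apply: le_trans (normr_coord _ _) _.
    by apply: ub; rewrite r0 (le_trans rs).
  rewrite -[X in `|X|](subrK (u 0 0 j)) addrC.
  by apply: le_trans (ler_normD _ _) _; rewrite lerD // normr_coord.
pose J s := `|u 0| + e / K + I s.
have Jd s : is_derive s (1 : R) J (K * `|u s| + e).
  have := is_derive_add (is_derive_cst (`|u 0| + e / K) s (1 : R)) (Id s).
  by rewrite add0r.
have Ed s : is_derive s (1 : R) (fun s => - (J s * expR (- K * s)))
    (K * (J s - `|u s| - e / K) * expR (- K * s)).
  have := is_derive_opp (is_derive_mul (Jd s) (is_derive_expR_scale (- K) s)).
  move=> H; apply: (is_derive_eq H).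
  by field; rewrite gt_eqF.
have := @le_of_derive (fun s => - (J s * expR (- K * s))) _ 0 t t0 (fun s _ => Ed s).
rewrite lerN2 mulr0 expR0 mulr1 => H.
have {}H : J t * expR (- K * t) <= J 0.
  apply: H => s /andP[s0 st]; rewrite mulr_ge0 ?expR_ge0 // mulr_ge0 ?(ltW K0) //.
  have := uI s; rewrite s0 (le_trans st) // => /(_ isT); rewrite /J; lra.
have := uI t; rewrite t0 tT => /(_ isT) ut.
apply: le_trans ut _; apply: (@le_trans _ _ (J t)).
  by rewrite /J lerD2r lerDl divr_ge0 // ltW.
move: H; rewrite {2}/J I0 addr0 mulNr expRN ler_pdivrMr ?expR_gt0 //.
Qed.

Lemma gronwall d (u : R -> 'rV[R]_d) (du : R -> 'rV[R]_d) (K e T : R) : 0 < K -> 0 <= e ->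
  (forall s j, is_derive s (1 : R) (fun s => u s 0 j) (du s 0 j)) ->
  (forall s, `|s| <= T -> `|du s| <= K * `|u s| + e) ->
  forall t, `|t| <= T -> `|u t| <= (`|u 0| + e / K) * expR (K * `|t|).
Proof.
move=> K0 e0 ud ub t tT; have [t0|t0] := leP 0 t.
  rewrite [X in K * X]ger0_norm //.
  apply: (gronwall_pos (T := T) K0 e0 ud); last by rewrite t0 -[t]ger0_norm.
  by move=> s /andP[s0 sT]; apply: ub; rewrite ger0_norm.
have := @gronwall_pos d (fun s => u (- s)) (fun s => - du (- s)) K e T K0 e0.
rewrite ltr0_norm // oppr0 => H; have := H _ _ (- t); rewrite opprK; apply.
- by move=> s j; rewrite mxE; apply: is_derive_reverse.
- by move=> s /andP[s0 sT]; rewrite normrN; apply: ub; rewrite normrN ger0_norm.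
- by rewrite oppr_ge0 ltW //= -ltr0_norm.
Qed.

Lemma geometric_small (B e : R) : 0 < e -> exists n, B / 2 ^+ n <= e.
Proof.
move=> e0; exists (Num.bound `|B / e|).
rewrite ler_pdivrMr ?exprn_gt0 // mulrC -ler_pdivrMr //.
apply: le_trans (ler_norm _) _; apply: le_trans (ltW (archi_boundP (normr_ge0 _))) _.
by rewrite -natrX ler_nat ltnW // ltn_expl.
Qed.

(** The limit is the supremum of the lower bounds [s n - B / 2 ^+ n]; each [s m + B / 2 ^+ m] bounds
    all of them from above. *)
Lemma geometric_limit (s : nat -> R) (B : R) :
  (forall m n, (n <= m)%N -> `|s m - s n| <= B / 2 ^+ n) ->
  exists l, forall n, `|l - s n| <= B / 2 ^+ n.
Proof.
move=> H.
have B0 n : 0 <= B / 2 ^+ n by apply: le_trans (H n n (leqnn _)).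
pose A : set R := range (fun n => s n - B / 2 ^+ n).
have ub m : ubound A (s m + B / 2 ^+ m).
  move=> _ [n _ <-]; have [nm|/ltnW mn] := leqP n m.
    have := H m n nm; rewrite ler_norml => /andP[h1 h2].
    have := B0 m; lra.
  have := H n m mn; rewrite ler_norml => /andP[h1 h2].
  have := B0 n; lra.
have A0 : A !=set0 by exists (s 0 - B / 2 ^+ 0), 0.
have As : has_sup A by split => //; exists (s 0 + B / 2 ^+ 0); exact: ub.
exists (sup A) => n; rewrite ler_norml; apply/andP; split.
  have : A (s n - B / 2 ^+ n) by exists n.
  by move=> /(sup_upper_bound As); lra.
have : sup A <= s n + B / 2 ^+ n by apply: ge_sup => //; exact: ub.
by lra.
Qed.

(** The hypothesis bounds the speed by the derivative of C exp(a |t|). With a equal to twice the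
    Lipschitz constant, this weight makes a Picard step contract by 1/2 on time intervals of any
    length. *)
Lemma exp_mvt_bound d (u du : R -> 'rV[R]_d) (C a T : R) : 0 <= C -> 0 < a -> u 0 = 0 ->
  (forall s j, is_derive s (1 : R) (fun s => u s 0 j) (du s 0 j)) ->
  (forall s, `|s| <= T -> `|du s| <= C * (a * expR (a * `|s|))) ->
  forall t, `|t| <= T -> `|u t| <= C * expR (a * `|t|).
Proof.
move=> C0 a0 u0 ud ub t tT.
have pos (v dv : R -> R) r : 0 <= r -> v 0 = 0 ->
    (forall s, is_derive s (1 : R) v (dv s)) ->
    (forall s, 0 <= s <= r -> `|dv s| <= C * (a * expR (a * s))) ->
    `|v r| <= C * expR (a * r).
  move=> r0 v0 vd vb.
  have bd s : is_derive s (1 : R) (fun s => C * expR (a * s)) (C * (a * expR (a * s))).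
    have H := is_derive_mul (is_derive_cst C s (1 : R)) (is_derive_expR_scale a s).
    by apply: (is_derive_eq H); rewrite mul0r add0r.
  have := mvt_compare r0 (fun s _ => vd s) (fun s _ => bd s) vb.
  rewrite v0 subr0 => /le_trans; apply.
  by rewrite gerDl oppr_le0 mulr_ge0 // expR_ge0.
apply: normr_le_coord; first by rewrite mulr_ge0 // expR_ge0.
move=> j; have [t0|t0] := leP 0 t.
  rewrite [X in a * X]ger0_norm //.
  apply: (pos (fun s => u s 0 j) (fun s => du s 0 j)) => //; first by rewrite u0 mxE.
  move=> s /andP[s0 st]; apply: le_trans (normr_coord _ _) _.
  have := ub s; rewrite (ger0_norm s0); apply.
  by rewrite (le_trans st) // -[t]ger0_norm.
rewrite [X in a * X]ltr0_norm //.
have := pos (fun s => u (- s) 0 j) (fun s => - du (- s) 0 j) (- t); rewrite opprK oppr0; apply.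
- by rewrite oppr_ge0 ltW.
- by rewrite u0 mxE.
- by move=> s; apply: (@is_derive_reverse (fun s => u s 0 j)).
- move=> s /andP[s0 st]; rewrite normrN; apply: le_trans (normr_coord _ _) _.
  have := ub (- s); rewrite normrN ger0_norm //; apply.
  by rewrite (le_trans st) // -ltr0_norm.
Qed.

Lemma continuous_bounded (f : R -> R) (T : R) : continuous f ->
  exists M, 0 <= M /\ forall t, `|t| <= T -> `|f t| <= M.
Proof.
move=> fc; have [T0|T0] := ltP T 0.
  by exists 0; split => // t tT; have := le_lt_trans tT T0; rewrite ltNge normr_ge0.
have TT : - T <= T by lra.
have [|c _ Hc] := @EVT_max R (fun t => `|f t|) (- T) T TT.
  by apply: continuous_subspaceT => x; apply: continuous_comp; [exact: fc|exact: norm_continuous].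
exists `|f c|; split => // t; rewrite ler_norml => tT; apply: Hc.
by rewrite in_itv.
Qed.

(** The constant is global in space but may grow with the time interval. This covers linear
    equations with continuous coefficients and yields solutions for all times. *)
Definition lipschitz_in_time d (G : R -> 'rV[R]_d -> 'rV[R]_d) := forall T : R, exists K : R,
  0 < K /\ forall t, `|t| <= T -> forall z z', `|G t z - G t z'| <= K * `|z - z'|.

Lemma ode_uniq d (G : R -> 'rV[R]_d -> 'rV[R]_d) (z z' : R -> 'rV[R]_d) :
  lipschitz_in_time G ->
  (forall t j, is_derive t (1 : R) (fun s => z s 0 j) (G t (z t) 0 j)) ->
  (forall t j, is_derive t (1 : R) (fun s => z' s 0 j) (G t (z' t) 0 j)) ->
  z 0 = z' 0 -> z =1 z'.
Proof.
move=> GL zd zd' z0 t; have [K [K0 HK]] := GL `|t|.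
have := @gronwall d (fun s => z s - z' s) (fun s => G s (z s) - G s (z' s)) K 0 `|t| K0 (lexx _).
rewrite z0 subrr normr0 add0r !mul0r => H.
apply/eqP; rewrite -subr_eq0 -normr_le0.
have {}H := H _ _ t (lexx _); rewrite mul0r in H; apply: H.
- move=> s j; rewrite !mxE.
  rewrite (_ : (fun s => _) = (fun s => z s 0 j - z' s 0 j)); last by apply/funext => r; rewrite !mxE.
  exact: is_derive_sub.
- by move=> s st; rewrite addr0; exact: HK.
Qed.

Lemma antiderivative_rV d (v : R -> 'rV[R]_d) : continuous v ->
  exists V : R -> 'rV[R]_d, V 0 = 0 /\ forall t j, is_derive t (1 : R) (fun s => V s 0 j) (v t 0 j).
Proof.
move=> vc.
have /choice[V HV] : forall j, exists F : R -> R, F 0 = 0 /\ forall t, is_derive t (1 : R) F (v t 0 j).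
  move=> j; apply: antiderivative => t.
  by apply: (@continuous_comp _ _ _ v (fun z : 'rV[R]_d => z 0 j)); [exact: vc|exact: continuous_entry].
exists (fun t => \row_j V j t); split; first by apply/rowP => j; rewrite !mxE; have [] := HV j.
move=> t j; rewrite (_ : (fun s => _) = V j); first by have [_] := HV j.
by apply/funext => s; rewrite mxE.
Qed.

(** Picard iteration, estimated on each [-T, T] in the norm weighted by exp(2 K |t|). Continuity of
    [G] is asked along continuous curves, which is the form in which the integral operator uses
    it. *)
Lemma picard d (G : R -> 'rV[R]_d -> 'rV[R]_d) (z0 : 'rV[R]_d) :
  (forall z : R -> 'rV[R]_d, continuous z -> continuous (fun t => G t (z t))) ->
  lipschitz_in_time G ->
  exists z : R -> 'rV[R]_d, z 0 = z0 /\
    forall t j, is_derive t (1 : R) (fun s => z s 0 j) (G t (z t) 0 j).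
Proof.
move=> Gc GL.
(* A total choice of primitives; for a discontinuous [v] the value is a dummy. *)
have /choice[A HA] : forall v : R -> 'rV[R]_d, exists V : R -> 'rV[R]_d, continuous v ->
    V 0 = 0 /\ forall t j, is_derive t (1 : R) (fun s => V s 0 j) (v t 0 j).
  move=> v; have [vc|vc] := pselect (continuous v); last by exists v.
  by have [V HV] := antiderivative_rV vc; exists V.
pose next (z : R -> 'rV[R]_d) t := z0 + A (fun s => G s (z s)) t.
have next0 z : continuous z -> next z 0 = z0.
  by move=> /Gc /HA[A0 _]; rewrite /next A0 addr0.
have nextd z t j : continuous z -> is_derive t (1 : R) (fun s => next z s 0 j) (G t (z t) 0 j).
  move=> /Gc /HA[_ Ad].
  rewrite (_ : (fun s => _) = (fun s => z0 0 j + A (fun s => G s (z s)) s 0 j)); last first.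
    by apply/funext => s; rewrite mxE.
  by have := is_derive_add (is_derive_cst (z0 0 j) t (1 : R)) (Ad t j); rewrite add0r.
have nextc z : continuous z -> continuous (next z).
  by move=> zc t; apply: norm_derive_curve_continuous => j; exact: nextd.
pose phi n := iter n next (fun=> z0).
have phic n : continuous (phi n).
  by elim: n => [|n IH]; [exact: cst_continuous|exact: nextc].
have phi0 n : phi n 0 = z0 by case: n => [//|n]; exact: next0.
have difd z z' t j : continuous z -> continuous z' ->
    is_derive t (1 : R) (fun s => (next z s - next z' s) 0 j) ((G t (z t) - G t (z' t)) 0 j).
  move=> zc zc'; rewrite !mxE (_ : (fun s => _) = (fun s => next z s 0 j - next z' s 0 j)).
    by apply: is_derive_sub; exact: nextd.
  by apply/funext => s; rewrite !mxE.
have cauchy (T : R) : exists B, forall t, `|t| <= T ->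
    forall m n, (n <= m)%N -> `|phi m t - phi n t| <= B / 2 ^+ n.
  have [K [K0 HK]] := GL T.
  have [M [M0 HM]] : exists M, 0 <= M /\ forall t, `|t| <= T -> `|phi 1 t - phi 0 t| <= M.
    have c : continuous (fun t => `|phi 1 t - phi 0 t|).
      move=> t; apply: continuous_comp; last exact: norm_continuous.
      by apply: (@continuousB _ _ _ (phi 1) (phi 0)); exact: phic.
    have [M [M0 HM]] := continuous_bounded T c.
    by exists M; split => // t /HM; rewrite normr_id.
  (* Each iteration multiplies by K through the Lipschitz bound and divides by 2 K through
     [exp_mvt_bound]. *)
  have step n t : `|t| <= T -> `|phi n.+1 t - phi n t| <= M / 2 ^+ n * expR (2 * K * `|t|).
    elim: n t => [|n IH] t tT.
      rewrite expr0 divr1; apply: le_trans (HM t tT) _; rewrite ler_peMr //.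
      by rewrite -expR0 ler_expR mulr_ge0 // mulr_ge0 // ltW.
    apply: (@exp_mvt_bound d (fun t => phi n.+2 t - phi n.+1 t) (fun t => G t (phi n.+1 t) - G t (phi n t)) (M / 2 ^+ n.+1) (2 * K) T _ _ _ _ _ t tT).
    - by rewrite divr_ge0 // exprn_ge0.
    - by rewrite mulr_gt0.
    - by rewrite !phi0 subrr.
    - by move=> s j; exact: (difd (phi n.+1) (phi n) s j (phic _) (phic _)).
    - move=> s sT; apply: le_trans (HK s sT _ _) _.
      apply: le_trans (ler_wpM2l (ltW K0) (IH s sT)) _.
      rewrite exprS invfM le_eqVlt; apply/orP; left; apply/eqP.
      by field; rewrite expf_neq0.
  pose B := 2 * (M * expR (2 * K * T)); exists B => t tT.
  have stepB n : `|phi n.+1 t - phi n t| <= B / 2 ^+ n.+1.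
    apply: le_trans (step n t tT) _.
    rewrite /B exprS invfM mulrACA divff // mul1r mulrAC ler_wpM2r ?invr_ge0 ?exprn_ge0 //.
    rewrite ler_wpM2l // ler_expR ler_wpM2l // mulr_ge0 // ltW //.
  have B0 : 0 <= B by rewrite !mulr_ge0 // expR_ge0.
  move=> m n /subnK <-; move: (m - n)%N => p {m}.
  suff : `|phi (p + n)%N t - phi n t| <= B / 2 ^+ n - B / 2 ^+ (p + n).
    by move/le_trans; apply; rewrite gerDl oppr_le0 divr_ge0 // exprn_ge0.
  elim: p => [|p IH]; first by rewrite !subrr normr0.
  rewrite addSn -(subrK (phi (p + n)%N t) (phi _ t)) -addrA.
  apply: le_trans (ler_normD _ _) _; apply: le_trans (lerD (stepB _) IH) _.
  have -> : B / 2 ^+ (p + n) = B / 2 ^+ (p + n).+1 + B / 2 ^+ (p + n).+1.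
    by rewrite exprS; field; rewrite expf_neq0.
  by rewrite le_eqVlt; apply/orP; left; apply/eqP; ring.
have /choice[z Hz] : forall t, exists l, exists B, forall n, `|l - phi n t| <= B / 2 ^+ n.
  move=> t; have [B HB] := cauchy `|t|.
  have /choice[l Hl] : forall j, exists l, forall n, `|l - phi n t 0 j| <= B / 2 ^+ n.
    move=> j; apply: geometric_limit => m n nm.
    apply: le_trans (HB t (lexx _) m n nm).
    by have := normr_coord (phi m t - phi n t) j; rewrite !mxE.
  exists (\row_j l j), B => n; apply: normr_le_coord.
    by apply: le_trans (HB t (lexx _) n n (leqnn _)).
  by move=> j; rewrite !mxE.
(* The constant [B'] attached to the limit at [t] depends on [t]. Comparing through an iterate of
   index [maxn n p], with [p] so large that the contribution of [B'] is below [e], leaves the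
   uniform constant. *)
have unif (T : R) : exists B, 0 <= B /\ forall t, `|t| <= T -> forall n, `|z t - phi n t| <= B / 2 ^+ n.
  have [B HB] := cauchy T; exists `|B|; split => // t tT n.
  have [B' HB'] := Hz t.
  apply/ler_addgt0Pr => e e0; have [p Hp] := geometric_small B' e0.
  rewrite -(subrK (phi (maxn n p) t) (z t)) -addrA addrC.
  apply: le_trans (ler_normD _ _) _; apply: lerD.
    apply: le_trans (HB t tT _ n (leq_maxl _ _)) _.
    by rewrite ler_wpM2r ?invr_ge0 ?exprn_ge0 // ler_norm.
  have B'0 : 0 <= B'.
    by have := le_trans (normr_ge0 _) (HB' 0); rewrite expr0 divr1.
  apply: le_trans (HB' _) _; apply: le_trans Hp; rewrite ler_wpM2l //.
  by rewrite lef_pV2 ?posrE ?exprn_gt0 // ler_eXn2l ?ltr1n // leq_maxr.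
have zc : continuous z.
  move=> t; apply/cvgrPdist_le => e e0; have [B [B0 HB]] := unif (`|t| + 1).
  have e3 : 0 < e / 3 by rewrite divr_gt0.
  have [n Hn] := geometric_small B e3.
  have near1 : \forall s \near t, `|s| <= `|t| + 1.
    have : \forall s \near t, `|t - s| <= 1.
      by have /cvgrPdist_le/(_ 1 ltr01) := @cvg_id _ (nbhs t).
    apply: filterS => s; rewrite distrC => ts; rewrite -(subrK t s) addrC.
    by apply: le_trans (ler_normD _ _) _; rewrite lerD2l.
  have near2 : \forall s \near t, `|phi n t - phi n s| <= e / 3.
    by have /cvgrPdist_le/(_ _ e3) := phic n t.
  apply: filterS2 near1 near2 => s s1 s2.
  rewrite (_ : z t - z s = (z t - phi n t) + (phi n t - phi n s) - (z s - phi n s)); last first.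
    by apply/rowP => j; rewrite !mxE; ring.
  apply: le_trans (ler_normB _ _) _; apply: le_trans (lerD (ler_normD _ _) (lexx _)) _.
  have h1 : `|z t - phi n t| <= e / 3.
    by apply: le_trans Hn; apply: HB; rewrite lerDl.
  have h2 : `|z s - phi n s| <= e / 3 by apply: le_trans Hn; exact: HB.
  by lra.
(* The iterate [phi n.+1] is within O(2^-n) of both [z] and [next z]. *)
have zE t : z t = next z t.
  have [B [B0 HB]] := unif `|t|.
  have [K [K0 HK]] := GL `|t|.
  apply/eqP; rewrite -subr_eq0 -normr_le0; apply/ler_addgt0Pr => e e0; rewrite add0r.
  have [n Hn] := geometric_small (B + K * B * expR (1 * `|t|)) e0.
  rewrite -(subrK (phi n.+1 t) (z t)) -addrA.
  apply: le_trans (ler_normD _ _) _; apply: le_trans Hn; rewrite mulrDl; apply: lerD.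
    apply: le_trans (HB t (lexx _) _) _.
    by rewrite ler_wpM2l // lef_pV2 ?posrE ?exprn_gt0 // ler_eXn2l ?ltr1n.
  rewrite mulrAC.
  apply: (@exp_mvt_bound d (fun t => phi n.+1 t - next z t) (fun t => G t (phi n t) - G t (z t)) (K * B / 2 ^+ n) 1 `|t|
    _ ltr01 _ _ _ t (lexx _)).
  - by rewrite divr_ge0 ?exprn_ge0 // mulr_ge0 // ltW.
  - by rewrite phi0 next0 // subrr.
  - by move=> s j; exact: (difd (phi n) z s j (phic _) zc).
  - move=> s sT; apply: le_trans (HK s sT _ _) _.
    rewrite mul1r mul1r -mulrA -mulrA ler_wpM2l ?(ltW K0) //.
    rewrite mulrA distrC; apply: le_trans (HB s sT n) _.
    rewrite ler_peMr ?divr_ge0 ?exprn_ge0 //.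
    by rewrite -expR0 ler_expR.
exists z; split; first by rewrite zE next0.
move=> t j; rewrite (_ : (fun s => _) = (fun s => next z s 0 j)); first exact: nextd.
by apply/funext => s; rewrite zE.
Qed.

End ODE.

(** * Smooth dependence of a flow on the initial point *)

Section Flow.
Context {R : realType}.

Definition mxsum_norm m n (A : 'M[R]_(m, n)) : R := \sum_p \sum_j `|A p j|.

Lemma normr_mulmx_row m n (w : 'rV[R]_m) (A : 'M[R]_(m, n)) :
  `|w *m A| <= `|w| * mxsum_norm A.
Proof.
apply: normr_le_coord => [|j]; first by rewrite mulr_ge0 // sumr_ge0 // => p _; exact: sumr_ge0.
rewrite mxE mulr_sumr; apply: le_trans (ler_norm_sum _ _ _) _.
apply: ler_sum => p _; rewrite normrM; apply: ler_pM => //; first exact: normr_coord.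
by rewrite (bigD1 j) //= lerDl sumr_ge0.
Qed.

Lemma continuous_bigsum (T : topologicalType) (I : Type) (r : seq I) (F : I -> T -> R) :
  (forall i, continuous (F i)) -> continuous (fun t => \sum_(i <- r) F i t).
Proof.
move=> Fc; elim: r => [|a r IH].
  by under eq_fun do rewrite big_nil; exact: cst_continuous.
under eq_fun do rewrite big_cons.
by move=> t; apply: (@continuousD _ _ _ (F a)); [exact: Fc|exact: IH].
Qed.

(** The tube lemma for a compact time interval; it makes local estimates uniform in [s]. *)
Lemma compact_time (Q : Type) (F : set_system Q) (FF : Filter F) (T : R) (P : R -> Q -> Prop) :
  (forall s0, `|s0| <= T -> \forall s \near s0 & q \near F, P s q) ->
  \forall q \near F, forall s, `|s| <= T -> P s q.
Proof.
move=> H.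
have /compact_near_coveringP C : compact `[(- T), T]%classic by exact: segment_compact.
have {}C := C Q F (fun q s => P s q) FF.
have : \forall q \near F, `[(- T), T]%classic `<=` (fun s => P s q).
  by apply: C => s; rewrite /= in_itv /= -ler_norml => /H.
by apply: filterS => q Hq s sT; apply: Hq; rewrite /= in_itv /= -ler_norml.
Qed.

Lemma near_joint (X : topologicalType) (f : R * X -> R) (s0 : R) (x0 : X) (e : R) : continuous f -> 0 < e ->
  \forall s \near s0 & x \near x0, `|f (s, x) - f (s, x0)| <= e.
Proof.
move=> fc e0.
have e2 : 0 < e / 2 by rewrite divr_gt0.
have /cvgrPdist_le/(_ _ e2) H := fc (s0, x0).
have [[A B] /= [nA nB] AB] := H.
exists (A, B) => //= -[s x] /= [As Bx].
rewrite -(subrK (f (s0, x0)) (f (s, x))) -addrA.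
apply: le_trans (ler_normD _ _) _; rewrite [e]splitr; apply: lerD.
  by rewrite distrC; apply: (AB (s, x)).
by apply: (AB (s, x0)); split => //=; exact: nbhs_singleton.
Qed.

(** The difference [wq q - w] solves a linear equation with source [w *m (Aq q - A)], so Gronwall
    applies. The filter is arbitrary because the lemma serves twice: for nearby initial data, and
    for difference quotients as the increment tends to 0. Continuity in time is asked of [A] and not
    of [Aq], whose entries in the second use come from mean value points chosen without
    regularity. *)
Lemma linear_ode_dependence d (Q : Type) (F : set_system Q) (FF : Filter F) (T : R)
    (w : R -> 'rV[R]_d) (A : R -> 'M[R]_d) (wq : Q -> R -> 'rV[R]_d) (Aq : Q -> R -> 'M[R]_d) :
  (forall s j, is_derive s (1 : R) (fun s => w s 0 j) ((w s *m A s) 0 j)) ->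
  (forall p j, continuous (fun s => A s p j)) ->
  (\forall q \near F, forall s j, is_derive s (1 : R) (fun s => wq q s 0 j) ((wq q s *m Aq q s) 0 j)) ->
  (forall e : R, 0 < e -> \forall q \near F, forall s, `|s| <= T -> forall p j, `|Aq q s p j - A s p j| <= e) ->
  (forall e : R, 0 < e -> \forall q \near F, `|wq q 0 - w 0| <= e) ->
  forall e : R, 0 < e -> \forall q \near F, forall s, `|s| <= T -> `|wq q s - w s| <= e.
Proof.
move=> wd Ac wqd AqA wq0 e e0.
have wc : continuous w by move=> s; exact: norm_derive_curve_continuous (wd s).
have [M [M0 HM]] : exists M, 0 <= M /\ forall s, `|s| <= T -> `|w s| <= M.
  have c : continuous (fun t => `|w t|).
    by move=> t; apply: continuous_comp; [exact: wc|exact: norm_continuous].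
  have [M [M0 HM]] := continuous_bounded T c.
  by exists M; split => // t /HM; rewrite normr_id.
have [K0 [K00 HK]] : exists K, 0 <= K /\ forall s, `|s| <= T -> mxsum_norm (A s) <= K.
  have c : continuous (fun t => mxsum_norm (A t)).
    move=> t; rewrite /mxsum_norm.
    apply: (continuous_bigsum (F := fun p t => \sum_j `|A t p j|)) => p {}t.
    apply: (continuous_bigsum (F := fun j t => `|A t p j|)) => j {}t.
    by apply: (@continuous_comp _ _ _ (fun t => A t p j) Num.norm); [exact: Ac|exact: norm_continuous].
  have [M' [M'0 HM']] := continuous_bounded T c.
  by exists M'; split => // t /HM'; apply: le_trans; exact: ler_norm.
pose D : R := (d * d)%:R.
have D0 : 0 <= D by rewrite ler0n.
(* [K0] bounds [A]; [D], the number of entries, bounds [Aq q - A] once these are at most 1; the last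
   1 makes [K] positive. *)
pose K := K0 + D + 1.
have Kgt : 0 < K by rewrite /K; lra.
(* Gronwall's bound when the initial error and the entrywise coefficient error are at most 1; errors
   of size [e1] then contribute at most [e1 * C]. *)
pose C := (1 + M * D / K) * expR (K * `|T|).
have C0 : 0 < C.
  apply: mulr_gt0; last exact: expR_gt0.
  by apply: ltr_wpDr => //; rewrite divr_ge0 ?(ltW Kgt) // mulr_ge0.
pose e1 := Num.min 1 (e / C).
have e10 : 0 < e1 by rewrite lt_min ltr01 divr_gt0.
near=> q => s sT.
have qd : forall s j, is_derive s (1 : R) (fun s => wq q s 0 j) ((wq q s *m Aq q s) 0 j).
  by near: q.
have qA : forall s, `|s| <= T -> forall p j, `|Aq q s p j - A s p j| <= e1 by near: q; exact: AqA.
have q0 : `|wq q 0 - w 0| <= e1 by near: q; exact: wq0.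
have dif s' : `|s'| <= T -> mxsum_norm (Aq q s' - A s') <= D * e1.
  move=> s'T; rewrite /mxsum_norm /D natrM -mulrA.
  apply: (@le_trans _ _ (\sum_(p < d) \sum_(j < d) e1)).
    by apply: ler_sum => p _; apply: ler_sum => j _; rewrite !mxE; exact: qA.
  by rewrite !sumr_const !card_ord mulrA -natrM mulr_natl mulrnA.
have := @gronwall R d (fun s => wq q s - w s) (fun s => wq q s *m Aq q s - w s *m A s) K (M * (D * e1)) T Kgt.
move=> H; have {}H := H _ _ _ s sT.
apply: le_trans (H _ _ _) _.
- by rewrite mulr_ge0 // mulr_ge0 // ltW.
- move=> r j; rewrite !mxE.
  rewrite (_ : (fun s => _) = (fun s => wq q s 0 j - w s 0 j)); last by apply/funext => y; rewrite !mxE.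
  apply: is_derive_sub; first by have := qd r j; rewrite mxE.
  by have := wd r j; rewrite mxE.
- move=> r rT.
  have -> : wq q r *m Aq q r - w r *m A r = (wq q r - w r) *m A r + ((wq q r - w r) *m (Aq q r - A r) + w r *m (Aq q r - A r)).
    by rewrite -mulmxDl subrK mulmxBl mulmxBr [RHS]addrC addrA subrK.
  apply: le_trans (ler_normD _ _) _; apply: le_trans (lerD (lexx _) (ler_normD _ _)) _.
  rewrite addrA; apply: lerD; last first.
    apply: le_trans (normr_mulmx_row _ _) _; apply: ler_pM => //; first by rewrite sumr_ge0 // => p _; exact: sumr_ge0.
      exact: HM.
    exact: dif.
  rewrite mulrC; apply: le_trans (lerD (normr_mulmx_row _ _) (normr_mulmx_row _ _)) _.
  rewrite -mulrDr ler_wpM2l //.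
  have := HK r rT; have := dif r rT.
  have : D * e1 <= D by rewrite -[leRHS]mulr1 ler_wpM2l // ge_min lexx.
  by rewrite /K; lra.
apply: (@le_trans _ _ (e1 * C)); last first.
  by rewrite -ler_pdivlMr // ge_min lexx orbT.
rewrite /C mulrA mulrDr mulr1; apply: ler_pM => //.
- by rewrite addr_ge0 // divr_ge0 ?(ltW Kgt) // mulr_ge0 // mulr_ge0 // ltW.
- by rewrite lerD // (_ : M * (D * e1) / K = e1 * (M * D / K)) //; ring.
- rewrite ler_expR ler_wpM2l ?(ltW Kgt) //.
  by apply: le_trans sT _; exact: ler_norm.
Unshelve. all: by end_near. Qed.

Definition is_flow d (W : 'rV[R]_d -> 'rV[R]_d) (Phi : R -> 'rV[R]_d -> 'rV[R]_d) :=
  [/\ forall x, Phi 0 x = x,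
      forall x t j, is_derive t (1 : R) (fun s => Phi s x 0 j) (W (Phi t x) 0 j) &
      continuous (fun p : R * 'rV[R]_d => Phi p.1 p.2)].

(** Row convention: [v *m jacm W x] is the derivative of [W] along [v]. *)
Definition jacm m n (W : 'rV[R]_m -> 'rV[R]_n) (x : 'rV[R]_m) : 'M[R]_(m, n) :=
  \matrix_(p, j) partial p (fun y => W y 0 j) x.

Lemma continuous_pair_rV d (Phi : R * 'rV[R]_d -> R) (X : topologicalType) (s : X -> R)
    (y : X -> 'rV[R]_d) (x : X) : {for (s x, y x), continuous Phi} -> {for x, continuous s} ->
  {for x, continuous y} -> {for x, continuous (fun x => Phi (s x, y x))}.
Proof.
move=> Pc sc yc; apply: (@continuous_comp _ _ _ (fun x => (s x, y x)) Phi) => //.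
exact: (cvg_pair sc yc).
Qed.

Section Variation.
Variables (d : nat) (W : 'rV[R]_d -> 'rV[R]_d) (Phi : R -> 'rV[R]_d -> 'rV[R]_d).
Hypothesis Ws : forall j, smooth setT (fun x => W x 0 j).
Hypothesis PhiW : is_flow W Phi.

Let Wd p j x : derivable (fun y => W y 0 j) x (delta_mx 0 p).
Proof. by apply: (C_derivable (Ws j 1)). Qed.

Let Wc p j : continuous (partial p (fun y => W y 0 j)).
Proof. by move=> x; apply: (C_cont (@C_partial _ _ _ _ _ p (Ws j 1))). Qed.

Lemma continuous_flow_coord (j : 'I_d) : continuous (fun p : R * 'rV[R]_d => Phi p.1 p.2 0 j).
Proof.
case: PhiW => _ _ Pc p.
by apply: (@continuous_comp _ _ _ (fun p : R * 'rV[R]_d => Phi p.1 p.2) (fun z : 'rV[R]_d => z 0 j)); [exact: Pc|exact: continuous_entry].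
Qed.

Lemma continuous_jacm_flow p j : continuous (fun q : R * 'rV[R]_d => jacm W (Phi q.1 q.2) p j).
Proof.
case: PhiW => _ _ Pc q.
rewrite (_ : (fun q => _) = partial p (fun y => W y 0 j) \o (fun q => Phi q.1 q.2)); last first.
  by apply/funext => r; rewrite mxE.
by apply: continuous_comp; [exact: Pc|exact: Wc].
Qed.

Lemma continuous_jacm_curve p j x : continuous (fun s => jacm W (Phi s x) p j).
Proof.
move=> s; apply: (@continuous_pair_rV _ (fun q => jacm W (Phi q.1 q.2) p j) _ id (fun=> x)).
- exact: continuous_jacm_flow.
- exact: cvg_id.
- exact: cst_continuous.
Qed.

(** [Psi] solves the variational equation along each flow line. It is linear with coefficients
    continuous in time, hence Lipschitz on every bounded time interval. *)
Lemma variation_exists : exists Psi : R -> 'rV[R]_d -> 'rV[R]_d -> 'rV[R]_d,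
  (forall x v, Psi 0 x v = v) /\
  forall x v t j, is_derive t (1 : R) (fun s => Psi s x v 0 j) ((Psi t x v *m jacm W (Phi t x)) 0 j).
Proof.
suff /choice[Psi HPsi] : forall xv : 'rV[R]_d * 'rV[R]_d, exists z : R -> 'rV[R]_d, z 0 = xv.2 /\
    forall t j, is_derive t (1 : R) (fun s => z s 0 j) ((z t *m jacm W (Phi t xv.1)) 0 j).
  exists (fun s x v => Psi (x, v) s); split=> [x v|x v t j].
    by have [] := HPsi (x, v).
  by have [_] := HPsi (x, v); apply.
move=> [x v] /=; apply: (picard (G := fun t w => w *m jacm W (Phi t x))).
  move=> z zc t; apply: continuous_rV => j.
  rewrite (_ : (fun s => _) = (fun s => \sum_p z s 0 p * jacm W (Phi s x) p j)); last first.
    by apply/funext => s; rewrite mxE.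
  apply: (continuous_bigsum (F := fun p s => z s 0 p * jacm W (Phi s x) p j)) => p {}t.
  apply: (@continuousM _ _ (fun s => z s 0 p)); last exact: continuous_jacm_curve.
  by apply: (@continuous_comp _ _ _ z (fun y : 'rV[R]_d => y 0 p)); [exact: zc|exact: continuous_entry].
move=> T.
have c : continuous (fun t => mxsum_norm (jacm W (Phi t x))).
  move=> t; rewrite /mxsum_norm.
  apply: (continuous_bigsum (F := fun p t => \sum_j `|jacm W (Phi t x) p j|)) => p {}t.
  apply: (continuous_bigsum (F := fun j t => `|jacm W (Phi t x) p j|)) => j {}t.
  by apply: (@continuous_comp _ _ _ (fun t => jacm W (Phi t x) p j) Num.norm); [exact: continuous_jacm_curve|exact: norm_continuous].
have [M [M0 HM]] := continuous_bounded T c.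
exists (M + 1); split; first by rewrite ltr_wpDl.
move=> t tT z z'; rewrite -mulmxBl; apply: le_trans (normr_mulmx_row _ _) _.
rewrite mulrC ler_wpM2r //; apply: le_trans (ler_norm _) _.
by apply: le_trans (HM t tT) _; rewrite lerDl.
Qed.

Variable Psi : R -> 'rV[R]_d -> 'rV[R]_d -> 'rV[R]_d.
Hypothesis Psi0 : forall x v, Psi 0 x v = v.
Hypothesis Psid : forall x v t j,
  is_derive t (1 : R) (fun s => Psi s x v 0 j) ((Psi t x v *m jacm W (Phi t x)) 0 j).

(** The base point and the initial vector are packed into a single parameter. Dependence on it is
    uniform on bounded times, so continuity in time at the fixed parameter [z0] is enough for joint
    continuity. *)
Lemma continuous_variation :
  continuous (fun p : R * 'rV[R]_(d + d) => Psi p.1 (lsubmx p.2) (rsubmx p.2)).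
Proof.
move=> [t0 z0]; apply/cvgrPdist_le => e e0 /=.
have e2 : 0 < e / 2 by rewrite divr_gt0.
have H : \forall z \near z0, forall s, `|s| <= `|t0| + 1 ->
    `|Psi s (lsubmx z) (rsubmx z) - Psi s (lsubmx z0) (rsubmx z0)| <= e / 2.
  apply: (@linear_ode_dependence d _ (nbhs z0) _ (`|t0| + 1) (fun s => Psi s (lsubmx z0) (rsubmx z0))
    (fun s => jacm W (Phi s (lsubmx z0))) (fun z s => Psi s (lsubmx z) (rsubmx z))
    (fun z s => jacm W (Phi s (lsubmx z)))) => //.
  - by move=> p j; exact: continuous_jacm_curve.
  - by apply: filterE => z s j; exact: Psid.
  - move=> e1 e10; apply: compact_time => s0 _.
    have : forall p j, \forall s \near s0 & z \near z0, `|jacm W (Phi s (lsubmx z)) p j - jacm W (Phi s (lsubmx z0)) p j| <= e1.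
      move=> p j; apply: (@near_joint _ (fun q : R * 'rV[R]_(d + d) => jacm W (Phi q.1 (lsubmx q.2)) p j)) => //.
      move=> q; apply: (@continuous_pair_rV _ (fun q => jacm W (Phi q.1 q.2) p j) _ fst (fun q => lsubmx q.2)).
      + exact: continuous_jacm_flow.
      + exact: cvg_fst.
      + by apply: continuous_comp; [exact: cvg_snd|exact: continuous_lsubmx].
    move=> K.
    have := @near_all _ (s0, z0) _ (fun p (q : R * 'rV[R]_(d + d)) => forall j, `|jacm W (Phi q.1 (lsubmx q.2)) p j - jacm W (Phi q.1 (lsubmx z0)) p j| <= e1).
    apply => p.
    apply: (@near_all _ (s0, z0) _ (fun j (q : R * 'rV[R]_(d + d)) => `|jacm W (Phi q.1 (lsubmx q.2)) p j - jacm W (Phi q.1 (lsubmx z0)) p j| <= e1)) => j.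
    exact: K.
  - move=> e1 e10; have := @continuous_rsubmx R 1 d d z0 => /cvgrPdist_le/(_ _ e10).
    by apply: filterS => z; rewrite !Psi0 distrC.
have near1 : \forall s \near t0, `|s| <= `|t0| + 1.
  have : \forall s \near t0, `|t0 - s| <= 1.
    by have /cvgrPdist_le/(_ 1 ltr01) := @cvg_id _ (nbhs t0).
  apply: filterS => s; rewrite distrC => ts; rewrite -(subrK t0 s) addrC.
  by apply: le_trans (ler_normD _ _) _; rewrite lerD2l.
have near2 : \forall s \near t0, `|Psi t0 (lsubmx z0) (rsubmx z0) - Psi s (lsubmx z0) (rsubmx z0)| <= e / 2.
  have := norm_derive_curve_continuous (u := fun s => Psi s (lsubmx z0) (rsubmx z0)) (Psid (lsubmx z0) (rsubmx z0) t0).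
  by move=> /cvgrPdist_le/(_ _ e2).
have near12 := @filterI _ (nbhs t0) _ _ _ near1 near2.
exists ([set s | `|s| <= `|t0| + 1 /\ `|Psi t0 (lsubmx z0) (rsubmx z0) - Psi s (lsubmx z0) (rsubmx z0)| <= e / 2], [set z | forall s, `|s| <= `|t0| + 1 ->
    `|Psi s (lsubmx z) (rsubmx z) - Psi s (lsubmx z0) (rsubmx z0)| <= e / 2]); first by split; [exact: near12|exact: H].
move=> [s z] /= [[s1 s2] Hz].
rewrite -(subrK (Psi s (lsubmx z0) (rsubmx z0)) (Psi t0 _ _)) -addrA.
apply: le_trans (ler_normD _ _) _; rewrite [e]splitr; apply: lerD => //.
by rewrite distrC; exact: Hz.
Qed.

(** The difference quotient [wq h] of the flow itself solves a linear equation: by the mean value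
    theorem its coefficients [Aq h] are partial derivatives of [W] at points between the two flow
    lines. They tend uniformly to those of the variational equation, so [wq h] tends to [Psi]. *)
Lemma is_derive_flow x v t j : is_derive x v (fun y => Phi t y 0 j) (Psi t x v 0 j).
Proof.
have [P0 Pd Pc] := PhiW.
pose y (h : R) : 'rV[R]_d := h *: v + x.
have /choice[xi Hxi] : forall hsj : R * R * 'I_d, exists xi : 'I_d -> 'rV[R]_d,
    (forall p, `|xi p - Phi hsj.1.2 x| <= `|Phi hsj.1.2 (y hsj.1.1) - Phi hsj.1.2 x|) /\
    W (Phi hsj.1.2 (y hsj.1.1)) 0 hsj.2 - W (Phi hsj.1.2 x) 0 hsj.2 =
     \sum_p (Phi hsj.1.2 (y hsj.1.1) 0 p - Phi hsj.1.2 x 0 p) * partial p (fun y => W y 0 hsj.2) (xi p).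
  move=> [[h s] k] /=.
  apply: (@mvt_box R d (fun y => W y 0 k) (Phi s x) (Phi s (y h))) => z _ p.
  exact: Wd.
pose Aq (h s : R) : 'M[R]_d := \matrix_(p, k) partial p (fun y => W y 0 k) (xi (h, s, k) p).
pose wq (h s : R) := h^-1 *: (Phi s (y h) - Phi s x).
have main (e : R) : 0 < e -> \forall h \near (0 : R)^', forall s, `|s| <= `|t| -> `|wq h s - Psi s x v| <= e.
  apply: (@linear_ode_dependence d _ ((0 : R)^') _ `|t| (fun s => Psi s x v)
    (fun s => jacm W (Phi s x)) wq Aq) => //.
  - by move=> p k; exact: continuous_jacm_curve.
  - apply: filterE => h s k.
    have -> : (wq h s *m Aq h s) 0 k = h^-1 * (W (Phi s (y h)) 0 k - W (Phi s x) 0 k).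
      have [_ ->] := Hxi (h, s, k); rewrite /= mxE mulr_sumr; apply: eq_bigr => p _.
      by rewrite !mxE mulrA.
    rewrite (_ : (fun s0 => _) = (fun s => h^-1 * (Phi s (y h) 0 k - Phi s x 0 k))); last first.
      by apply/funext => r; rewrite !mxE.
    have := is_derive_mul (is_derive_cst h^-1 s (1 : R)) (is_derive_sub (Pd (y h) s k) (Pd x s k)).
    by rewrite mul0r add0r.
  - move=> e1 e10; apply: compact_time => s0 _.
    have e2 : 0 < e1 / 2 by rewrite divr_gt0.
    have /nbhs_ballP[r /= r0 Hr] : \forall z \near (Phi s0 x), forall p k,
        `|partial p (fun y => W y 0 k) (Phi s0 x) - partial p (fun y => W y 0 k) z| <= e1 / 2.
      apply: (@near_all _ _ _ (fun p z => forall k, `|partial p (fun y => W y 0 k) (Phi s0 x) - partial p (fun y => W y 0 k) z| <= e1 / 2)) => p.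
      apply: (@near_all _ _ _ (fun k z => `|partial p (fun y => W y 0 k) (Phi s0 x) - partial p (fun y => W y 0 k) z| <= e1 / 2)) => k.
      by have /cvgrPdist_le/(_ _ e2) := @Wc p k (Phi s0 x).
    (* Both flow lines stay within r/4 of [Phi s0 x], and a mean value point is at most r/2 from
       [Phi s x]; in total 3r/4 < r. *)
    have r4 : 0 < r / 4 by rewrite divr_gt0.
    have yc : {for (0 : R), continuous y}.
      apply: (@continuousD _ _ _ (fun h : R => h *: v) (fun=> x)); last exact: cst_continuous.
      exact: scalel_continuous.
    have joint : continuous_at (s0, (0 : R)) (fun q : R * R => Phi q.1 (y q.2)).
      apply: (@continuous_comp _ _ _ (fun q : R * R => (q.1, y q.2)) (fun q : R * 'rV[R]_d => Phi q.1 q.2)); last exact: Pc.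
      have cf : {for (s0, (0 : R)), continuous (@fst R R)} by exact: cvg_fst.
      have cs : {for (s0, (0 : R)), continuous (y \o @snd R R)}.
        by apply: continuous_comp; [exact: cvg_snd|exact: yc].
      exact: (cvg_pair cf cs).
    have [[A B] /= [nA nB] AB] : \forall q \near (s0, (0 : R)), `|Phi s0 x - Phi q.1 (y q.2)| <= r / 4.
      by move: joint => /cvgrPdist_le/(_ _ r4); rewrite /= /y scale0r add0r.
    exists (A, B) => //=; first by split => //; apply: nbhs_dnbhs.
    move=> [s h] /= [As Bh] p k.
    have c1 : `|Phi s0 x - Phi s x| <= r / 4.
      have := AB (s, 0); rewrite /= /y scale0r add0r; apply; split => //=; exact: nbhs_singleton.
    have c2 : `|Phi s0 x - Phi s (y h)| <= r / 4 by apply: (AB (s, h)).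
    have [c3 _] := Hxi (h, s, k).
    rewrite !mxE -(subrK (partial p (fun y => W y 0 k) (Phi s0 x)) (partial p _ (xi _ _))) -addrA.
    apply: le_trans (ler_normD _ _) _; rewrite [e1]splitr; apply: lerD.
      rewrite distrC; apply: Hr; rewrite -ball_normE /=.
      rewrite -(subrK (Phi s x) (Phi s0 x)) -addrA; apply: le_lt_trans (ler_normD _ _) _.
      have := c3 p; rewrite /= => c3p.
      have c4 : `|Phi s (y h) - Phi s x| <= r / 4 + r / 4.
        rewrite -(subrK (Phi s0 x) (Phi s (y h))) -addrA; apply: le_trans (ler_normD _ _) _.
        by rewrite distrC lerD.
      rewrite distrC in c3p; have := le_trans c3p c4; lra.
    by apply: Hr; rewrite -ball_normE /=; lra.
  - move=> e1 e10; near=> h.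
    have h0 : h != 0 by near: h; exact: nbhs_dnbhs_neq.
    by rewrite /wq !P0 Psi0 /y addrK scalerA mulVf // scale1r subrr normr0 ltW.
have lim : (fun h : R => h^-1 *: (Phi t (h *: v + x) 0 j - Phi t x 0 j)) @ (0 : R)^' --> Psi t x v 0 j.
  apply/cvgrPdist_le => e e0; apply: filterS (main e e0) => h /(_ t (lexx _)).
  apply: le_trans; rewrite distrC.
  by have := normr_coord (wq h t - Psi t x v) j; rewrite !mxE.
split; first by apply/cvg_ex; exists (Psi t x v 0 j).
exact: cvg_lim.
Unshelve. all: by end_near. Qed.

End Variation.

Definition tangent_field d (W : 'rV[R]_d -> 'rV[R]_d) (z : 'rV[R]_(d + d)) : 'rV[R]_(d + d) :=
  row_mx (W (lsubmx z)) (rsubmx z *m jacm W (lsubmx z)).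

Lemma tangent_field_smooth d (W : 'rV[R]_d -> 'rV[R]_d) :
  (forall j, smooth setT (fun x => W x 0 j)) ->
  forall j, smooth setT (fun z => tangent_field W z 0 j).
Proof.
move=> Ws j k; rewrite -(splitK j); case: (fintype.split j) => a /=.
  rewrite (_ : (fun z => _) = (fun z => W (lsubmx z) 0 a)); last first.
    by apply/funext => z; rewrite /tangent_field row_mxEl.
  apply: (@C_comp R _ _ k setT setT lsubmx (fun x => W x 0 a)) => //; try exact: openT.
  move=> b; rewrite (_ : (fun u => _) = (fun u : 'rV[R]_(d + d) => u 0 (lshift d b))); first exact: C_coord.
    by apply/funext => z; rewrite mxE.
  exact: Ws.
rewrite (_ : (fun z => _) = (fun z : 'rV[R]_(d + d) => \sum_p z 0 (rshift d p) * partial p (fun y => W y 0 a) (lsubmx z))); last first.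
  by apply/funext => z; rewrite /tangent_field row_mxEr mxE; apply: eq_bigr => p _; rewrite !mxE.
apply: C_sum => [|p _]; first exact: openT.
apply: C_mul; [exact: openT|exact: C_coord|].
apply: (@C_comp R _ _ k setT setT lsubmx (partial p (fun y => W y 0 a))) => //; try exact: openT.
  move=> b; rewrite (_ : (fun u => _) = (fun u : 'rV[R]_(d + d) => u 0 (lshift d b))); first exact: C_coord.
  by apply/funext => z; rewrite mxE.
by apply: C_partial; exact: Ws.
Qed.

Lemma tangent_flow d (W : 'rV[R]_d -> 'rV[R]_d) Phi (Psi : R -> 'rV[R]_d -> 'rV[R]_d -> 'rV[R]_d) :
  (forall j, smooth setT (fun x => W x 0 j)) -> is_flow W Phi ->
  (forall x v, Psi 0 x v = v) ->
  (forall x v t j, is_derive t (1 : R) (fun s => Psi s x v 0 j) ((Psi t x v *m jacm W (Phi t x)) 0 j)) ->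
  is_flow (tangent_field W) (fun t z => row_mx (Phi t (lsubmx z)) (Psi t (lsubmx z) (rsubmx z))).
Proof.
move=> Ws PW Psi0 Psid; have [P0 Pd Pc] := PW; split.
- by move=> z; rewrite P0 Psi0 hsubmxK.
- move=> z t j; rewrite /tangent_field row_mxKl row_mxKr.
  rewrite -(splitK j); case: (fintype.split j) => a /=.
    rewrite (_ : (fun s => _) = (fun s => Phi s (lsubmx z) 0 a)); first by rewrite row_mxEl; exact: Pd.
    by apply/funext => s; rewrite row_mxEl.
  rewrite (_ : (fun s => _) = (fun s => Psi s (lsubmx z) (rsubmx z) 0 a)); first by rewrite row_mxEr; exact: Psid.
  by apply/funext => s; rewrite row_mxEr.
- move=> p; apply: continuous_rV => j; rewrite -(splitK j); case: (fintype.split j) => a /=.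
    rewrite (_ : (fun z => _) = (fun q => Phi q.1 (lsubmx q.2) 0 a)); last first.
      by apply/funext => s; rewrite row_mxEl.
    apply: (@continuous_pair_rV _ (fun q => Phi q.1 q.2 0 a) _ fst (fun q => lsubmx q.2)).
    + exact: (continuous_flow_coord PW).
    + exact: cvg_fst.
    + by apply: continuous_comp; [exact: cvg_snd|exact: continuous_lsubmx].
  rewrite (_ : (fun z => _) = (fun q => Psi q.1 (lsubmx q.2) (rsubmx q.2) 0 a)); last first.
    by apply/funext => s; rewrite row_mxEr.
  apply: (@continuous_comp _ _ _ (fun p : R * 'rV[R]_(d + d) => Psi p.1 (lsubmx p.2) (rsubmx p.2)) (fun z : 'rV[R]_d => z 0 a)); last exact: continuous_entry.
  exact: (continuous_variation Ws PW Psi0 Psid).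
Qed.

(* The pair (flow, its differential) is itself a flow, that of [tangent_field W]:
   this turns the gain of one derivative into an induction over all fields. *)
Lemma flow_C k d (W : 'rV[R]_d -> 'rV[R]_d) Phi :
  (forall j, smooth setT (fun x => W x 0 j)) -> is_flow W Phi ->
  forall t j, C_ k setT (fun x => Phi t x 0 j).
Proof.
elim: k d W Phi => [|k IH] d W Phi Ws PW t j.
  split => // u _; apply: (@continuous_pair_rV _ (fun q => Phi q.1 q.2 0 j) _ (fun=> t) id).
  - exact: (continuous_flow_coord PW).
  - exact: cst_continuous.
  - exact: cvg_id.
have [Psi [Psi0 Psid]] := variation_exists Ws PW.
have D := is_derive_flow Ws PW Psi0 Psid.
split.
  move=> u _; apply: (@continuous_pair_rV _ (fun q => Phi q.1 q.2 0 j) _ (fun=> t) id).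
  - exact: (continuous_flow_coord PW).
  - exact: cst_continuous.
  - exact: cvg_id.
move=> i; split; first by move=> u _; case: (D u (delta_mx 0 i) t j).
rewrite (_ : partial i _ = fun x => Psi t x (delta_mx 0 i) 0 j); last first.
  by apply/funext => x; case: (D x (delta_mx 0 i) t j).
(* The i-th partial derivative of the flow is the second half of the tangent flow started at [x]
   with the i-th basis vector. *)
have := IH _ _ _ (tangent_field_smooth Ws) (tangent_flow Ws PW Psi0 Psid) t (rshift d j).
move=> H.
have := @C_comp R _ _ k setT setT (fun x => row_mx x (delta_mx 0 i)) _ openT openT (fun _ _ => I) _ H.
rewrite (_ : (fun u => _) = (fun x => Psi t x (delta_mx 0 i) 0 j)); last first.
  by apply/funext => x; rewrite row_mxEr row_mxKl row_mxKr.
apply=> l; rewrite -(splitK l); case: (fintype.split l) => a /=.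
  rewrite (_ : (fun u => _) = (fun u : 'rV[R]_d => u 0 a)); first exact: C_coord.
  by apply/funext => x; rewrite row_mxEl.
rewrite (_ : (fun u => _) = (fun=> (delta_mx 0 i : 'rV[R]_d) 0 a)); first exact: C_cst.
by apply/funext => x; rewrite row_mxEr.
Qed.

End Flow.

(** * Bump functions and transport along a field *)

Section Bump.
Context {R : realType}.

Lemma exp_beats_monomial n (y : R) : 0 < y -> y ^+ n * expR (- y) <= (n.+1)`!%:R / y.
Proof.
move=> y0; rewrite ler_pdivlMr // mulrAC -exprSr expRN ler_pdivrMr ?expR_gt0 //.
have F0 : (0 : R) < (n.+1)`!%:R by rewrite ltr0n fact_gt0.
rewrite mulrC -ler_pdivrMr //; apply: le_trans (expR_ge1Dxn n (ltW y0)).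
by rewrite lerDr.
Qed.

Lemma exp_beats_poly (q : {poly R}) : exists C : R, 0 <= C /\ forall h, 0 < h ->
  `|q.[h^-1] * expR (- h^-1)| <= C * h.
Proof.
exists (\sum_(i < size q) `|q`_i| * (i.+1)`!%:R); split.
  by apply: sumr_ge0 => i _; rewrite mulr_ge0.
move=> h h0; rewrite horner_coef mulr_suml mulr_suml.
apply: le_trans (ler_norm_sum _ _ _) _; apply: ler_sum => i _.
rewrite -mulrA normrM -mulrA ler_wpM2l //.
have hV0 : 0 < h^-1 by rewrite invr_gt0.
rewrite ger0_norm ?mulr_ge0 ?exprn_ge0 ?expR_ge0 ?(ltW hV0) //.
by apply: le_trans (exp_beats_monomial i hV0) _; rewrite invrK.
Qed.

(* The family [p(1/x) exp(-1/x)], extended by 0 to [x <= 0], is closed under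
   derivation, hence consists of smooth functions. *)
Definition flat (p : {poly R}) (x : R) : R :=
  if 0 < x then p.[x^-1] * expR (- x^-1) else 0.

(** From (p(1/x) exp(-1/x))' = x^-2 (p - p')(1/x) exp(-1/x). *)
Definition flat_deriv (p : {poly R}) : {poly R} := 'X^2 * (p - p^`()).

Lemma is_derive_flat p (x : R) : is_derive x (1 : R) (flat p) (flat (flat_deriv p) x).
Proof.
have [x0|x0|->] := ltgtP x 0.
- rewrite {2}/flat ltNge (ltW x0) /=.
  apply: near_eq_is_derive (is_derive_cst 0 x (1 : R)).
  have : \forall y \near x, y < 0 by exact: lt_nbhsl.
  by apply: filterS => y y0; rewrite /flat ltNge (ltW y0).
- rewrite {2}/flat x0.
  have D : is_derive x (1 : R) (fun y => p.[y^-1] * expR (- y^-1))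
      ((flat_deriv p).[x^-1] * expR (- x^-1)).
    have I : is_derive x (1 : R) (fun y : R => y^-1) (- x ^- 2).
      have H := @is_deriveV R (fun y : R => y) x 1 1 (lt0r_neq0 x0) (is_derive_id x (1 : R)).
      by apply: (is_derive_eq H); rewrite [_ *: _]mulr1.
    have A := @is_derive1_comp R (horner p) (fun y : R => y^-1) x _ _ (is_derive_poly p x^-1) I.
    have B := @is_derive1_comp R expR (fun y : R => - y^-1) x _ _ (is_derive_expR (- x^-1)) (is_derive_opp I).
    have C := is_derive_mul A B.
    apply: (is_derive_eq C); rewrite /= /flat_deriv hornerM hornerXn hornerD hornerN -exprVn.
    by ring.
  apply: near_eq_is_derive D.
  have : \forall y \near x, 0 < y by exact: lt_nbhsr.
  by apply: filterS => y y0; rewrite /flat y0.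
- rewrite {2}/flat ltxx.
  (* The difference quotient at 0 divides by h once more, which the factor ['X] accounts for. *)
  have [C [C0 HC]] := exp_beats_poly (p * 'X).
  have lim : (fun h : R => h^-1 *: (flat p (h *: (1 : R) + 0) - flat p 0)) @ (0 : R)^' --> (0 : R).
    apply/cvgrPdist_le => e e0.
    have c0 : 0 < e / (C + 1) by rewrite divr_gt0 // ltr_wpDl.
    near=> h.
    have hne : h != 0 by near: h; exact: nbhs_dnbhs_neq.
    have hs : `|h| < e / (C + 1).
      near: h; apply: nbhs_dnbhs.
      by have /cvgrPdist_lt/(_ _ c0) := @cvg_id _ (nbhs (0 : R)); apply: filterS => y; rewrite sub0r normrN.
    rewrite addr0 [h *: 1]mulr1 {2}/flat ltxx subr0 sub0r normrN /flat.
    case: ifP => h0; last by rewrite scaler0 normr0 ltW.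
    have := HC h h0; rewrite hornerM hornerX.
    rewrite (_ : h^-1 *: _ = p.[h^-1] * h^-1 * expR (- h^-1)); last by rewrite /GRing.scale /=; ring.
    move=> /le_trans; apply.
    have : (C + 1) * h <= e by rewrite mulrC -ler_pdivlMr ?ltr_wpDl // ltW // -(gtr0_norm h0).
    by rewrite mulrDl mul1r; lra.
  split; first by apply/cvg_ex; exists 0.
  exact: cvg_lim.
Unshelve. all: by end_near. Qed.

Lemma is_derive_comp1 (V : normedModType R) (f : R -> R) (g : V -> R) (x v : V) (df dg : R) :
  is_derive (g x) (1 : R) f df -> is_derive x v g dg -> is_derive x v (fun y => f (g y)) (df * dg).
Proof.
move=> fd gd.
have E (h : V -> R) : (fun s : R => s^-1 *: (h (s *: v + x) - h x)) =
  (fun s : R => s^-1 *: ((fun s : R => h (x + s *: v)) (s *: (1 : R) + 0) - (fun s : R => h (x + s *: v)) 0)).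
  apply/funext => s; congr (_ *: (h _ - h _)); last by rewrite scale0r addr0.
  by rewrite addr0 addrC [s *: 1]mulr1.
have G : is_derive (0 : R) (1 : R) (fun s : R => g (x + s *: v)) dg.
  by apply: is_derive_line; rewrite scale0r addr0.
have := @is_derive1_comp R f (fun s : R => g (x + s *: v)) 0 df dg.
rewrite scale0r addr0 => /(_ fd G) [H1 H2].
split; first by rewrite /derivable (E (fun y => f (g y))).
by rewrite -H2 /derive (E (fun y => f (g y))).
Qed.

Lemma flat_C n k (U : set 'rV[R]_n) (g : 'rV[R]_n -> R) p : open U -> C_ k U g ->
  C_ k U (fun u => flat p (g u)).
Proof.
move=> oU; elim: k p => [|k IH] p gC.
  split => // u Uu; apply: continuous_comp; first exact: C_cont gC Uu.
  exact: is_derive_continuous (is_derive_flat p _).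
have D u i (Uu : U u) := is_derive_comp1 (is_derive_flat p (g u)) (derivableP (C_derivable (i := i) gC Uu)).
split=> [u Uu|i].
  apply: continuous_comp; first exact: C_cont gC Uu.
  exact: is_derive_continuous (is_derive_flat p _).
split=> [u Uu|]; first by case: (D u i Uu).
apply: (@C_eq _ _ _ _ (fun u => flat (flat_deriv p) (g u) * partial i g u)) => //.
  by move=> u Uu; have [_ <-] := D u i Uu.
by apply: C_mul => //; [apply: IH; exact: C_lt|exact: C_partial].
Qed.

Definition smooth_step (x : R) := flat 1 x / (flat 1 x + flat 1 (1 - x)).

Lemma flat1_ge0 x : 0 <= flat 1 x.
Proof. by rewrite /flat; case: ifP => // _; rewrite hornerC mul1r expR_ge0. Qed.

Lemma flat1_gt0 x : 0 < x -> 0 < flat 1 x.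
Proof. by move=> x0; rewrite /flat x0 hornerC mul1r expR_gt0. Qed.

Lemma flat_le0 p x : x <= 0 -> flat p x = 0.
Proof. by move=> x0; rewrite /flat ltNge x0. Qed.

Lemma smooth_step_den x : 0 < flat 1 x + flat 1 (1 - x).
Proof.
have [x0|x0] := ltP 0 x.
  by apply: ltr_pwDl; [exact: flat1_gt0|exact: flat1_ge0].
by apply: ltr_wpDl; [exact: flat1_ge0|apply: flat1_gt0; lra].
Qed.

Lemma smooth_step0 x : x <= 0 -> smooth_step x = 0.
Proof. by move=> x0; rewrite /smooth_step flat_le0 ?mul0r. Qed.

Lemma smooth_step1 x : 1 <= x -> smooth_step x = 1.
Proof.
move=> x1; rewrite /smooth_step (@flat_le0 _ (1 - x)) ?subr_le0 // addr0 divff //.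
by rewrite gt_eqF // flat1_gt0 // (lt_le_trans ltr01).
Qed.

Lemma smooth_step_C n k (U : set 'rV[R]_n) (g : 'rV[R]_n -> R) : open U -> C_ k U g ->
  C_ k U (fun u => smooth_step (g u)).
Proof.
move=> oU gC.
have gC' : C_ k U (fun u => 1 - g u).
  by apply: C_add => //; [exact: C_cst|exact: C_opp].
apply: C_mul => //; first exact: flat_C.
apply: C_inv => //; first by move=> u _; rewrite gt_eqF // smooth_step_den.
by apply: C_add => //; exact: flat_C.
Qed.

(** A product of smooth steps over the coordinates. The argument 2 - (u_i - c_i)^2 / r^2 is at least
    1 when |u_i - c_i| <= r and negative when |u_i - c_i| > 2 r; squaring keeps it smooth. Beyond 3
    r in sup norm some coordinate differs by more than 2 r. *)
Lemma bump n (c : 'rV[R]_n) (r : R) : 0 < r -> exists chi : 'rV[R]_n -> R,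
  [/\ smooth setT chi, forall u, `|u - c| <= r -> chi u = 1 &
      forall u, 3 * r <= `|u - c| -> chi u = 0].
Proof.
move=> r0; pose g (i : 'I_n) (u : 'rV[R]_n) : R := 2 - (u 0 i - c 0 i) * (u 0 i - c 0 i) / (r * r).
have rr0 : 0 < r * r by rewrite mulr_gt0.
have sqrn (x : R) : x * x = `|x| * `|x| by rewrite -normrM ger0_norm // -expr2 sqr_ge0.
exists (fun u => \prod_i smooth_step (g i u)); split.
- move=> k; apply: C_prod => [|i _]; first exact: openT.
  apply: smooth_step_C; first exact: openT.
  have oT : open [set: 'rV[R]_n] by exact: openT.
  apply: C_add => //; first exact: C_cst.
  apply: C_opp => //; apply: C_mul => //; last exact: C_cst.
  have d : C_ k setT (fun u : 'rV[R]_n => u 0 i - c 0 i).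
    by apply: C_add => //; [exact: C_coord|exact: C_cst].
  exact: C_mul.
- move=> u uc; apply: big1 => i _; apply: smooth_step1.
  suff : (u 0 i - c 0 i) * (u 0 i - c 0 i) / (r * r) <= 1 by rewrite /g; lra.
  rewrite ler_pdivrMr // mul1r (sqrn (_ - _)).
  by apply: ler_pM => //; apply: le_trans uc; have := normr_coord (u - c) i; rewrite !mxE.
- move=> u uc.
  have [i Hi] : exists i, 2 * r < `|u 0 i - c 0 i|.
    apply: contrapT => /forallNP H.
    have : `|u - c| <= 2 * r.
      apply: normr_le_coord; first by rewrite mulr_ge0 // ltW.
      by move=> i; rewrite !mxE leNgt; apply/negP => Hi; exact: (H i).
    by lra.
  rewrite (bigD1 i) //= smooth_step0 ?mul0r // /g subr_le0 ler_pdivlMr // (sqrn (_ - _)).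
  have : (2 * r) * (2 * r) <= `|u 0 i - c 0 i| * `|u 0 i - c 0 i|.
    by apply: ler_pM; rewrite ?mulr_ge0 // ltW.
  by lra.
Qed.

End Bump.

(** * Flows of compactly supported fields, germs of smooth functions, and the equation Z f = g *)

Section Transport.
Context {R : realType}.

Lemma continuous_dist n (c : 'rV[R]_n) : continuous (fun u : 'rV[R]_n => `|u - c|).
Proof.
move=> x; apply: continuous_comp; last exact: norm_continuous.
by apply: (@continuousB _ _ _ id (fun=> c)); [exact: cvg_id|exact: cst_continuous].
Qed.

Lemma open_dist_gt n (c : 'rV[R]_n) (r : R) : open [set u : 'rV[R]_n | r < `|u - c|].
Proof.
rewrite (_ : mkset _ = (fun u => `|u - c|) @^-1` [set x | r < x]) //.
apply: open_comp; last exact: open_gt.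
by move=> x _; exact: continuous_dist.
Qed.

Lemma open_dist_lt n (c : 'rV[R]_n) (r : R) : open [set u : 'rV[R]_n | `|u - c| < r].
Proof.
rewrite (_ : mkset _ = (fun u => `|u - c|) @^-1` [set x | x < r]) //.
apply: open_comp; last exact: open_lt.
by move=> x _; exact: continuous_dist.
Qed.

(** The open sets |u - c| < 4 r, where [g] is smooth, and |u - c| > 3 r, where the product is 0,
    cover the space; the values of [g] outside [U] are arbitrary. *)
Lemma cutoff_smooth n (chi g : 'rV[R]_n -> R) (c : 'rV[R]_n) (r : R) (U : set 'rV[R]_n) :
  0 < r -> smooth setT chi -> (forall u, 3 * r <= `|u - c| -> chi u = 0) ->
  open U -> (forall u, `|u - c| < 4 * r -> U u) -> smooth U g ->
  smooth setT (fun u => chi u * g u).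
Proof.
move=> r0 chis chi0 oU rU gs; apply/smooth_pointwise => u _.
have [ur|ur] := ltP (`|u - c|) (4 * r).
  apply: (@smooth_subset _ _ _ U); first by move=> _ ->; exact: rU.
  move=> k; apply: C_mul => //; first exact: smooth_subset chis k.
pose V := [set u : 'rV[R]_n | 3 * r < `|u - c|].
have oV : open V by exact: open_dist_gt.
apply: (@smooth_subset _ _ _ V); first by move=> _ ->; rewrite /V /=; lra.
apply: (@smooth_eq _ _ _ (fun=> 0)) => //; last by move=> k; exact: C_cst.
by move=> x Vx; rewrite chi0 ?mul0r // ltW.
Qed.

Lemma compact_support_bounded n (f : 'rV[R]_n -> R) (c : 'rV[R]_n) (r : R) :
  continuous f -> (forall u, r < `|u - c| -> f u = 0) -> exists M, 0 <= M /\ forall u, `|f u| <= M.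
Proof.
move=> fc f0.
pose B := [set u : 'rV[R]_n | `|u| <= `|r| + `|c|].
have [B0|B0] := pselect (B !=set0); last first.
  exists 0; split => // u; rewrite f0 ?normr0 // ltNge; apply/negP => ur.
  apply: B0; exists u; rewrite /B /= -(subrK c u); apply: le_trans (ler_normD _ _) _.
  by rewrite lerD2r (le_trans ur) // ler_norm.
have cB : compact B.
  apply: bounded_closed_compact.
    exists (`|r| + `|c|); split; first exact: num_real.
    by move=> x xr u /= /le_trans; apply; exact: ltW.
  rewrite (_ : B = (fun u : 'rV[R]_n => `|u|) @^-1` [set x | x <= `|r| + `|c|]) //.
  apply: closed_comp; last exact: closed_le.
  by move=> x _; exact: norm_continuous.
have cf : {within B, continuous (fun u => `|f u|)}.
  apply: continuous_subspaceT => u; apply: continuous_comp; [exact: fc|exact: norm_continuous].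
have [m _ Hm] := @EVT_max_rV R n (fun u => `|f u|) B B0 cB cf.
exists `|f m|; split => // u.
have [ur|ur] := ltP r (`|u - c|); first by rewrite f0 ?normr0.
apply: Hm; rewrite inE /B /= -(subrK c u); apply: le_trans (ler_normD _ _) _.
by rewrite lerD2r (le_trans ur) // ler_norm.
Qed.

(** The partial derivatives are continuous and vanish outside a ball, hence are bounded. The
    resulting global constant is what makes the flow of a cut-off field complete. *)
Lemma compact_support_lipschitz m n (W : 'rV[R]_m -> 'rV[R]_n) (c : 'rV[R]_m) (r : R) :
  (forall j, smooth setT (fun x => W x 0 j)) -> (forall u, r <= `|u - c| -> W u = 0) ->
  exists K, 0 < K /\ forall x y, `|W x - W y| <= K * `|x - y|.
Proof.
move=> Ws W0.
have /choice[M HM] : forall pj : 'I_m * 'I_n, exists M, 0 <= M /\ forall u, `|partial pj.1 (fun x => W x 0 pj.2) u| <= M.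
  move=> [p j] /=; apply: (@compact_support_bounded _ _ c r).
    move=> x; have := C_cont (@C_partial _ _ 0 _ _ p (Ws j 1)) (I : setT x); exact.
  move=> u ur; rewrite /partial (@near_eq_derive _ _ _ _ (fun=> 0)) ?derive_cst //.
  have : \forall z \near u, r < `|z - c|.
    by apply: open_nbhs_nbhs; split => //; exact: open_dist_gt.
  by apply: filterS => z zr; rewrite W0 ?mxE // ltW.
pose K := \sum_p \sum_j M (p, j).
have M0 p j : 0 <= M (p, j) by have [] := HM (p, j).
have K0 : 0 <= K by apply: sumr_ge0 => p _; apply: sumr_ge0 => j _; exact: M0.
exists (K + 1); split; first by rewrite ltr_wpDl.
move=> x y; apply: normr_le_coord; first by rewrite mulr_ge0 // addr_ge0.
move=> j; rewrite !mxE.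
have [|xi [_ ->]] := @mvt_box R m (fun x => W x 0 j) y x.
  by move=> z _ p; apply: (C_derivable (Ws j 1)).
apply: le_trans (ler_norm_sum _ _ _) _.
apply: (@le_trans _ _ (K * `|x - y|)); last by rewrite ler_wpM2r // lerDl.
rewrite /K mulr_suml.
apply: ler_sum => p _; rewrite normrM mulrC; apply: ler_pM => //.
  have [_ H] := HM (p, j); apply: le_trans (H _) _.
  by rewrite (bigD1 j) //= lerDl sumr_ge0.
by have := normr_coord (x - y) p; rewrite !mxE.
Qed.

Lemma lipschitz_continuous (V W : normedModType R) (f : V -> W) (K : R) : 0 < K ->
  (forall x y, `|f x - f y| <= K * `|x - y|) -> continuous f.
Proof.
move=> K0 fK x; apply/cvgrPdist_le => e e0.
have eK : 0 < e / K by rewrite divr_gt0.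
have /cvgrPdist_le/(_ _ eK) := @cvg_id _ (nbhs x).
apply: filterS => y; rewrite ler_pdivlMr // mulrC => H.
exact: le_trans (fK x y) H.
Qed.

Lemma flow_exists d (W : 'rV[R]_d -> 'rV[R]_d) (K : R) : 0 < K ->
  (forall x y, `|W x - W y| <= K * `|x - y|) -> exists Phi, is_flow W Phi.
Proof.
move=> K0 WK.
have Wc : continuous W.
  exact: lipschitz_continuous K0 WK.
have WL : lipschitz_in_time (fun _ : R => W) by move=> T; exists K.
have /choice[z Hz] : forall x, exists z : R -> 'rV[R]_d, z 0 = x /\
    forall t j, is_derive t (1 : R) (fun s => z s 0 j) (W (z t) 0 j).
  move=> x; apply: (picard (G := fun _ => W)) => // z zc t.
  by apply: continuous_comp; [exact: zc|exact: Wc].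
exists (fun t x => z x t); split.
- by move=> x; have [] := Hz x.
- by move=> x t j; have [_] := Hz x; apply.
move=> [t0 x0]; apply/cvgrPdist_le => e e0 /=.
have e2 : 0 < e / 2 by rewrite divr_gt0.
have dep s x y : `|z x s - z y s| <= `|x - y| * expR (K * `|s|).
  have [x0' xd] := Hz x; have [y0' yd] := Hz y.
  have := @gronwall R d (fun s => z x s - z y s) (fun s => W (z x s) - W (z y s)) K 0 `|s| K0 (lexx _).
  rewrite x0' y0' mul0r addr0 => H; apply: H => //.
    move=> r j; rewrite !mxE (_ : (fun s => _) = (fun s => z x s 0 j - z y s 0 j)); last by apply/funext => q; rewrite !mxE.
    exact: is_derive_sub.
  by move=> r _; rewrite addr0; exact: WK.
pose C := expR (K * (`|t0| + 1)).
have C0 : 0 < C by exact: expR_gt0.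
have eC : 0 < e / 2 / C by rewrite divr_gt0.
have near1 : \forall s \near t0, `|s| <= `|t0| + 1 /\ `|z x0 t0 - z x0 s| <= e / 2.
  apply: filterI.
    have : \forall s \near t0, `|t0 - s| <= 1.
      by have /cvgrPdist_le/(_ 1 ltr01) := @cvg_id _ (nbhs t0).
    apply: filterS => s; rewrite distrC => ts; rewrite -(subrK t0 s) addrC.
    by apply: le_trans (ler_normD _ _) _; rewrite lerD2l.
  have [_ xd] := Hz x0.
  have := norm_derive_curve_continuous (u := z x0) (xd t0).
  by move=> /cvgrPdist_le/(_ _ e2).
have near2 : \forall x \near x0, `|x0 - x| <= e / 2 / C.
  by have /cvgrPdist_le/(_ _ eC) := @cvg_id _ (nbhs x0).
exists ([set s | `|s| <= `|t0| + 1 /\ `|z x0 t0 - z x0 s| <= e / 2], [set x | `|x0 - x| <= e / 2 / C]); first by split.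
move=> [s x] /= [[s1 s2] xx].
rewrite -(subrK (z x0 s) (z x0 t0)) -addrA.
apply: le_trans (ler_normD _ _) _; rewrite [e]splitr; apply: lerD => //.
apply: le_trans (dep s x0 x) _.
move: xx; rewrite ler_pdivlMr //; apply: le_trans.
by rewrite ler_wpM2l // ler_expR ler_wpM2l // ltW.
Qed.

(** Time becomes a coordinate: the field (t W(x), 0) on R^(d+1) keeps t constant, and its flow at
    time 1 sends (x, t) to (Phi t x, t). Smoothness in the initial point then includes smoothness in
    t. *)
Lemma flow_joint_smooth d (W : 'rV[R]_d -> 'rV[R]_d) Phi :
  (forall j, smooth setT (fun x => W x 0 j)) -> is_flow W Phi ->
  forall j, smooth setT (fun z : 'rV[R]_(d + 1) => Phi (z 0 (rshift d 0)) (lsubmx z) 0 j).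
Proof.
move=> Ws PW j.
pose V (z : 'rV[R]_(d + 1)) : 'rV[R]_(d + 1) := row_mx (z 0 (rshift d 0) *: W (lsubmx z)) 0.
pose Psi t (z : 'rV[R]_(d + 1)) : 'rV[R]_(d + 1) := row_mx (Phi (z 0 (rshift d 0) * t) (lsubmx z)) (rsubmx z).
have [P0 Pd Pc] := PW.
have Vs l : smooth setT (fun z => V z 0 l).
  move=> k; rewrite -(splitK l); case: (fintype.split l) => a /=.
    rewrite (_ : (fun z => _) = (fun z : 'rV[R]_(d + 1) => z 0 (rshift d 0) * W (lsubmx z) 0 a)); last first.
      by apply/funext => z; rewrite /V row_mxEl mxE.
    apply: C_mul; [exact: openT|exact: C_coord|].
    apply: (@C_comp R _ _ k setT setT lsubmx (fun x => W x 0 a)) => //; try exact: openT.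
      move=> b; rewrite (_ : (fun u => _) = (fun u : 'rV[R]_(d + 1) => u 0 (lshift 1 b))); first exact: C_coord.
      by apply/funext => z; rewrite mxE.
    exact: Ws.
  rewrite (_ : (fun z => _) = fun=> 0); first exact: C_cst.
  by apply/funext => z; rewrite /V row_mxEr mxE.
have fl : is_flow V Psi.
  split.
  - by move=> z; rewrite /Psi mulr0 P0 hsubmxK.
  - move=> z t l.
    have -> : V (Psi t z) = row_mx (z 0 (rshift d 0) *: W (Phi (z 0 (rshift d 0) * t) (lsubmx z))) 0.
      by rewrite /V /Psi row_mxKl row_mxEr mxE.
    rewrite -(splitK l); case: (fintype.split l) => a /=.
      rewrite row_mxEl (_ : (fun s => _) = (fun s => Phi (z 0 (rshift d 0) * s) (lsubmx z) 0 a)); last first.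
        by apply/funext => s; rewrite row_mxEl.
      rewrite mxE; apply: (@is_derive_scale _ (fun s => Phi s (lsubmx z) 0 a)); exact: Pd.
    rewrite row_mxEr mxE (_ : (fun s => _) = cst (rsubmx z 0 a)); first exact: is_derive_cst.
    by apply/funext => s; rewrite row_mxEr.
  - move=> [t z]; apply: continuous_rV => l; rewrite -(splitK l); case: (fintype.split l) => a /=.
      rewrite (_ : (fun z => _) = (fun q : R * 'rV[R]_(d + 1) => Phi (q.2 0 (rshift d 0) * q.1) (lsubmx q.2) 0 a)); last first.
        by apply/funext => s; rewrite row_mxEl.
      apply: (@continuous_pair_rV _ _ (fun q => Phi q.1 q.2 0 a) _ (fun q : R * 'rV[R]_(d + 1) => q.2 0 (rshift d 0) * q.1) (fun q : R * 'rV[R]_(d + 1) => lsubmx q.2)).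
      + exact: (continuous_flow_coord PW).
      + apply: (@continuousM _ _ (fun q : R * 'rV[R]_(d + 1) => q.2 0 (rshift d 0)) fst); last exact: cvg_fst.
        by apply: (@continuous_comp _ _ _ snd (fun z : 'rV[R]_(d + 1) => z 0 (rshift d 0))); [exact: cvg_snd|exact: continuous_entry].
      + by apply: continuous_comp; [exact: cvg_snd|exact: continuous_lsubmx].
    rewrite (_ : (fun z => _) = (fun q : R * 'rV[R]_(d + 1) => q.2 0 (rshift d a))); last first.
      by apply/funext => s; rewrite row_mxEr mxE.
    by apply: (@continuous_comp _ _ _ snd (fun z : 'rV[R]_(d + 1) => z 0 (rshift d a))); [exact: cvg_snd|exact: continuous_entry].
move=> k; have := flow_C k Vs fl 1 (lshift 1 j).
rewrite (_ : (fun z => _) = (fun z : 'rV[R]_(d + 1) => Phi (z 0 (rshift d 0)) (lsubmx z) 0 j)) //.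
by apply/funext => z; rewrite /Psi row_mxEl mulr1.
Qed.

Lemma flow_uniq d (W : 'rV[R]_d -> 'rV[R]_d) (K : R) (z z' : R -> 'rV[R]_d) : 0 < K ->
  (forall x y, `|W x - W y| <= K * `|x - y|) ->
  (forall t j, is_derive t (1 : R) (fun s => z s 0 j) (W (z t) 0 j)) ->
  (forall t j, is_derive t (1 : R) (fun s => z' s 0 j) (W (z' t) 0 j)) ->
  z 0 = z' 0 -> z =1 z'.
Proof. by move=> K0 WK; apply: (ode_uniq (G := fun _ => W)) => T; exists K. Qed.

(** Smoothness is asked at all points near [u]: at [u] alone, the iterated partial derivatives could
    involve default values of [partial] at neighbouring points. *)
Definition smooth_at n (u : 'rV[R]_n) (f : 'rV[R]_n -> R) := \forall z \near u, smooth [set z] f.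

Lemma near_open (T : topologicalType) (u : T) (P : T -> Prop) : (\forall z \near u, P z) ->
  exists U : set T, [/\ open U, U u & forall z, U z -> P z].
Proof.
move=> H; exists (interior [set z | P z]); split; first exact: open_interior.
  exact: H.
by move=> z; exact: interior_subset.
Qed.

Lemma near_dist n (u : 'rV[R]_n) (P : 'rV[R]_n -> Prop) : (\forall z \near u, P z) ->
  exists r : R, 0 < r /\ forall z, `|z - u| < r -> P z.
Proof.
move=> /nbhs_ballP[r /= r0 H]; exists r; split => // z zu; apply: H.
by rewrite -ball_normE /= distrC.
Qed.

Lemma smooth_atP n (u : 'rV[R]_n) f : smooth_at u f <->
  exists U, [/\ open U, U u & smooth U f].
Proof.
split=> [/near_open[U [oU Uu HU]]|[U [oU Uu Us]]].
  by exists U; split => //; apply/smooth_pointwise.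
have : nbhs u U by exact: open_nbhs_nbhs.
by apply: filterS => z Uz; move/smooth_pointwise : Us; exact.
Qed.

Lemma smooth_at_smooth n (u : 'rV[R]_n) f (U : set 'rV[R]_n) : open U -> U u -> smooth U f -> smooth_at u f.
Proof. by move=> oU Uu Us; apply/smooth_atP; exists U. Qed.

Lemma smooth_at_near n (u : 'rV[R]_n) f : smooth_at u f -> \forall z \near u, smooth_at z f.
Proof. exact: nbhs_interior. Qed.

Lemma smooth_at_point n (u : 'rV[R]_n) f : smooth_at u f -> smooth [set u] f.
Proof. exact: nbhs_singleton. Qed.

Lemma smooth_at_eq n (u : 'rV[R]_n) f g : (\forall z \near u, f z = g z) ->
  smooth_at u f -> smooth_at u g.
Proof.
move=> /near_open[U [oU Uu HU]] fs.
have : nbhs u U by exact: open_nbhs_nbhs.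
apply: filterS2 fs => z fz Uz k; apply: C_near_eq (fz k).
have : nbhs z U by exact: open_nbhs_nbhs.
by apply: filterS.
Qed.

Lemma smooth_at_diff n (u : 'rV[R]_n) f : smooth_at u f -> differentiable f u.
Proof. by move=> /smooth_atP[U [oU Uu Us]]; exact: smooth_diff Us Uu. Qed.

Lemma smooth_at_cont n (u : 'rV[R]_n) f : smooth_at u f -> {for u, continuous f}.
Proof. by move=> /smooth_at_diff; exact: differentiable_continuous. Qed.

Lemma smooth_at_is_derive n (u : 'rV[R]_n) f i : smooth_at u f ->
  is_derive u (delta_mx 0 i) f (partial i f u).
Proof. by move=> /smooth_at_diff fd; apply: derivableP; exact: derivable_diff. Qed.

Lemma smooth_at_partial n (u : 'rV[R]_n) f i : smooth_at u f -> smooth_at u (partial i f).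
Proof. by apply: filterS => z; exact: smooth_partial. Qed.

Lemma smooth_at_op1 n (u : 'rV[R]_n) f h :
  (forall U, open U -> U u -> smooth U f -> exists V, [/\ open V, V u & smooth (U `&` V) h]) ->
  smooth_at u f -> smooth_at u h.
Proof.
move=> H /smooth_atP[U [oU Uu Us]]; have [V [oV Vu VS]] := H U oU Uu Us.
by apply/smooth_atP; exists (U `&` V); split => //; exact: openI.
Qed.

Lemma smooth_at_cst n (u : 'rV[R]_n) c : smooth_at u (fun=> c).
Proof. by apply/smooth_atP; exists setT; split => //; [exact: openT|move=> k; exact: C_cst]. Qed.

Lemma smooth_at_coord n (u : 'rV[R]_n) j : smooth_at u (fun z : 'rV[R]_n => z 0 j).
Proof. by apply/smooth_atP; exists setT; split => //; [exact: openT|move=> k; exact: C_coord]. Qed.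

Lemma smooth_at_common n (u : 'rV[R]_n) (I : finType) (f : I -> 'rV[R]_n -> R) :
  (forall i, smooth_at u (f i)) -> exists U, [/\ open U, U u & forall i, smooth U (f i)].
Proof.
move=> H.
have /near_open[U [oU Uu HU]] : \forall z \near u, forall i, smooth [set z] (f i) by exact: near_all.
by exists U; split => // i; apply/smooth_pointwise => z /HU.
Qed.

Lemma smooth_at_add n (u : 'rV[R]_n) f g : smooth_at u f -> smooth_at u g ->
  smooth_at u (fun z => f z + g z).
Proof.
move=> fs gs; have [|U [oU Uu Us]] := @smooth_at_common n u bool (fun b => if b then f else g); first by case.
by apply: (smooth_at_smooth oU Uu) => k; apply: C_add => //; [exact: Us true k|exact: Us false k].
Qed.

Lemma smooth_at_mul n (u : 'rV[R]_n) f g : smooth_at u f -> smooth_at u g ->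
  smooth_at u (fun z => f z * g z).
Proof.
move=> fs gs; have [|U [oU Uu Us]] := @smooth_at_common n u bool (fun b => if b then f else g); first by case.
by apply: (smooth_at_smooth oU Uu) => k; apply: C_mul => //; [exact: Us true k|exact: Us false k].
Qed.

Lemma smooth_at_opp n (u : 'rV[R]_n) f : smooth_at u f -> smooth_at u (fun z => - f z).
Proof.
by move=> /smooth_atP[U [oU Uu Us]]; apply: (smooth_at_smooth oU Uu) => k; exact: C_opp.
Qed.

Lemma smooth_at_sub n (u : 'rV[R]_n) f g : smooth_at u f -> smooth_at u g ->
  smooth_at u (fun z => f z - g z).
Proof. by move=> fs gs; apply: smooth_at_add => //; exact: smooth_at_opp. Qed.

Lemma smooth_at_inv n (u : 'rV[R]_n) f : f u != 0 -> smooth_at u f -> smooth_at u (fun z => (f z)^-1).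
Proof.
move=> f0 fs.
have /near_open[V [oV Vu HV]] : \forall z \near u, f z != 0.
  have := smooth_at_cont fs => fc.
  have oN : open [set x : R | x != 0] by exact: open_neq.
  exact: (fc _ (open_nbhs_nbhs (conj oN f0))).
apply: smooth_at_op1 fs => U oU Uu Us; exists V; split => // k.
apply: C_inv; first exact: openI.
  by move=> z [_ /HV].
by apply: smooth_subset (Us) k => z [].
Qed.

Lemma smooth_at_sum n (u : 'rV[R]_n) (I : Type) (r : seq I) (P : pred I) (f : I -> 'rV[R]_n -> R) :
  (forall i, P i -> smooth_at u (f i)) -> smooth_at u (fun z => \sum_(i <- r | P i) f i z).
Proof.
move=> FC; elim: r => [|a r IH].
  by under eq_fun do rewrite big_nil; exact: smooth_at_cst.
under eq_fun do rewrite big_cons.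
by case: (boolP (P a)) => // Pa; apply: smooth_at_add => //; exact: FC.
Qed.

Lemma smooth_at_prod n (u : 'rV[R]_n) (I : Type) (r : seq I) (P : pred I) (f : I -> 'rV[R]_n -> R) :
  (forall i, P i -> smooth_at u (f i)) -> smooth_at u (fun z => \prod_(i <- r | P i) f i z).
Proof.
move=> FC; elim: r => [|a r IH].
  by under eq_fun do rewrite big_nil; exact: smooth_at_cst.
under eq_fun do rewrite big_cons.
by case: (boolP (P a)) => // Pa; apply: smooth_at_mul => //; exact: FC.
Qed.

Lemma smooth_at_comp m n (u : 'rV[R]_m) (p : 'rV[R]_m -> 'rV[R]_n) f :
  (forall j, smooth_at u (fun z => p z 0 j)) -> smooth_at (p u) f -> smooth_at u (fun z => f (p z)).
Proof.
move=> ps /smooth_atP[V [oV Vpu Vs]].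
have pc : {for u, continuous p} by apply: continuous_rV => j; exact: smooth_at_cont.
have [U [oU Uu Us]] := smooth_at_common ps.
have /near_open[U' [oU' Uu' HU']] : \forall z \near u, V (p z).
  by apply: pc; exact: open_nbhs_nbhs.
apply: (@smooth_at_smooth _ _ _ (U `&` U')) => //; first exact: openI.
move=> k; apply: (@C_comp _ _ _ _ _ V) => //; first exact: openI.
  by move=> z [_ /HU'].
by move=> j; apply: (smooth_subset _ (Us j)) => z [].
Qed.

Definition lied n (Z : 'rV[R]_n -> 'rV[R]_n) (f : 'rV[R]_n -> R) (u : 'rV[R]_n) : R :=
  \sum_j Z u 0 j * partial j f u.

Lemma smooth_at_lied n (u : 'rV[R]_n) (Z : 'rV[R]_n -> 'rV[R]_n) f : (forall j, smooth_at u (fun z => Z z 0 j)) ->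
  smooth_at u f -> smooth_at u (lied Z f).
Proof.
move=> Zs fs; apply: smooth_at_sum => j _; apply: smooth_at_mul => //.
exact: smooth_at_partial.
Qed.

Lemma is_derive_curve_uniq n (f : 'rV[R]_n -> R) (c : R -> 'rV[R]_n) (t : R) (dc : 'I_n -> R) df :
  (forall j, is_derive t (1 : R) (fun s => c s 0 j) (dc j)) -> differentiable f (c t) ->
  is_derive t (1 : R) (fun s => f (c s)) df -> df = \sum_j dc j * partial j f (c t).
Proof. by move=> cd fd H; exact: (is_derive_uniq H (is_derive_curve cd fd)). Qed.

(** The affine function whose zero set is the hyperplane that carries the initial values for the
    transport equation. *)
Definition height n (u0 : 'rV[R]_n) (c : 'cV[R]_n) (u : 'rV[R]_n) : R := ((u - u0) *m c) 0 0.

Lemma is_derive_entry n (u : 'rV[R]_n) i j :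
  is_derive u (delta_mx 0 j : 'rV[R]_n) (fun z : 'rV[R]_n => z 0 i) ((j == i)%:R).
Proof.
have dif : differentiable (fun u : 'rV[R]_n => u 0 i : R) u by exact: differentiable_coord.
have dd := derivableP (diff_derivable (v := delta_mx 0 j) dif).
apply: (is_derive_eq dd); rewrite /derive; apply: cvg_lim => //.
apply: (@cvg_trans _ ((fun=> (j == i)%:R) @ (0 : R)^')); last exact: cvg_cst.
apply: near_eq_cvg; near=> h.
have h0 : h != 0 by near: h; exact: nbhs_dnbhs_neq.
by rewrite /= !mxE eqxx /= addrK [h^-1 *: _]mulKf // eq_sym.
Unshelve. all: by end_near. Qed.

Lemma partial_height n (u0 : 'rV[R]_n) c j u : is_derive u (delta_mx 0 j) (height u0 c) (c j 0).
Proof.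
have E : height u0 c = fun u => \sum_i (u 0 i - u0 0 i) * c i 0.
  by apply/funext => z; rewrite /height mxE; apply: eq_bigr => i _; rewrite !mxE.
rewrite E.
have := @is_derive_bigsum R _ u (delta_mx 0 j) _ (index_enum 'I_n) (fun i z => (z 0 i - u0 0 i) * c i 0) (fun i => (i == j)%:R * c i 0).
rewrite (bigD1 j) //= eqxx mul1r big1 ?addr0; last by move=> i /negbTE ->; rewrite mul0r.
apply=> i.
have H := is_derive_mul (is_derive_sub (is_derive_entry u i j) (is_derive_cst (u0 0 i) u (delta_mx 0 j : 'rV[R]_n))) (is_derive_cst (c i 0) u (delta_mx 0 j : 'rV[R]_n)).
by apply: (is_derive_eq H); rewrite subr0 mulr0 addr0 eq_sym.
Qed.

Lemma smooth_at_height n (u0 : 'rV[R]_n) c u : smooth_at u (height u0 c).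
Proof.
apply: (@smooth_at_eq _ _ (fun u => \sum_i (u 0 i - u0 0 i) * c i 0)).
  by apply: filterE => z; rewrite /height mxE; apply: eq_bigr => i _; rewrite !mxE.
apply: smooth_at_sum => i _; apply: smooth_at_mul; last exact: smooth_at_cst.
by apply: smooth_at_sub; [exact: smooth_at_coord|exact: smooth_at_cst].
Qed.

Lemma lsubmx_coord d e (b : 'I_d) : (fun z : 'rV[R]_(d + e) => lsubmx z 0 b) = (fun z => z 0 (lshift e b)).
Proof. by apply/funext => z; rewrite mxE. Qed.

Lemma smooth_lsubmx d e (f : 'rV[R]_d -> R) : smooth setT f ->
  smooth setT (fun z : 'rV[R]_(d + e) => f (lsubmx z)).
Proof.
move=> fs k; apply: (@C_comp R _ _ k setT setT lsubmx f) => //; try exact: openT.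
by move=> b; rewrite lsubmx_coord; exact: C_coord.
Qed.

Lemma normr_lsubmx d e (z : 'rV[R]_(d + e)) : `|lsubmx z| <= `|z|.
Proof. by apply: normr_le_coord => // j; rewrite mxE normr_coord. Qed.

(* [F] is minus the integral of [g] along the flow line of [W] ending at [x]
   during time [t]; it is the last coordinate of a flow on R^(d+1). *)
Lemma transport_global d (W : 'rV[R]_d -> 'rV[R]_d) (g : 'rV[R]_d -> R) (c : 'rV[R]_d) (r : R) :
  (forall j, smooth setT (fun x => W x 0 j)) -> smooth setT g ->
  (forall u, r <= `|u - c| -> W u = 0) -> (forall u, r <= `|u - c| -> g u = 0) ->
  exists F : 'rV[R]_(d + 1) -> R, [/\ smooth setT F,
    forall x, F (row_mx x 0) = 0 &
    forall z, \sum_p W (lsubmx z) 0 p * partial (lshift 1 p) F z + partial (rshift d 0) F z = g (lsubmx z)].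
Proof.
move=> Ws gs W0 g0.
pose V0 (x : 'rV[R]_d) : 'rV[R]_(d + 1) := row_mx (W x) (g x)%:M.
have V0s j : smooth setT (fun x => V0 x 0 j).
  rewrite -(splitK j); case: (fintype.split j) => a /=.
    rewrite (_ : (fun x => _) = (fun x => W x 0 a)) //.
    by apply/funext => x; rewrite /V0 row_mxEl.
  rewrite (_ : (fun x => _) = g) //.
  by apply/funext => x; rewrite /V0 row_mxEr !mxE ord1 eqxx mulr1n.
have V00 u : r <= `|u - c| -> V0 u = 0.
  move=> ur; rewrite /V0 W0 // g0 //; apply/rowP => j; rewrite -(splitK j).
  by case: (fintype.split j) => a /=; rewrite ?row_mxEl ?row_mxEr !mxE ?mul0rn.
have [K [K0 HK]] := compact_support_lipschitz V0s V00.
pose V (z : 'rV[R]_(d + 1)) := V0 (lsubmx z).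
have Vs j : smooth setT (fun z => V z 0 j) by apply: (@smooth_lsubmx d 1 (fun x => V0 x 0 j)); exact: V0s.
have VK x y : `|V x - V y| <= K * `|x - y|.
  apply: le_trans (HK _ _) _; rewrite ler_wpM2l ?(ltW K0) // -raddfB.
  exact: normr_lsubmx.
have [Phi PV] := flow_exists K0 VK.
have [P0 Pd Pc] := PV.
pose last : 'I_(d + 1) := rshift d 0.
pose emb (x : 'rV[R]_d) : 'rV[R]_(d + 1) := row_mx x 0.
pose F (z : 'rV[R]_(d + 1)) : R := - Phi (- z 0 last) (emb (lsubmx z)) 0 last.
have Fs : smooth setT F.
  move=> k.
  have J := flow_joint_smooth Vs PV last.
  have oT m : open [set: 'rV[R]_m] by exact: openT.
  apply: C_opp => //.
  pose q (z : 'rV[R]_(d + 1)) : 'rV[R]_(d + 1 + 1) := row_mx (emb (lsubmx z)) (- z 0 last)%:M.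
  have := @C_comp R _ _ k setT setT q _ (oT _) (oT _) (fun _ _ => I) _ (J k).
  rewrite (_ : (fun u => _) = (fun z : 'rV[R]_(d + 1) => Phi (- z 0 last) (emb (lsubmx z)) 0 last)); last first.
    by apply/funext => z; rewrite /q row_mxEr row_mxKl !mxE eqxx mulr1n.
  apply=> j; rewrite -(splitK j); case: (fintype.split j) => a /=.
    rewrite (_ : (fun u => _) = (fun z => emb (lsubmx z) 0 a)); last first.
      by apply/funext => z; rewrite /q row_mxEl.
    rewrite -(splitK a); case: (fintype.split a) => b /=.
      rewrite (_ : (fun u => _) = (fun z : 'rV[R]_(d + 1) => z 0 (lshift 1 b))); first exact: C_coord.
      by apply/funext => z; rewrite /emb row_mxEl mxE.
    rewrite (_ : (fun u => _) = (fun=> 0)); first exact: C_cst.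
    by apply/funext => z; rewrite /emb row_mxEr mxE.
  rewrite (_ : (fun u => _) = (fun z : 'rV[R]_(d + 1) => - z 0 last)); first by apply: C_opp => //; exact: C_coord.
  by apply/funext => z; rewrite /q row_mxEr !mxE ord1 eqxx mulr1n.
exists F; split => //.
  by move=> x; rewrite /F row_mxEr mxE oppr0 row_mxKl P0 /emb row_mxEr mxE oppr0.
move=> z; pose x := lsubmx z; pose t := z 0 last.
pose Y h := lsubmx (Phi h (emb x)).
pose s h := Phi h (emb x) 0 last.
have lastE (a : 'I_1) : rshift d a = last by rewrite ord1.
have subE (A B : 'rV[R]_(d + 1)) j : (A - B) 0 j = A 0 j - B 0 j.
  by rewrite mxE [X in _ + X]mxE.
(* [V] does not depend on the last coordinate, so restarting with that coordinate reset to 0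
   translates the flow line by the amount [s h] accumulated so far. *)
have shift h w : Phi w (emb (Y h)) = Phi (w + h) (emb x) - row_mx 0 (s h)%:M.
  apply: (@flow_uniq _ V K (fun w => Phi w (emb (Y h))) (fun w => Phi (w + h) (emb x) - row_mx 0 (s h)%:M)) => //.
  - move=> w' j.
    have -> : V (Phi (w' + h) (emb x) - row_mx 0 (s h)%:M) = V (Phi (w' + h) (emb x)).
      by rewrite /V linearB /= row_mxKl subr0.
    rewrite (_ : (fun w => _) = (fun w => Phi (w + h) (emb x) 0 j - (row_mx 0 (s h)%:M : 'rV[R]_(d + 1)) 0 j)); last first.
      by apply/funext => y; rewrite !mxE.
    have H := is_derive_sub (@is_derive_shift _ R (fun w => Phi w (emb x) 0 j) w' h 1 _ (Pd (emb x) (w' + h) j)) (is_derive_cst ((row_mx 0 (s h)%:M : 'rV[R]_(d + 1)) 0 j) w' (1 : R)).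
    by apply: (is_derive_eq H); rewrite subr0.
  - rewrite P0 add0r /emb /Y; apply/rowP => j; rewrite -(splitK j).
    case: (fintype.split j) => a /=.
      by rewrite subE !row_mxEl !mxE subr0.
    by rewrite subE !row_mxEr !mxE ord1 eqxx mulr1n lastE subrr.
(* Following the flow line while the time variable advances equally increases [F] by [s h], whose
   derivative at 0 is [g x]. Differentiating this is the required equation. *)
have E h : F (row_mx (Y h) (t + h)%:M) = F z + s h.
  rewrite /F row_mxEr row_mxKl !mxE eqxx mulr1n shift.
  by rewrite subE row_mxEr !mxE eqxx mulr1n opprB addrC opprD subrK.
have Y0 : Y 0 = x by rewrite /Y P0 row_mxKl.
have zE : row_mx (Y 0) (t + 0)%:M = z.
  rewrite Y0 addr0 -[RHS]hsubmxK; congr row_mx; apply/rowP => a.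
  by rewrite !mxE !ord1 eqxx mulr1n.
have := @is_derive_curve_uniq _ F (fun h => row_mx (Y h) (t + h)%:M) 0 (fun j => (row_mx (W x) 1%:M : 'rV[R]_(d + 1)) 0 j) (g x).
rewrite zE => H; have {}H : g x = \sum_j (row_mx (W x) 1%:M : 'rV[R]_(d + 1)) 0 j * partial j F z.
apply: H.
- move=> j; rewrite -(splitK j); case: (fintype.split j) => a /=.
    rewrite row_mxEl (_ : (fun h => _) = (fun h => Phi h (emb x) 0 (lshift 1 a))); last first.
      by apply/funext => h; rewrite row_mxEl mxE.
    have D := Pd (emb x) 0 (lshift 1 a); apply: (is_derive_eq D).
    by rewrite P0 /V /emb row_mxKl /V0 row_mxEl.
  rewrite row_mxEr (_ : (fun h => _) = (fun h => t + h)); last first.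
    by apply/funext => h; rewrite row_mxEr !mxE ord1 eqxx mulr1n.
  have D := is_derive_add (is_derive_cst t (0 : R) (1 : R)) (is_derive_id (0 : R) (1 : R)).
  by apply: (is_derive_eq D); rewrite !mxE ord1 eqxx mulr1n add0r.
- exact: (smooth_diff openT Fs).
- rewrite (_ : (fun h => _) = (fun h => F z + s h)); last by apply/funext.
  have D := is_derive_add (is_derive_cst (F z) (0 : R) (1 : R)) (Pd (emb x) 0 last).
  apply: (is_derive_eq D).
  by rewrite add0r P0 /V /emb row_mxKl /V0 row_mxEr !mxE eqxx mulr1n.
rewrite H big_split_ord /= big_ord1; congr (_ + _).
  by apply: eq_bigr => p _; rewrite row_mxEl.
by rewrite row_mxEr !mxE eqxx mulr1n mul1r.
Qed.

Lemma bump_near n (u0 : 'rV[R]_n) (P : 'rV[R]_n -> Prop) : (\forall z \near u0, P z) ->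
  exists (chi : 'rV[R]_n -> R) (r : R), [/\ 0 < r, smooth setT chi,
    forall u, `|u - u0| <= r -> chi u = 1,
    forall u, 3 * r <= `|u - u0| -> chi u = 0 &
    forall u, `|u - u0| < 4 * r -> P u].
Proof.
move=> /near_dist[r [r0 Hr]].
have r4 : 0 < r / 4 by rewrite divr_gt0.
have [chi [chis chi1 chi0]] := bump u0 r4.
exists chi, (r / 4); split => // u ur; apply: Hr; lra.
Qed.

Lemma near_le_dist n (u0 : 'rV[R]_n) (r : R) : 0 < r -> \forall z \near u0, `|z - u0| <= r.
Proof.
move=> r0; have /cvgrPdist_le/(_ _ r0) := @cvg_id _ (nbhs u0).
by apply: filterS => z; rewrite distrC.
Qed.

(** The time variable of [transport_global] is replaced by the height. Since Z has derivative 1 on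
    the height, the chain rule turns the equation for [F] into Z f = g near [u0], and on the
    hyperplane the time is 0. *)
Lemma transport_exists n (u0 : 'rV[R]_n) (Z : 'rV[R]_n -> 'rV[R]_n) (c : 'cV[R]_n) (g : 'rV[R]_n -> R) :
  (forall j, smooth_at u0 (fun z => Z z 0 j)) -> smooth_at u0 g ->
  (\forall z \near u0, (Z z *m c) 0 0 = 1) ->
  exists f, [/\ smooth_at u0 f, \forall z \near u0, lied Z f z = g z &
    forall z, height u0 c z = 0 -> f z = 0].
Proof.
move=> Zs gs Zc.
have nP : \forall z \near u0, (forall j, smooth [set z] (fun z => Z z 0 j)) /\ smooth [set z] g.
  apply: filterI; last exact: gs.
  by apply: (@near_all _ _ _ (fun j z => smooth [set z] (fun z0 : 'rV[R]_n => Z z0 0 j))).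
have [chi [r [r0 chis chi1 chi0 HP]]] := bump_near nP.
have oU := @open_dist_lt n u0 (4 * r).
have Zs' j : smooth setT (fun x => (chi x *: Z x) 0 j).
  rewrite (_ : (fun x => _) = (fun x => chi x * Z x 0 j)); last by apply/funext => x; rewrite mxE.
  apply: (cutoff_smooth r0 chis chi0 oU) => //.
  by apply/smooth_pointwise => u /HP[].
have gs' : smooth setT (fun x => chi x * g x).
  apply: (cutoff_smooth r0 chis chi0 oU) => //.
  by apply/smooth_pointwise => u /HP[].
have [||F [Fs F0 FE]] := transport_global Zs' gs' (c := u0) (r := 3 * r).
- by move=> u ur; rewrite chi0 // scale0r.
- by move=> u ur; rewrite chi0 // mul0r.
pose q (x : 'rV[R]_n) : 'rV[R]_(n + 1) := row_mx x (height u0 c x)%:M.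
have qd x i j : is_derive x (delta_mx 0 i) (fun y => q y 0 j) ((row_mx (delta_mx 0 i) (c i 0)%:M : 'rV[R]_(n + 1)) 0 j).
  rewrite -(splitK j); case: (fintype.split j) => a /=.
    rewrite row_mxEl (_ : (fun y => _) = (fun y : 'rV[R]_n => y 0 a)); last by apply/funext => y; rewrite /q row_mxEl.
    by rewrite mxE eqxx /= eq_sym; exact: is_derive_entry.
  rewrite row_mxEr (_ : (fun y => _) = height u0 c); first by rewrite !mxE ord1 eqxx mulr1n; exact: partial_height.
  by apply/funext => y; rewrite /q row_mxEr !mxE ord1 eqxx mulr1n.
have qs x j : smooth_at x (fun y => q y 0 j).
  rewrite -(splitK j); case: (fintype.split j) => a /=.
    apply: (@smooth_at_eq _ _ (fun y : 'rV[R]_n => y 0 a)); last exact: smooth_at_coord.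
    by apply: filterE => y; rewrite /q row_mxEl.
  apply: (@smooth_at_eq _ _ (height u0 c)); last exact: smooth_at_height.
  by apply: filterE => y; rewrite /q row_mxEr !mxE ord1 eqxx mulr1n.
have Fs' z : smooth_at z F by apply: (smooth_at_smooth openT _ Fs).
exists (fun x => F (q x)); split.
- by apply: smooth_at_comp.
- have near1 := near_le_dist u0 r0.
  apply: filterS2 near1 Zc => z z1 zc.
  have := FE (q z); rewrite row_mxKl chi1 // scale1r mul1r => <-.
  have D i : partial i (fun x => F (q x)) z = partial (lshift 1 i) F (q z) + c i 0 * partial (rshift n 0) F (q z).
    have [_ ] := is_derive_chain (fun j => qd z i j) (smooth_at_diff (Fs' (q z))).
    rewrite /partial => ->; rewrite big_split_ord /= big_ord1; congr (_ + _).
      rewrite (bigD1 i) //= row_mxEl mxE !eqxx mul1r big1 ?addr0 // => j ji.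
      by rewrite row_mxEl mxE (negbTE ji) andbF mul0r.
    by rewrite row_mxEr !mxE eqxx mulr1n.
  rewrite /lied; under eq_bigr do rewrite D mulrDr mulrA.
  rewrite big_split /=; congr (_ + _).
  by rewrite -mulr_suml; move: zc; rewrite mxE => ->; rewrite mul1r.
- by move=> z hz; rewrite /q hz -scalemx1 scale0r F0.
Qed.

(** The height grows at unit speed along Z, so the flow carries a point [y] near [u0] to the
    hyperplane at time minus the height of [y], while [h] stays constant. *)
Lemma transport_uniq n (u0 : 'rV[R]_n) (Z : 'rV[R]_n -> 'rV[R]_n) (c : 'cV[R]_n) (h : 'rV[R]_n -> R) :
  (forall j, smooth_at u0 (fun z => Z z 0 j)) -> smooth_at u0 h ->
  (\forall z \near u0, (Z z *m c) 0 0 = 1) ->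
  (\forall z \near u0, lied Z h z = 0) ->
  (\forall z \near u0, height u0 c z = 0 -> h z = 0) ->
  \forall z \near u0, h z = 0.
Proof.
move=> Zs hs Zc Zh h0.
have nP : \forall z \near u0, [/\ forall j, smooth [set z] (fun z => Z z 0 j), smooth_at z h,
    (Z z *m c) 0 0 = 1, lied Z h z = 0 & height u0 c z = 0 -> h z = 0].
  have nZ : \forall z \near u0, forall j, smooth [set z] (fun z => Z z 0 j).
    by apply: (@near_all _ _ _ (fun j z => smooth [set z] (fun z0 : 'rV[R]_n => Z z0 0 j))).
  near=> z; split.
  - by near: z.
  - by near: z; exact: smooth_at_near.
  - by near: z.
  - by near: z.
  - by near: z.
have [chi [r [r0 chis chi1 chi0 HP]]] := bump_near nP.
have oU := @open_dist_lt n u0 (4 * r).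
pose W z := chi z *: Z z.
have Ws j : smooth setT (fun x => W x 0 j).
  rewrite (_ : (fun x => _) = (fun x => chi x * Z x 0 j)); last by apply/funext => x; rewrite mxE.
  apply: (cutoff_smooth r0 chis chi0 oU) => //.
  by apply/smooth_pointwise => u /HP[].
have W0 u : 3 * r <= `|u - u0| -> W u = 0 by move=> ur; rewrite /W chi0 // scale0r.
have [K [K0 HK]] := compact_support_lipschitz Ws W0.
have [Phi PW] := flow_exists K0 HK.
have [P0 Pd Pc] := PW.
(* For small times and starting points near [u0] the flow line remains in the ball where [chi = 1],
   that is, where [W] coincides with [Z]. *)
have [[A B] /= [nA nB] AB] : \forall q \near ((0 : R), u0), `|u0 - Phi q.1 q.2| <= r.
  have := Pc (0, u0); rewrite /continuous_at /= P0 => /cvgrPdist_le; exact.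
have /nbhs_ballP[d /= d0 Hd] := nA.
have hd : \forall y \near u0, `|height u0 c y| < d.
  have := smooth_at_cont (smooth_at_height u0 c u0) => /cvgrPdist_lt/(_ _ d0).
  by apply: filterS => y; rewrite /height subrr mul0mx mxE sub0r normrN.
apply: filterS2 nB hd => y By yd.
have near_c s : `|s| <= `|- height u0 c y| -> `|Phi s y - u0| <= r.
  rewrite normrN => sy; rewrite distrC; apply: (AB (s, y)); split => //=; apply: Hd.
  by rewrite -ball_normE /= sub0r normrN (le_lt_trans sy).
have curve s f df : `|s| <= `|- height u0 c y| -> smooth_at (Phi s y) f ->
    \sum_j Z (Phi s y) 0 j * partial j f (Phi s y) = df ->
    is_derive s (1 : R) (fun s => f (Phi s y)) df.
  move=> sy fs <-.
  have H := is_derive_curve (fun j => Pd y s j) (smooth_at_diff fs).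
  apply: (is_derive_eq H); apply: eq_bigr => j _.
  by rewrite /W chi1 ?scale1r //; exact: near_c.
have r4 : r < 4 * r by lra.
have hc : h (Phi (- height u0 c y) y) = h y.
  have := @eq_of_derive R (fun s => h (Phi s y)) (cst (h y)) (cst 0) (- height u0 c y).
  apply=> [s sy|]; last by rewrite P0.
  by have [_ hsm _ Zh0 _] := HP _ (le_lt_trans (near_c s sy) r4); exact: curve.
have ec : height u0 c (Phi (- height u0 c y) y) = 0.
  have := @eq_of_derive R (fun s => height u0 c (Phi s y)) (fun s => height u0 c y + s) (cst 1) (- height u0 c y).
  rewrite subrr; apply=> [s sy|s sy|]; last by rewrite P0 addr0.
    have [_ _ Zc1 _ _] := HP _ (le_lt_trans (near_c s sy) r4).
    apply: curve => //; first exact: smooth_at_height.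
    rewrite -[RHS]Zc1 mxE; apply: eq_bigr => j _; congr (_ * _).
    by have [_ H] := partial_height u0 c j (Phi s y); rewrite -[RHS]H.
  have D := is_derive_add (is_derive_cst (height u0 c y) s (1 : R)) (is_derive_id s (1 : R)).
  by apply: (is_derive_eq D); rewrite add0r.
rewrite -hc.
have [|_ _ _ _ H] := HP (Phi (- height u0 c y) y); last exact: H.
by apply: le_lt_trans (near_c _ _) r4.
Unshelve. all: by end_near. Qed.

End Transport.

(** * Commuting fields and local Lagrangians *)

Section Leafwise.
Context {R : realType}.

(** * Lie derivatives of functions and brackets of fields *)

Section PartialRules.
Variables (n : nat) (u : 'rV[R]_n).
Implicit Types (f g : 'rV[R]_n -> R) (Z Y : 'rV[R]_n -> 'rV[R]_n).

Lemma partial_eq f g i : (\forall z \near u, f z = g z) -> partial i f u = partial i g u.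
Proof. exact: near_eq_derive. Qed.

Lemma partial_add f g i : smooth_at u f -> smooth_at u g ->
  partial i (fun z => f z + g z) u = partial i f u + partial i g u.
Proof.
move=> fs gs.
by have [_] := is_derive_add (smooth_at_is_derive i fs) (smooth_at_is_derive i gs).
Qed.

Lemma partial_sub f g i : smooth_at u f -> smooth_at u g ->
  partial i (fun z => f z - g z) u = partial i f u - partial i g u.
Proof.
move=> fs gs.
by have [_] := is_derive_sub (smooth_at_is_derive i fs) (smooth_at_is_derive i gs).
Qed.

Lemma partial_opp f i : smooth_at u f -> partial i (fun z => - f z) u = - partial i f u.
Proof. by move=> fs; have [_] := is_derive_opp (smooth_at_is_derive i fs). Qed.

Lemma partial_mul f g i : smooth_at u f -> smooth_at u g ->
  partial i (fun z => f z * g z) u = partial i f u * g u + f u * partial i g u.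
Proof.
move=> fs gs.
by have [_] := is_derive_mul (smooth_at_is_derive i fs) (smooth_at_is_derive i gs).
Qed.

Lemma partial_sum (I : Type) (r : seq I) (F : I -> 'rV[R]_n -> R) i :
  (forall a, smooth_at u (F a)) ->
  partial i (fun z => \sum_(a <- r) F a z) u = \sum_(a <- r) partial i (F a) u.
Proof.
move=> Fs.
by have [_] := is_derive_bigsum r (fun a => smooth_at_is_derive i (Fs a)).
Qed.

Lemma partial_cst (c : R) i : partial i (fun=> c) u = 0.
Proof. exact: derive_cst. Qed.

Lemma partial_entry i j : partial i (fun z : 'rV[R]_n => z 0 j) u = (i == j)%:R.
Proof. by have [_] := is_derive_entry u j i. Qed.

Lemma partialC f i j : smooth_at u f -> partial i (partial j f) u = partial j (partial i f) u.
Proof. by move=> /smooth_atP[U [oU Uu Us]]; exact: (schwarz i j oU Uu (Us 2)). Qed.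

Lemma lied_eq Z f g : (\forall z \near u, f z = g z) -> lied Z f u = lied Z g u.
Proof. by move=> fg; apply: eq_bigr => j _; rewrite (partial_eq j fg). Qed.

Lemma lied_cst Z (c : R) : lied Z (fun=> c) u = 0.
Proof. by apply: big1 => j _; rewrite partial_cst mulr0. Qed.

Lemma lied_add Z f g : smooth_at u f -> smooth_at u g ->
  lied Z (fun z => f z + g z) u = lied Z f u + lied Z g u.
Proof.
by move=> fs gs; rewrite -big_split; apply: eq_bigr => j _; rewrite partial_add // mulrDr.
Qed.

Lemma lied_opp Z f : smooth_at u f -> lied Z (fun z => - f z) u = - lied Z f u.
Proof.
by move=> fs; rewrite -sumrN; apply: eq_bigr => j _; rewrite partial_opp // mulrN.
Qed.

Lemma lied_sub Z f g : smooth_at u f -> smooth_at u g ->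
  lied Z (fun z => f z - g z) u = lied Z f u - lied Z g u.
Proof.
by move=> fs gs; rewrite -sumrB; apply: eq_bigr => j _; rewrite partial_sub // mulrBr.
Qed.

Lemma lied_mul Z f g : smooth_at u f -> smooth_at u g ->
  lied Z (fun z => f z * g z) u = lied Z f u * g u + f u * lied Z g u.
Proof.
move=> fs gs; rewrite mulr_suml mulr_sumr -big_split; apply: eq_bigr => j _ /=.
by rewrite partial_mul //; ring.
Qed.

Lemma lied_sum Z (I : Type) (r : seq I) (F : I -> 'rV[R]_n -> R) :
  (forall a, smooth_at u (F a)) ->
  lied Z (fun z => \sum_(a <- r) F a z) u = \sum_(a <- r) lied Z (F a) u.
Proof.
move=> Fs; rewrite exchange_big; apply: eq_bigr => j _ /=.
by rewrite partial_sum // mulr_sumr.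
Qed.

Definition bracket Z Y (z : 'rV[R]_n) (j : 'I_n) : R :=
  lied Z (fun x => Y x 0 j) z - lied Y (fun x => Z x 0 j) z.

Lemma lied_comm Z Y f : (forall j, smooth_at u (fun z => Z z 0 j)) ->
  (forall j, smooth_at u (fun z => Y z 0 j)) -> smooth_at u f ->
  lied Z (lied Y f) u - lied Y (lied Z f) u = \sum_j bracket Z Y u j * partial j f u.
Proof.
move=> Zs Ys fs.
have E (X X' : 'rV[R]_n -> 'rV[R]_n) : (forall j, smooth_at u (fun z => X' z 0 j)) ->
    lied X (lied X' f) u = \sum_j lied X (fun x => X' x 0 j) u * partial j f u +
      \sum_i \sum_j X u 0 i * X' u 0 j * partial i (partial j f) u.
  move=> Xs; rewrite lied_sum; last first.
    by move=> j; apply: smooth_at_mul => //; exact: smooth_at_partial.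
  rewrite (eq_bigr (fun j => lied X (fun x => X' x 0 j) u * partial j f u + X' u 0 j * lied X (partial j f) u)); last first.
    by move=> j _; rewrite lied_mul //; exact: smooth_at_partial.
  rewrite big_split /=; congr (_ + _); rewrite exchange_big; apply: eq_bigr => j _ /=.
  by rewrite mulr_sumr; apply: eq_bigr => i _; ring.
rewrite (E Z Y) // (E Y Z) // [X in _ + X - _]exchange_big /=.
rewrite opprD addrACA -sumrB -[RHS]addr0; congr (_ + _).
  by apply: eq_bigr => j _; rewrite -mulrBl.
rewrite -sumrB big1 // => i _; rewrite -sumrB big1 // => j _.
by rewrite partialC //; ring.
Qed.

End PartialRules.

(** * The leafwise and the ordinary Poincare lemma for 1-forms and 2-forms *)

Lemma near_lied_eq n (u : 'rV[R]_n) (Z : 'rV[R]_n -> 'rV[R]_n) f g :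
  (\forall z \near u, f z = g z) -> \forall z \near u, lied Z f z = lied Z g z.
Proof. by move=> /nbhs_interior; apply: filterS => z fg; exact: lied_eq. Qed.

(** The straight line through [z] with direction [Z z] lies in the hyperplane, where [f]
    vanishes. *)
Lemma lied_tangent n (u0 : 'rV[R]_n) (c : 'cV[R]_n) (Z : 'rV[R]_n -> 'rV[R]_n) f z :
  (forall z, height u0 c z = 0 -> f z = 0) -> smooth_at z f -> height u0 c z = 0 ->
  (Z z *m c) 0 0 = 0 -> lied Z f z = 0.
Proof.
move=> f0 fs hz Zc.
have := @is_derive_curve_uniq R n f (fun s => z + s *: Z z) 0 (fun j => Z z 0 j) 0.
rewrite scale0r addr0 => H; rewrite /lied; symmetry; apply: H.
- move=> j; rewrite (_ : (fun s => _) = (fun s => z 0 j + s * Z z 0 j)); last by apply/funext => s; rewrite !mxE.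
  have D := is_derive_add (is_derive_cst (z 0 j) (0 : R) (1 : R)) (is_derive_mul (is_derive_id (0 : R) (1 : R)) (is_derive_cst (Z z 0 j) (0 : R) (1 : R))).
  by apply: (is_derive_eq D); rewrite add0r mul1r mul0r addr0.
- exact: smooth_at_diff.
- rewrite (_ : (fun s => _) = cst 0); first exact: is_derive_cst.
  apply/funext => s; rewrite f0 //.
  rewrite /height addrAC mulmxDl -scalemxAl mxE [X in _ + X]mxE Zc mulr0 addr0; exact: hz.
Qed.

(** Let [r] be the first index whose component may be nonzero. With Z_r f = g_r and f = 0 on the
    r-th hyperplane, Z_a f = 0 for a < r: it vanishes on the hyperplane, to which Z_a is tangent,
    and Z_r Z_a f = Z_a g_r = Z_r g_a = 0. Subtracting the derivatives of f thus kills the component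
    [r] and preserves the earlier zeros. *)
Lemma leafwise_poincare n m (u0 : 'rV[R]_n) (Z : 'I_m -> 'rV[R]_n -> 'rV[R]_n) (C : 'M[R]_(n, m))
    (g : 'I_m -> 'rV[R]_n -> R) :
  (forall a j, smooth_at u0 (fun z => Z a z 0 j)) -> (forall a, smooth_at u0 (g a)) ->
  (forall a b, \forall z \near u0, (Z a z *m C) 0 b = (a == b)%:R) ->
  (forall a b j, \forall z \near u0, bracket (Z a) (Z b) z j = 0) ->
  (forall a b, \forall z \near u0, lied (Z a) (g b) z = lied (Z b) (g a) z) ->
  exists f, smooth_at u0 f /\ forall a, \forall z \near u0, lied (Z a) f z = g a z.
Proof.
move=> Zs gs ZC Zcomm.
(* At most the last [s] components are nonzero; [s = m] is the claim. *)
suff H s : forall g : 'I_m -> 'rV[R]_n -> R, (forall a, smooth_at u0 (g a)) ->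
    (forall a b, \forall z \near u0, lied (Z a) (g b) z = lied (Z b) (g a) z) ->
    (forall a : 'I_m, (a + s < m)%N -> \forall z \near u0, g a z = 0) ->
    exists f, smooth_at u0 f /\ forall a, \forall z \near u0, lied (Z a) f z = g a z.
  by move=> gcl; apply: (H m) => // a; rewrite ltnNge leq_addl.
move=> {gs}; elim: s => [|s IH] {}g gs gcl g0.
  exists (fun=> 0); split; first exact: smooth_at_cst.
  move=> a; have := g0 a; rewrite addn0 ltn_ord => /(_ isT).
  by apply: filterS => z ->; rewrite lied_cst.
have [ms|sm] := leqP m s.
  by apply: IH => // a; rewrite ltnNge (leq_trans ms (leq_addl _ _)).
have rm : (m - s.+1 < m)%N by rewrite ltn_subrL /= (leq_ltn_trans (leq0n s)).
pose r := Ordinal rm; pose c := col r C.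
have Zc a : \forall z \near u0, (Z a z *m c) 0 0 = (a == r)%:R.
  apply: filterS (ZC a r) => z <-; rewrite !mxE; apply: eq_bigr => j _; by rewrite mxE.
have Zr1 : \forall z \near u0, (Z r z *m c) 0 0 = 1.
  by apply: filterS (Zc r) => z ->; rewrite eqxx.
have [f [fs Zf f0]] := transport_exists (Zs r) (gs r) Zr1.
have Zfs a : smooth_at u0 (lied (Z a) f) by exact: smooth_at_lied.
have near_comm a b h : smooth_at u0 h -> \forall z \near u0, lied (Z a) (lied (Z b) h) z = lied (Z b) (lied (Z a) h) z.
  move=> hs; near=> z.
  apply/eqP; rewrite -subr_eq0; apply/eqP.
  rewrite (@lied_comm n z (Z a) (Z b) h).
  - apply: big1 => j _; suff -> : bracket (Z a) (Z b) z j = 0 by rewrite mul0r.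
    move: j; near: z; apply: (@near_all _ _ _ (fun j z => bracket (Z a) (Z b) z j = 0)) => j; exact: Zcomm.
  - near: z; apply: (@near_all _ _ _ (fun j z => smooth_at z (fun z => Z a z 0 j))) => j; exact: smooth_at_near.
  - near: z; apply: (@near_all _ _ _ (fun j z => smooth_at z (fun z => Z b z 0 j))) => j; exact: smooth_at_near.
  - by near: z; exact: smooth_at_near.
have Zaf0 (a : 'I_m) : (a < r)%N -> \forall z \near u0, lied (Z a) f z = 0.
  move=> ar.
  have ga : \forall z \near u0, g a z = 0.
    by apply: g0; rewrite addnC -ltn_subRL; exact: ar.
  apply: (transport_uniq (Zs r) (Zfs a) Zr1).
    near=> z.
    have -> : lied (Z r) (lied (Z a) f) z = lied (Z a) (lied (Z r) f) z by near: z; exact: near_comm.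
    have -> : lied (Z a) (lied (Z r) f) z = lied (Z a) (g r) z by near: z; exact: near_lied_eq.
    have -> : lied (Z a) (g r) z = lied (Z r) (g a) z by near: z; exact: gcl.
    have -> : lied (Z r) (g a) z = lied (Z r) (fun=> 0) z by near: z; exact: near_lied_eq.
    exact: lied_cst.
  near=> z => hz; apply: (lied_tangent f0 _ hz).
    by near: z; exact: smooth_at_near.
  have -> : (Z a z *m c) 0 0 = (a == r)%:R by near: z; exact: Zc.
  by rewrite -val_eqE /= (ltn_eqF ar).
have [|||f' [fs' Zf']] := IH (fun a z => g a z - lied (Z a) f z).
- by move=> a; apply: smooth_at_sub.
- move=> a b; near=> z.
  have ga1 : smooth_at z (g a) by near: z; exact: smooth_at_near.
  have gb1 : smooth_at z (g b) by near: z; exact: smooth_at_near.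
  have fa1 : smooth_at z (lied (Z a) f) by near: z; exact: smooth_at_near.
  have fb1 : smooth_at z (lied (Z b) f) by near: z; exact: smooth_at_near.
  rewrite lied_sub // [RHS]lied_sub //.
  have -> : lied (Z a) (g b) z = lied (Z b) (g a) z by near: z; exact: gcl.
  by apply: (f_equal2 +%R erefl); congr (- _); near: z; exact: near_comm.
- move=> a; rewrite addnC -ltn_subRL -(subnSK sm) ltnS leq_eqVlt => /orP[/eqP ar|ar].
    have -> : a = r by exact: val_inj.
    by apply: filterS Zf => z ->; rewrite subrr.
  apply: filterS2 (Zaf0 a ar) (g0 a _) => [z -> ->|]; first by rewrite subrr.
  by rewrite addnC -ltn_subRL.
exists (fun z => f z + f' z); split; first exact: smooth_at_add.
move=> a; near=> z.
rewrite lied_add; last 2 first.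
- by near: z; exact: smooth_at_near.
- by near: z; exact: smooth_at_near.
have -> : lied (Z a) f' z = g a z - lied (Z a) f z by near: z; exact: Zf'.
by rewrite addrC subrK.
Unshelve. all: by end_near. Qed.

Lemma lied_delta n (r : 'I_n) (f : 'rV[R]_n -> R) z : lied (fun=> delta_mx 0 r) f z = partial r f z.
Proof.
rewrite /lied (bigD1 r) //= mxE !eqxx mul1r big1 ?addr0 // => j jr.
by rewrite mxE (negbTE jr) andbF mul0r.
Qed.

Lemma delta_mul_delta n (a r : 'I_n) :
  ((delta_mx 0 a : 'rV[R]_n) *m (delta_mx r 0 : 'cV[R]_n)) 0 0 = (a == r)%:R.
Proof. by rewrite mul_delta_mx_cond mulmxnE mxE !eqxx /= -mulr_natr mul1r. Qed.

(** Poincare's lemma for 2-forms, one row at a time. If rows before [r] vanish, take th_j with d_r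
    th_j = w_rj and th_j = 0 on the r-th hyperplane. Uniqueness gives th_a = 0 for a <= r, and, with
    closedness, d_a th_j = 0 for a < r. Hence w - d th has a zero row [r] and keeps its earlier zero
    rows. *)
Lemma closed_form_exact n (u0 : 'rV[R]_n) (w : 'I_n -> 'I_n -> 'rV[R]_n -> R) :
  (forall i j, smooth_at u0 (w i j)) ->
  (forall i j, \forall z \near u0, w i j z = - w j i z) ->
  (forall p q r, \forall z \near u0,
    partial p (w q r) z + partial q (w r p) z + partial r (w p q) z = 0) ->
  exists th : 'I_n -> 'rV[R]_n -> R, (forall j, smooth_at u0 (th j)) /\
    forall i j, \forall z \near u0, w i j z = partial i (th j) z - partial j (th i) z.
Proof.
suff H s : forall w : 'I_n -> 'I_n -> 'rV[R]_n -> R, (forall i j, smooth_at u0 (w i j)) ->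
    (forall i j, \forall z \near u0, w i j z = - w j i z) ->
    (forall p q r, \forall z \near u0,
      partial p (w q r) z + partial q (w r p) z + partial r (w p q) z = 0) ->
    (forall (a : 'I_n) j, (a + s < n)%N -> \forall z \near u0, w a j z = 0) ->
    exists th : 'I_n -> 'rV[R]_n -> R, (forall j, smooth_at u0 (th j)) /\
      forall i j, \forall z \near u0, w i j z = partial i (th j) z - partial j (th i) z.
  by move=> ws wa wc; apply: (H n) => // a j; rewrite ltnNge leq_addl.
move=> {w}; elim: s => [|s IH] w ws wa wc w0.
  exists (fun _ _ => 0); split; first by move=> j; exact: smooth_at_cst.
  move=> i j; have := w0 i j; rewrite addn0 ltn_ord => /(_ isT).
  by apply: filterS => z ->; rewrite !partial_cst subrr.
have [ns|sn] := leqP n s.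
  by apply: IH => // a j; rewrite ltnNge (leq_trans ns (leq_addl _ _)).
have rn : (n - s.+1 < n)%N by rewrite ltn_subrL /= (leq_ltn_trans (leq0n s)).
pose r := Ordinal rn; pose c : 'cV[R]_n := delta_mx r 0.
pose E : 'rV[R]_n -> 'rV[R]_n := fun=> delta_mx 0 r.
have Es j : smooth_at u0 (fun z => E z 0 j) by exact: smooth_at_cst.
have E1 : \forall z \near u0, (E z *m c) 0 0 = 1.
  by apply: filterE => z; rewrite delta_mul_delta eqxx.
have /choice[th Hth] : forall j, exists f, [/\ smooth_at u0 f, \forall z \near u0, lied E f z = w r j z &
    forall z, height u0 c z = 0 -> f z = 0].
  by move=> j; exact: (transport_exists Es (ws r j) E1).
have ths j : smooth_at u0 (th j) by have [] := Hth j.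
have thd j : \forall z \near u0, partial r (th j) z = w r j z.
  by have [_ H _] := Hth j; apply: filterS H => z; rewrite lied_delta.
have th0 j z : height u0 c z = 0 -> th j z = 0 by have [_ _] := Hth j; apply.
have uniq f : smooth_at u0 f -> (\forall z \near u0, partial r f z = 0) ->
    (\forall z \near u0, height u0 c z = 0 -> f z = 0) -> \forall z \near u0, f z = 0.
  move=> fs fr f0; apply: (transport_uniq Es fs E1) => //.
  by apply: filterS fr => z; rewrite lied_delta.
have wra (a : 'I_n) : (a <= r)%N -> \forall z \near u0, w r a z = 0.
  rewrite leq_eqVlt => /orP[/eqP/val_inj ->|ar].
    by apply: filterS (wa r r) => z ww; lra.
  have war : \forall z \near u0, w a r z = 0 by apply: w0; rewrite addnC -ltn_subRL.
  by apply: filterS2 (wa r a) war => z -> ->; rewrite oppr0.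
have tha (a : 'I_n) : (a <= r)%N -> \forall z \near u0, th a z = 0.
  move=> ar; apply: uniq => //; last by apply: filterE => z; exact: th0.
  by apply: filterS2 (thd a) (wra a ar) => z -> ->.
(* d_r d_a th_j = d_a w_rj, which closedness expresses by derivatives of entries in row and column
   [a], all zero. *)
have dth (a : 'I_n) j : (a < r)%N -> \forall z \near u0, partial a (th j) z = 0.
  move=> ar; apply: uniq; first exact: smooth_at_partial.
    near=> z.
    rewrite partialC; last by near: z; exact: smooth_at_near.
    have -> : partial a (partial r (th j)) z = partial a (w r j) z.
      by near: z; exact: near_partial_eq.
    have : partial a (w r j) z + partial r (w j a) z + partial j (w a r) z = 0 by near: z; exact: wc.
    have -> : partial j (w a r) z = partial j (fun=> 0) z.
      by near: z; apply: near_partial_eq; apply: w0; rewrite addnC -ltn_subRL.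
    have -> : partial r (w j a) z = partial r (fun=> 0) z.
      near: z; apply: near_partial_eq.
      have waj : \forall z \near u0, w a j z = 0 by apply: w0; rewrite addnC -ltn_subRL.
      by apply: filterS2 (wa j a) waj => z -> ->; rewrite oppr0.
    by rewrite !partial_cst !addr0.
  near=> z => hz; rewrite -lied_delta; apply: (lied_tangent (th0 j) _ hz).
    by near: z; exact: smooth_at_near.
  by rewrite delta_mul_delta -val_eqE /= (ltn_eqF ar).
have [||||th' [ths' Hth']] := IH (fun i j z => w i j z - (partial i (th j) z - partial j (th i) z)).
- by move=> i j; apply: smooth_at_sub => //; apply: smooth_at_sub; exact: smooth_at_partial.
- by move=> i j; apply: filterS (wa i j) => z ->; ring.
- move=> p q l; near=> z.
  have wss i j : smooth_at z (w i j).
    move: i j; near: z; apply: (@near_all _ _ _ (fun i z => forall j, smooth_at z (w i j))) => i.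
    by apply: (@near_all _ _ _ (fun j z => smooth_at z (w i j))) => j; exact: smooth_at_near.
  have tss j : smooth_at z (th j).
    by move: j; near: z; apply: (@near_all _ _ _ (fun j z => smooth_at z (th j))) => j; exact: smooth_at_near.
  have tps i j : smooth_at z (partial i (th j)) by exact: smooth_at_partial.
  rewrite !partial_sub //; try by apply: smooth_at_sub.
  have : partial p (w q l) z + partial q (w l p) z + partial l (w p q) z = 0 by near: z; exact: wc.
  rewrite (@partialC _ z (th l) q p) // (@partialC _ z (th q) l p) // (@partialC _ z (th p) l q) //.
  move: (partial p (w q l) z) (partial q (w l p) z) (partial l (w p q) z) => a b d.
  move: (partial p (partial q _) z) (partial p (partial l _) z) (partial q (partial l _) z) => x y t.
  by move=> <-; ring.
- move=> a j; rewrite addnC -ltn_subRL -(subnSK sn) ltnS => ar'.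
  have ar : (a <= r)%N := ar'.
  have nth0 : \forall z \near u0, partial j (th a) z = 0.
    by apply: filterS (near_partial_eq j (tha a ar)) => z ->; rewrite partial_cst.
  move: (ar); rewrite leq_eqVlt => /orP[/eqP/val_inj {}ar|{}ar].
    by rewrite ar in nth0 *; apply: filterS2 (thd j) nth0 => z -> ->; rewrite subr0 subrr.
  have wa0 : \forall z \near u0, w a j z = 0 by apply: w0; rewrite addnC -ltn_subRL.
  by apply: filterS3 (dth a j ar) nth0 wa0 => z -> -> ->; rewrite !subrr.
exists (fun j z => th j z + th' j z); split; first by move=> j; exact: smooth_at_add.
move=> i j; near=> z.
have tss l : smooth_at z (th l).
  by move: l; near: z; apply: (@near_all _ _ _ (fun j z => smooth_at z (th j))) => l; exact: smooth_at_near.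
have tss' l : smooth_at z (th' l).
  by move: l; near: z; apply: (@near_all _ _ _ (fun j z => smooth_at z (th' j))) => l; exact: smooth_at_near.
rewrite !partial_add //.
have : w i j z - (partial i (th j) z - partial j (th i) z) = partial i (th' j) z - partial j (th' i) z.
  by near: z; exact: Hth'.
move: (w i j z) (partial i (th j) z) (partial j (th i) z) (partial i (th' j) z) (partial j (th' i) z).
by move=> a b d x y H; rewrite -[a](subrK (b - d)) H; ring.
Unshelve. all: by end_near. Qed.

(** * Derivatives of matrix-valued functions, and the Nijenhuis tensor at a point *)

Section MatrixCalculus.
Variables (n : nat) (u : 'rV[R]_n).

Definition smooth_mx_at p q (A : 'rV[R]_n -> 'M[R]_(p, q)) :=
  forall i j, smooth_at u (fun z => A z i j).

Definition dmx p q (v : 'rV[R]_n) (A : 'rV[R]_n -> 'M[R]_(p, q)) : 'M[R]_(p, q) :=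
  \matrix_(i, j) lied (fun=> v) (fun z => A z i j) u.

Lemma dmx_mul p q r (v : 'rV[R]_n) (A : 'rV[R]_n -> 'M[R]_(p, q)) (B : 'rV[R]_n -> 'M[R]_(q, r)) :
  smooth_mx_at A -> smooth_mx_at B ->
  dmx v (fun z => A z *m B z) = dmx v A *m B u + A u *m dmx v B.
Proof.
move=> As Bs; apply/matrixP => i j; rewrite !mxE -big_split /=.
rewrite (_ : (fun z => (A z *m B z) i j) = (fun z => \sum_l A z i l * B z l j)); last first.
  by apply/funext => z; rewrite mxE.
rewrite lied_sum; last by move=> l; exact: smooth_at_mul.
by apply: eq_bigr => l _; rewrite lied_mul // !mxE.
Qed.

Lemma dmx_eq p q (v : 'rV[R]_n) (A B : 'rV[R]_n -> 'M[R]_(p, q)) :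
  (\forall z \near u, A z = B z) -> dmx v A = dmx v B.
Proof.
move=> AB; apply/matrixP => i j; rewrite !mxE; apply: lied_eq.
by apply: filterS AB => z ->.
Qed.

Lemma dmx_cst p q (v : 'rV[R]_n) (A : 'M[R]_(p, q)) : dmx v (fun=> A) = 0.
Proof. by apply/matrixP => i j; rewrite !mxE lied_cst. Qed.

Lemma smooth_mx_cst p q (A : 'M[R]_(p, q)) : smooth_mx_at (fun=> A).
Proof. by move=> i j; exact: smooth_at_cst. Qed.

Lemma smooth_mx_mul p q r (A : 'rV[R]_n -> 'M[R]_(p, q)) (B : 'rV[R]_n -> 'M[R]_(q, r)) :
  smooth_mx_at A -> smooth_mx_at B -> smooth_mx_at (fun z => A z *m B z).
Proof.
move=> As Bs i j; apply: (@smooth_at_eq _ _ _ (fun z => \sum_l A z i l * B z l j)).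
  by apply: filterE => z; rewrite mxE.
by apply: smooth_at_sum => l _; exact: smooth_at_mul.
Qed.

Lemma smooth_mx_row p q (A : 'rV[R]_n -> 'M[R]_(p, q)) a :
  smooth_mx_at A -> smooth_mx_at (fun z => row a (A z)).
Proof.
move=> As i j; apply: (@smooth_at_eq _ _ _ (fun z => A z a j)); last exact: As.
by apply: filterE => z; rewrite mxE.
Qed.

Lemma smooth_mx_tr p q (A : 'rV[R]_n -> 'M[R]_(p, q)) :
  smooth_mx_at A -> smooth_mx_at (fun z => (A z)^T).
Proof.
move=> As i j; apply: (@smooth_at_eq _ _ _ (fun z => A z j i)); last exact: As.
by apply: filterE => z; rewrite mxE.
Qed.

Lemma smooth_at_det p (A : 'rV[R]_n -> 'M[R]_p) : smooth_mx_at A -> smooth_at u (fun z => \det (A z)).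
Proof.
move=> As; apply: smooth_at_sum => s _; apply: smooth_at_mul; first exact: smooth_at_cst.
by apply: smooth_at_prod => i _; exact: As.
Qed.

Lemma near_unitmx p (A : 'rV[R]_n -> 'M[R]_p) : smooth_mx_at A -> A u \in unitmx ->
  \forall z \near u, A z \in unitmx.
Proof.
move=> As Au; have := smooth_at_cont (smooth_at_det As) => dc.
have oN : open [set x : R | x != 0] by exact: open_neq.
have du : \det (A u) != 0 by move: Au; rewrite unitmxE unitfE.
have H : \forall z \near u, \det (A z) != 0 := dc _ (open_nbhs_nbhs (conj oN du)).
by apply: filterS H => z; rewrite unitmxE unitfE.
Qed.

Lemma smooth_mx_inv p (A : 'rV[R]_n -> 'M[R]_p) : smooth_mx_at A -> A u \in unitmx ->
  smooth_mx_at (fun z => invmx (A z)).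
Proof.
move=> As Au i j.
apply: (@smooth_at_eq _ _ _ (fun z => (\det (A z))^-1 * \adj (A z) i j)).
  by apply: filterS (near_unitmx As Au) => z Az; rewrite /invmx Az [RHS]mxE.
apply: smooth_at_mul.
  by apply: smooth_at_inv; [move: Au; rewrite unitmxE unitfE|exact: smooth_at_det].
apply: (@smooth_at_eq _ _ _ (fun z => (-1) ^+ (j + i) * \det (row' j (col' i (A z))))).
  by apply: filterE => z; rewrite mxE.
apply: smooth_at_mul; first exact: smooth_at_cst.
apply: smooth_at_det => a b.
apply: (@smooth_at_eq _ _ _ (fun z => A z (lift j a) (lift i b))); last exact: As.
by apply: filterE => z; rewrite !mxE.
Qed.

Definition bracketv (X Y : 'rV[R]_n -> 'rV[R]_n) : 'rV[R]_n := dmx (X u) Y - dmx (Y u) X.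

Lemma bracketvC X Y : bracketv X Y = - bracketv Y X.
Proof. by rewrite /bracketv opprB. Qed.

Lemma bracketvE X Y j : bracketv X Y 0 j = bracket X Y u j.
Proof. by rewrite !mxE. Qed.

(* The value at [u] of N_F(X, Y) for fields with values [x], [y] at [u]: the
   derivatives of X and Y cancel. *)
Definition nijenhuis_at (F : 'rV[R]_n -> 'M[R]_n) (x y : 'rV[R]_n) : 'rV[R]_n :=
  y *m dmx (x *m F u) F - x *m dmx (y *m F u) F + x *m dmx y F *m F u - y *m dmx x F *m F u.

Lemma nijenhuis_tensorial (F : 'rV[R]_n -> 'M[R]_n) (X Y : 'rV[R]_n -> 'rV[R]_n) :
  smooth_mx_at F -> smooth_mx_at X -> smooth_mx_at Y ->
  bracketv (fun z => X z *m F z) (fun z => Y z *m F z)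
  - bracketv (fun z => X z *m F z) Y *m F u - bracketv X (fun z => Y z *m F z) *m F u
  + bracketv X Y *m F u *m F u = nijenhuis_at F (X u) (Y u).
Proof.
move=> Fs Xs Ys; rewrite /bracketv /nijenhuis_at !dmx_mul // !mulmxBl !mulmxDl.
move: (dmx (X u *m F u) Y *m F u) (dmx (Y u *m F u) X *m F u) => a b.
move: (dmx (Y u) X *m F u *m F u) (dmx (X u) Y *m F u *m F u) => c d.
move: (Y u *m dmx (X u *m F u) F) (X u *m dmx (Y u *m F u) F) => e f.
move: (Y u *m dmx (X u) F *m F u) (X u *m dmx (Y u) F *m F u) => g h.
by apply/rowP => j; rewrite !mxE; ring.
Qed.

End MatrixCalculus.

Lemma cartan_formula n (u : 'rV[R]_n) (th : 'I_n -> 'rV[R]_n -> R) (X Y : 'rV[R]_n -> 'rV[R]_n) :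
  (forall j, smooth_at u (th j)) -> smooth_mx_at u X -> smooth_mx_at u Y ->
  lied X (fun z => \sum_j Y z 0 j * th j z) u - lied Y (fun z => \sum_j X z 0 j * th j z) u =
  \sum_j bracketv u X Y 0 j * th j u +
  \sum_i \sum_j X u 0 i * (partial i (th j) u - partial j (th i) u) * Y u 0 j.
Proof.
move=> ths Xs Ys.
have E (V W : 'rV[R]_n -> 'rV[R]_n) : smooth_mx_at u W ->
    lied V (fun z => \sum_j W z 0 j * th j z) u =
    \sum_j lied V (fun z => W z 0 j) u * th j u + \sum_i \sum_j V u 0 i * partial i (th j) u * W u 0 j.
  move=> Ws; rewrite lied_sum; last by move=> j; exact: smooth_at_mul.
  rewrite (eq_bigr (fun j => lied V (fun z => W z 0 j) u * th j u + W u 0 j * lied V (th j) u)); last first.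
    by move=> j _; rewrite lied_mul.
  rewrite big_split /=; congr (_ + _); rewrite exchange_big; apply: eq_bigr => j _ /=.
  by rewrite mulr_sumr; apply: eq_bigr => i _; ring.
rewrite !E // [X in _ - (_ + X)]exchange_big /= opprD addrACA; congr (_ + _).
  by rewrite -sumrB; apply: eq_bigr => j _; rewrite bracketvE /bracket mulrBl.
rewrite -sumrB; apply: eq_bigr => i _; rewrite -sumrB; apply: eq_bigr => j _.
by ring.
Qed.

(** * Germs of tangent structures and the local Lagrangian *)

Lemma near_smooth_mx n p q (u : 'rV[R]_n) (A : 'rV[R]_n -> 'M[R]_(p, q)) :
  smooth_mx_at u A -> \forall z \near u, smooth_mx_at z A.
Proof.
move=> As; apply: (@near_all _ _ _ (fun i z => forall j, smooth_at z (fun z => A z i j))) => i.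
apply: (@near_all _ _ _ (fun j z => smooth_at z (fun z => A z i j))) => j.
exact: smooth_at_near.
Qed.

Lemma near_forall2 (T : topologicalType) (u : T) (I J : finType) (P : I -> J -> T -> Prop) :
  (forall i j, \forall z \near u, P i j z) -> \forall z \near u, forall i j, P i j z.
Proof.
move=> H; apply: (@near_all _ _ _ (fun i z => forall j, P i j z)) => i.
exact: near_all.
Qed.

Lemma smooth_at_pair n (u : 'rV[R]_n) (th : 'I_n -> 'rV[R]_n -> R) (X : 'rV[R]_n -> 'rV[R]_n) :
  (forall j, smooth_at u (th j)) -> smooth_mx_at u X -> smooth_at u (fun z => \sum_j X z 0 j * th j z).
Proof. by move=> ths Xs; apply: smooth_at_sum => j _; exact: smooth_at_mul. Qed.

(** The Nijenhuis condition is stated on vectors through [nijenhuis_at], so it applies to local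
    fields, which need not extend. [tg_ker] contains both F^2 = 0 and im F = ker F. *)
Record tangent_germ n (u0 : 'rV[R]_n) (F : 'rV[R]_n -> 'M[R]_n) : Prop := {
  tg_smooth : smooth_mx_at u0 F;
  tg_ker : \forall z \near u0, (F z == kermx (F z))%MS;
  tg_nijenhuis : \forall z \near u0, forall x y, nijenhuis_at z F x y = 0 }.

(* Near [u0], the rows of [X z *m F z] form a frame of [im F] whose fields
   commute, because they are dual to constant coordinates given by [C]. *)
Lemma tangent_frame n (u0 : 'rV[R]_n) (F : 'rV[R]_n -> 'M[R]_n) : tangent_germ u0 F ->
  exists m (X : 'rV[R]_n -> 'M[R]_(m, n)) (C : 'M[R]_(n, m)),
  [/\ smooth_mx_at u0 X, \forall z \near u0, X z *m F z *m C = 1%:M &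
      \forall z \near u0, (F z <= X z *m F z)%MS].
Proof.
move=> [Fs Fk _].
pose m := \rank (F u0); pose B : 'M[R]_(m, n) := row_base (F u0).
have Bfree : row_free B by exact: row_base_free.
have BF : (B <= F u0)%MS by rewrite eq_row_base.
pose G := B *m pinvmx (F u0); pose C := pinvmx B.
have GF : G *m F u0 = B by rewrite mulmxKpV.
(* The matrix of the frame [G *m F z] in the constant coordinates [C]. It is the identity at [u0],
   so multiplying by its inverse normalises the frame nearby. *)
pose A z := G *m F z *m C.
have As : smooth_mx_at u0 A.
  apply: smooth_mx_mul; last exact: smooth_mx_cst.
  by apply: smooth_mx_mul => //; exact: smooth_mx_cst.
have A0 : A u0 = 1%:M by rewrite /A GF mulmxVp.
have Au : A u0 \in unitmx by rewrite A0 unitmx1.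
exists m, (fun z => invmx (A z) *m G), C; split.
- apply: smooth_mx_mul; last exact: smooth_mx_cst.
  exact: smooth_mx_inv.
- apply: filterS (near_unitmx As Au) => z Az.
  by rewrite -2!mulmxA [G *m _]mulmxA mulVmx.
- have rkF z : (F z == kermx (F z))%MS -> (\rank (F z)).*2 = n.
    move=> /eqmx_rank; rewrite mxrank_ker => r; by rewrite -addnn {1}r subnK // rank_leq_row.
  have m2 : m.*2 = n by apply: rkF; exact: nbhs_singleton Fk.
  apply: filterS2 (near_unitmx As Au) Fk => z Az Fz.
  set Z := _ *m F z.
  have ZC : Z *m C = 1%:M by rewrite /Z -2!mulmxA [G *m _]mulmxA mulVmx.
  have ZF : (Z <= F z)%MS by exact: submxMl.
  have rZ : (m <= \rank Z)%N.
    by rewrite -[X in (X <= _)%N](mxrank1 R m) -ZC; exact: mxrankM_maxl.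
  rewrite -(mxrank_leqif_sup ZF).
  rewrite eqn_leq mxrankS //=; apply: leq_trans rZ.
  by rewrite -leq_double m2 (rkF z Fz).
Qed.

Lemma quadratic_formE n (A : 'M[R]_n) (x y : 'rV[R]_n) :
  \sum_i \sum_j x 0 i * A i j * y 0 j = (x *m A *m y^T) 0 0.
Proof.
rewrite !mxE exchange_big; apply: eq_bigr => j _ /=; rewrite !mxE mulr_suml.
exact: eq_bigr.
Qed.

Lemma symmetric_form n (M : 'M[R]_n) (x y : 'rV[R]_n) : M^T = M ->
  (x *m M *m y^T) 0 0 = (y *m M *m x^T) 0 0.
Proof.
move=> MT; have -> : x *m M *m y^T = (y *m M *m x^T)^T by rewrite !trmx_mul trmxK MT mulmxA.
by rewrite mxE.
Qed.

Lemma local_lagrangian n (u0 : 'rV[R]_n) (F w : 'rV[R]_n -> 'M[R]_n) :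
  tangent_germ u0 F -> smooth_mx_at u0 w ->
  (\forall z \near u0, (w z)^T = - w z) ->
  (\forall z \near u0, (F z *m w z)^T = F z *m w z) ->
  (forall p q r, \forall z \near u0, partial p (fun z => w z q r) z +
     partial q (fun z => w z r p) z + partial r (fun z => w z p q) z = 0) ->
  exists L, smooth_at u0 L /\ forall i j, \forall z \near u0,
    w z i j = partial i (fun z => \sum_l F z j l * partial l L z) z
            - partial j (fun z => \sum_l F z i l * partial l L z) z.
Proof.
move=> tF ws wT Fw wcl.
have [m [X [C [Xs ZC FZ]]]] := tangent_frame tF.
have [Fs Fk FN] := tF.
have FF : \forall z \near u0, F z *m F z = 0.
  by apply: filterS Fk => z /andP[/sub_kermxP].
pose Z z := X z *m F z.
have Zs : smooth_mx_at u0 Z by exact: smooth_mx_mul.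
pose Za a z := row a (Z z); pose Xa a z := row a (X z).
have Zas a : smooth_mx_at u0 (Za a) by exact: smooth_mx_row.
have Xas a : smooth_mx_at u0 (Xa a) by exact: smooth_mx_row.
have ZaE a z : Za a z = Xa a z *m F z by rewrite /Za /Xa row_mul.
have ZF : \forall z \near u0, Z z *m F z = 0.
  by apply: filterS FF => z FF0; rewrite -mulmxA FF0 mulmx0.
have kerZ : \forall z \near u0, forall v : 'rV[R]_n, v *m F z = 0 -> exists y, v = y *m Z z.
  apply: filterS2 FZ Fk => z FZ1 /andP[_ kF] v vF.
  apply/submxP; apply: submx_trans FZ1; apply: submx_trans kF.
  exact/sub_kermxP.
(* With F^2 = 0, vanishing of N_F says that [Z_a, Z_b] is the image under F of [Z_a, X_b] +
   [X_a, Z_b]. It therefore lies in the span of the frame, on which [C] is injective; but [C] kills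
   it, since [Z z *m C] is constant. So the bracket is zero and the sum lies in ker F. *)
have key a b : \forall z \near u0, bracketv z (Za a) (Za b) = 0 /\
    (bracketv z (Za a) (Xa b) + bracketv z (Xa a) (Za b)) *m F z = 0.
  near=> z.
  have F1 : smooth_mx_at z F by near: z; exact: near_smooth_mx.
  have X1 c : smooth_mx_at z (Xa c).
    by apply: smooth_mx_row; near: z; exact: near_smooth_mx.
  have FF1 : F z *m F z = 0 by near: z.
  have N : nijenhuis_at z F (Xa a z) (Xa b z) = 0.
    have : forall x y, nijenhuis_at z F x y = 0 by near: z.
    exact.
  have ZE c : Za c = fun z => Xa c z *m F z by apply/funext => y; exact: ZaE.
  have T := nijenhuis_tensorial F1 (X1 a) (X1 b).
  rewrite N -!ZE -[_ *m F z *m F z]mulmxA FF1 mulmx0 addr0 -addrA -opprD -mulmxDl in T.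
  have {}T : bracketv z (Za a) (Za b) = (bracketv z (Za a) (Xa b) + bracketv z (Xa a) (Za b)) *m F z.
    by apply/eqP; rewrite -subr_eq0 T.
  have H : bracketv z (Za a) (Za b) *m C = 0.
    have ZC1 : \forall z \near z, Z z *m C = 1%:M by near: z; exact: nbhs_interior.
    have Z1 : smooth_mx_at z Z by near: z; exact: near_smooth_mx.
    have dZC c v : dmx z v (Za c) *m C = 0.
      have Zs1 : smooth_mx_at z (Za c) by exact: smooth_mx_row.
      have := dmx_mul v Zs1 (smooth_mx_cst z C); rewrite dmx_cst mulmx0 addr0 => <-.
      rewrite -(dmx_cst z v (row c (1%:M : 'M[R]_m))); apply: dmx_eq.
      by apply: filterS ZC1 => y yC; rewrite /Za -row_mul yC.
    by rewrite /bracketv mulmxBl !dZC subrr.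
  have FZ1 : (F z <= Z z)%MS by near: z.
  have ZC1 : Z z *m C = 1%:M by near: z.
  rewrite -T; suff -> : bracketv z (Za a) (Za b) = 0 by [].
  have /submxP[y yZ] : (bracketv z (Za a) (Za b) <= Z z)%MS.
    by rewrite T; apply: submx_trans FZ1; exact: submxMl.
  rewrite yZ; move: H; rewrite yZ -mulmxA ZC1 mulmx1 => ->; by rewrite mul0mx.
pose pr (t : 'I_n -> 'rV[R]_n -> R) (Y : 'rV[R]_n -> 'rV[R]_n) z := \sum_j Y z 0 j * t j z.
have brZ a b : \forall z \near u0, bracketv z (Za a) (Za b) = 0 by apply: filterS (key a b) => z [].
have wanti i j : \forall z \near u0, w z i j = - w z j i.
  by apply: filterS wT => z /matrixP/(_ j i); rewrite !mxE.
have [th [ths Hth]] := closed_form_exact (fun i j => ws i j) wanti wcl.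
(* Used once for [th] and twice for its correction [th'], both primitives of [w]. *)
have cartan (t : 'I_n -> 'rV[R]_n -> R) V W : (forall j, smooth_at u0 (t j)) ->
    (forall i j, \forall z \near u0, w z i j = partial i (t j) z - partial j (t i) z) ->
    smooth_mx_at u0 V -> smooth_mx_at u0 W ->
    \forall z \near u0, lied V (pr t W) z - lied W (pr t V) z =
      \sum_j bracketv z V W 0 j * t j z + (V z *m w z *m (W z)^T) 0 0.
  move=> ts Ht Vs Ws.
  have nt : \forall z \near u0, forall j, smooth_at z (t j).
    by apply: (@near_all _ _ _ (fun j z => smooth_at z (t j))) => j; exact: smooth_at_near.
  have nH := near_forall2 Ht.
  near=> z.
  have tz : forall j, smooth_at z (t j) by near: z.
  have Hz : forall i j, w z i j = partial i (t j) z - partial j (t i) z by near: z.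
  have Vz : smooth_mx_at z V by near: z; exact: near_smooth_mx.
  have Wz : smooth_mx_at z W by near: z; exact: near_smooth_mx.
  rewrite (cartan_formula tz Vz Wz) -quadratic_formE; congr (_ + _).
  by apply: eq_bigr => i _; apply: eq_bigr => j _; rewrite Hz.
have ZaC a b : \forall z \near u0, (Za a z *m C) 0 b = (a == b)%:R.
  by apply: filterS ZC => z zc; rewrite /Za -row_mul zc !mxE.
have brZj a b j : \forall z \near u0, bracket (Za a) (Za b) z j = 0.
  by apply: filterS (brZ a b) => z zb; rewrite -bracketvE zb mxE.
have LP := leafwise_poincare (fun a j => Zas a 0 j) _ ZaC brZj.
have [||f [fs Hf]] := LP (fun a z => - pr th (Za a) z).
- by move=> a; apply: smooth_at_opp; exact: smooth_at_pair.
- move=> a b.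
  have nb := cartan th (Za a) (Za b) ths Hth (Zas a) (Zas b).
  near=> z.
  rewrite !lied_opp; last 2 first.
  + by near: z; apply: smooth_at_near; exact: smooth_at_pair.
  + by near: z; apply: smooth_at_near; exact: smooth_at_pair.
  have : lied (Za a) (pr th (Za b)) z - lied (Za b) (pr th (Za a)) z =
      \sum_j bracketv z (Za a) (Za b) 0 j * th j z + (Za a z *m w z *m (Za b z)^T) 0 0 by near: z.
  have -> : bracketv z (Za a) (Za b) = 0 by near: z; exact: brZ.
  rewrite big1 ?add0r => [|j _]; last by rewrite mxE mul0r.
  rewrite !ZaE trmx_mul !mulmxA.
  (* Skewness of w and symmetry of F w give F w F^T = - F F w. Thus im F is isotropic, and Cartan's
     formula on commuting fields reduces to the compatibility condition for [th]. *)
  have FwF : F z *m w z *m (F z)^T = 0.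
    have wTz : (w z)^T = - w z by near: z.
    have Fwz : (F z *m w z)^T = F z *m w z by near: z.
    have FFz : F z *m F z = 0 by near: z.
    have wF : w z *m (F z)^T = - (F z *m w z) by rewrite -Fwz trmx_mul wTz mulNmx opprK.
    by rewrite -mulmxA wF mulmxN mulmxA FFz mul0mx oppr0.
  rewrite -[_ *m w z *m _]mulmxA -[_ *m F z *m (_ *m _)]mulmxA [F z *m (_ *m _)]mulmxA FwF mulmx0 mul0mx mxE.
  by move/eqP; rewrite subr_eq0 => /eqP ->.
pose th' j z := th j z + partial j f z.
have ths' j : smooth_at u0 (th' j) by apply: smooth_at_add => //; exact: smooth_at_partial.
have Hth' i j : \forall z \near u0, w z i j = partial i (th' j) z - partial j (th' i) z.
  near=> z.
  have -> : w z i j = partial i (th j) z - partial j (th i) z by near: z; exact: Hth.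
  have fz : smooth_at z f by near: z; exact: smooth_at_near.
  rewrite /th' !partial_add; first last.
  - exact: smooth_at_partial.
  - by near: z; exact: smooth_at_near.
  - exact: smooth_at_partial.
  - by near: z; exact: smooth_at_near.
  by rewrite (partialC i j fz); ring.
have thZ : \forall z \near u0, forall a, pr th' (Za a) z = 0.
  apply: (@near_all _ _ _ (fun a z => pr th' (Za a) z = 0)) => a.
  apply: filterS (Hf a) => z Hz; rewrite /pr /th'.
  under eq_bigr do rewrite mulrDr.
  by rewrite big_split /= -/(pr th (Za a) z) -/(lied (Za a) f z) Hz addrN.
have [||L [Ls HL]] := LP (fun a => pr th' (Xa a)).
- by move=> a; exact: smooth_at_pair.
- move=> a b.
  (* Since th' vanishes on the Z_a, one of the two derivatives in Cartan's formula for (Z_a, X_b)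
     drops out, leaving Z_a th'(X_b) = th'([Z_a, X_b]) + w(Z_a, X_b). *)
  have nZ c : \forall z \near u0, lied (Xa c) (pr th' (Za a)) z = 0 /\ lied (Xa c) (pr th' (Za b)) z = 0.
    have Z0 d : \forall z \near u0, lied (Xa c) (pr th' (Za d)) z = 0.
      have E : \forall z \near u0, pr th' (Za d) z = 0 by apply: filterS thZ => z; exact.
      by apply: filterS (near_lied_eq (Xa c) E) => z ->; rewrite lied_cst.
    by apply: filterS2 (Z0 a) (Z0 b).
  have c1 := cartan th' (Za a) (Xa b) ths' Hth' (Zas a) (Xas b).
  have c2 := cartan th' (Za b) (Xa a) ths' Hth' (Zas b) (Xas a).
  near=> z.
  have -> : lied (Za a) (pr th' (Xa b)) z = \sum_j bracketv z (Za a) (Xa b) 0 j * th' j z + (Za a z *m w z *m (Xa b z)^T) 0 0.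
    have E1 : lied (Xa b) (pr th' (Za a)) z = 0 /\ lied (Xa b) (pr th' (Za b)) z = 0 by near: z; exact: nZ.
    by rewrite -[LHS]subr0 -[X in _ - X](proj1 E1); near: z.
  have -> : lied (Za b) (pr th' (Xa a)) z = \sum_j bracketv z (Za b) (Xa a) 0 j * th' j z + (Za b z *m w z *m (Xa a z)^T) 0 0.
    have E1 : lied (Xa a) (pr th' (Za a)) z = 0 /\ lied (Xa a) (pr th' (Za b)) z = 0 by near: z; exact: nZ.
    by rewrite -[LHS]subr0 -[X in _ - X](proj2 E1); near: z.
  have Fwz : (F z *m w z)^T = F z *m w z by near: z.
  have -> : (Za a z *m w z *m (Xa b z)^T) 0 0 = (Za b z *m w z *m (Xa a z)^T) 0 0.
    rewrite !ZaE -[Xa a z *m F z *m w z]mulmxA -[Xa b z *m F z *m w z]mulmxA.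
    exact: symmetric_form.
  apply: (f_equal2 +%R _ erefl).
  (* The remaining difference is th' evaluated on [Z_a, X_b] + [X_a, Z_b], which lies in ker F by
     [key], hence in the span of the Z_c, where th' is zero. *)
  apply/eqP; rewrite -subr_eq0 -sumrB; apply/eqP.
  have [_ U0] : bracketv z (Za a) (Za b) = 0 /\
    (bracketv z (Za a) (Xa b) + bracketv z (Xa a) (Za b)) *m F z = 0 by near: z; exact: key.
  have kz : forall v : 'rV[R]_n, v *m F z = 0 -> exists y, v = y *m Z z by near: z.
  have [y yU] := kz _ U0.
  transitivity (\sum_j (y *m Z z) 0 j * th' j z).
    by apply: eq_bigr => j _; rewrite -mulrBl -yU (bracketvC z (Xa a)) [in RHS]mxE [(- bracketv _ _ _) 0 j]mxE.
  have tz : forall a, pr th' (Za a) z = 0 by near: z.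
  under eq_bigr do rewrite mxE mulr_suml.
  rewrite exchange_big big1 // => c _ /=.
  under eq_bigr do rewrite -mulrA.
  rewrite -mulr_sumr; suff -> : \sum_j Z z c j * th' j z = 0 by rewrite mulr0.
  rewrite -[RHS](tz c); apply: eq_bigr => j _; congr (_ * _).
  by rewrite /Za [RHS]mxE.
have thE : \forall z \near u0, forall j, th' j z = \sum_l F z j l * partial l L z.
  have nL : \forall z \near u0, forall a, lied (Za a) L z = pr th' (Xa a) z.
    by apply: (@near_all _ _ _ (fun a z => lied (Za a) L z = pr th' (Xa a) z)).
  near=> z => j.
  pose dL : 'cV[R]_n := \col_l partial l L z; pose tc : 'cV[R]_n := \col_l th' l z.
  have kz : forall v : 'rV[R]_n, v *m F z = 0 -> exists y, v = y *m Z z by near: z.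
  have FZz : (F z <= Z z)%MS by near: z.
  have ZFz : Z z *m F z = 0 by near: z.
  have Ztc : Z z *m tc = 0.
    have tz : forall a, pr th' (Za a) z = 0 by near: z.
    apply/colP => a; rewrite !mxE -[RHS](tz a); apply: eq_bigr => l _.
    by rewrite !mxE.
  have Xtc : Z z *m dL = X z *m tc.
    have Lz : forall a, lied (Za a) L z = pr th' (Xa a) z by near: z.
    apply/colP => a; rewrite !mxE; have := Lz a.
    rewrite /lied /pr => E; transitivity (\sum_l Za a z 0 l * partial l L z).
      by apply: eq_bigr => l _; rewrite !mxE.
    by rewrite E; apply: eq_bigr => l _; rewrite !mxE.
  have /submxP[y yZ] : ((delta_mx 0 j : 'rV[R]_n) *m F z <= Z z)%MS by apply: submx_trans FZz; exact: submxMl.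
  (* The X_a and Z_a together span the tangent space: v F = y Z puts v - y X in ker F, which is the
     span of the Z_a. *)
  have [y' y'Z] : exists y', (delta_mx 0 j : 'rV[R]_n) - y *m X z = y' *m Z z.
    by apply: kz; rewrite mulmxBl yZ -mulmxA subrr.
  have vE : (delta_mx 0 j : 'rV[R]_n) = y *m X z + y' *m Z z by rewrite -y'Z addrC subrK.
  have : (delta_mx 0 j : 'rV[R]_n) *m (F z *m dL - tc) = 0.
    have Xi : X z *m (F z *m dL - tc) = 0 by rewrite mulmxBr mulmxA -/(Z z) Xtc subrr.
    have Zi : Z z *m (F z *m dL - tc) = 0 by rewrite mulmxBr mulmxA ZFz mul0mx Ztc subr0.
    by rewrite vE mulmxDl -(mulmxA y) -(mulmxA y') Xi Zi !mulmx0 addr0.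
  rewrite mulmxBr => /eqP; rewrite subr_eq0 => /eqP/matrixP/(_ 0 0).
  rewrite -!rowE !mxE => <-.
  by apply: eq_bigr => l _; rewrite !mxE.
exists L; split; first exact: Ls.
move=> i j; have E l : \forall z \near u0, th' l z = \sum_k F z l k * partial k L z by apply: filterS thE => z; exact.
near=> z.
have -> : partial i (fun z => \sum_l F z j l * partial l L z) z = partial i (th' j) z.
  by symmetry; near: z; exact: near_partial_eq.
have -> : partial j (fun z => \sum_l F z i l * partial l L z) z = partial j (th' i) z.
  by symmetry; near: z; exact: near_partial_eq.
by near: z; exact: Hth'.
Unshelve. all: by end_near. Qed.

End Leafwise.

(** * Change of variables *)

Section Pullback.
Context {R : realType}.

Section Germ.
Variables (k n : nat) (u : 'rV[R]_k) (iota : 'rV[R]_k -> 'rV[R]_n).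
Hypothesis iotas : smooth_mx_at u iota.

Lemma smooth_jacm : smooth_mx_at u (jacm iota).
Proof.
move=> p j; apply: (@smooth_at_eq _ _ _ (partial p (fun y => iota y 0 j))).
  by apply: filterE => z; rewrite mxE.
by apply: smooth_at_partial; exact: iotas.
Qed.

Lemma partial_comp (f : 'rV[R]_n -> R) p : smooth_at (iota u) f ->
  partial p (fun z => f (iota z)) u = \sum_j jacm iota u p j * partial j f (iota u).
Proof.
move=> fs.
have D j : is_derive u (delta_mx 0 p) (fun y => iota y 0 j) (jacm iota u p j).
  by rewrite mxE; apply: smooth_at_is_derive; exact: iotas.
by have [_] := is_derive_chain D (smooth_at_diff fs).
Qed.

Lemma lied_comp (f : 'rV[R]_n -> R) (v : 'rV[R]_k) : smooth_at (iota u) f ->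
  lied (fun=> v) (fun z => f (iota z)) u = lied (fun=> v *m jacm iota u) f (iota u).
Proof.
move=> fs; rewrite /lied.
under eq_bigr do rewrite partial_comp // mulr_sumr.
rewrite exchange_big; apply: eq_bigr => j _ /=; rewrite mxE mulr_suml.
by apply: eq_bigr => p _; rewrite mulrA.
Qed.

Lemma dmx_comp p q (A : 'rV[R]_n -> 'M[R]_(p, q)) (v : 'rV[R]_k) : smooth_mx_at (iota u) A ->
  dmx u v (fun z => A (iota z)) = dmx (iota u) (v *m jacm iota u) A.
Proof.
by move=> As; apply/matrixP => i j; rewrite !mxE (lied_comp (f := fun z => A z i j)).
Qed.

Lemma smooth_mx_comp p q (A : 'rV[R]_n -> 'M[R]_(p, q)) : smooth_mx_at (iota u) A ->
  smooth_mx_at u (fun z => A (iota z)).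
Proof.
move=> As i j; apply: (@smooth_at_comp _ _ _ _ iota (fun z => A z i j)); last exact: As.
by move=> l; exact: iotas.
Qed.

(** Both sides are the second derivative of [iota] on the pair (v, w). *)
Lemma hessian_sym (v w : 'rV[R]_k) : w *m dmx u v (jacm iota) = v *m dmx u w (jacm iota).
Proof.
have E x y j : (x *m dmx u y (jacm iota)) 0 j =
    \sum_p \sum_l x 0 p * y 0 l * partial l (partial p (fun y => iota y 0 j)) u.
  rewrite mxE; apply: eq_bigr => p _; rewrite mxE /lied mulr_sumr; apply: eq_bigr => l _.
  rewrite mulrA; congr (_ * _); congr (partial l _ u); apply/funext => z; by rewrite mxE.
apply/rowP => j; rewrite !E exchange_big; apply: eq_bigr => p _; apply: eq_bigr => l _.
by rewrite (mulrC (w 0 l)) partialC //; exact: iotas.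
Qed.

(** Differentiating the relation F D = D S expresses dF D by dS and second derivatives of [iota].
    The latter occur in pairs that cancel by [hessian_sym]; D need not be square. *)
Lemma nijenhuis_pullback (F : 'rV[R]_k -> 'M[R]_k) (S : 'rV[R]_n -> 'M[R]_n) (x y : 'rV[R]_k) :
  smooth_mx_at u F -> smooth_mx_at (iota u) S ->
  (\forall z \near u, F z *m jacm iota z = jacm iota z *m S (iota z)) ->
  nijenhuis_at u F x y *m jacm iota u =
  nijenhuis_at (iota u) S (x *m jacm iota u) (y *m jacm iota u).
Proof.
move=> Fs Ss FD; pose D := jacm iota.
have Ds : smooth_mx_at u D := smooth_jacm.
have FDu : F u *m D u = D u *m S (iota u) by exact: nbhs_singleton FD.
pose Dv v := dmx u v D; pose Sv v := dmx (iota u) (v *m D u) S.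
have A v : dmx u v F *m D u = Dv v *m S (iota u) + D u *m Sv v - F u *m Dv v.
  have := dmx_eq v FD; rewrite dmx_mul // dmx_mul //; last exact: smooth_mx_comp.
  by rewrite dmx_comp // => <-; rewrite addrK.
have B z v : z *m dmx u v F *m D u = z *m Dv v *m S (iota u) + z *m D u *m Sv v - z *m F u *m Dv v.
  by rewrite -mulmxA A mulmxBr mulmxDr !mulmxA.
have B' z v : z *m dmx u v F *m F u *m D u = z *m Dv v *m S (iota u) *m S (iota u) + z *m D u *m Sv v *m S (iota u) - z *m F u *m Dv v *m S (iota u).
  by rewrite -[_ *m F u *m D u]mulmxA FDu mulmxA B mulmxBl mulmxDl.
rewrite /nijenhuis_at mulmxBl mulmxDl mulmxBl !B !B'.
rewrite /Dv (hessian_sym (x *m F u) y) (hessian_sym (y *m F u) x) (hessian_sym (x *m F u) (y *m F u)) (hessian_sym y x).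
rewrite /Sv -!(mulmxA _ (F u)) FDu !mulmxA.
set a := x *m F u *m _ *m _; set b := y *m F u *m _ *m _.
by apply/rowP => j; rewrite !mxE; ring.
Qed.

End Germ.

End Pullback.

(** * Linear algebra of the restriction to a leaf *)

Section LeafAlgebra.
Context {R : realType}.

(** Over the reals, v D D^T = 0 forces the sum of the squares of the entries of v D to vanish. *)
Lemma gram_unitmx k n (D : 'M[R]_(k, n)) : row_free D -> D *m D^T \in unitmx.
Proof.
move=> Df; rewrite -row_free_unit -kermx_eq0; apply/eqP/row_matrixP => i; rewrite row0.
set v := row i _.
have vDD : v *m D *m D^T = 0 by rewrite -mulmxA /v -row_mul mulmx_ker row0.
suff vD : v *m D = 0 by apply: (row_free_inj Df); rewrite vD mul0mx.
have : (v *m D *m (v *m D)^T) 0 0 = 0 by rewrite trmx_mul mulmxA vDD mul0mx mxE.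
rewrite mxE => /eqP; rewrite psumr_eq0; last by move=> j _; rewrite [X in _ * X]mxE -expr2 sqr_ge0.
move=> /allP H; apply/rowP => j; have := H j (mem_index_enum j).
by rewrite [X in _ * X]mxE mulf_eq0 orbb => /eqP ->; rewrite mxE.
Qed.

(* Unlike [pinvmx], this right inverse depends smoothly on [D]. *)
Definition rinvmx k n (D : 'M[R]_(k, n)) : 'M[R]_(n, k) := D^T *m invmx (D *m D^T).

Lemma mulmx_rinv k n (D : 'M[R]_(k, n)) : row_free D -> D *m rinvmx D = 1%:M.
Proof. by move=> Df; rewrite mulmxA mulmxV // gram_unitmx. Qed.

Lemma mulmxK_rinv k n p (D : 'M[R]_(k, n)) (A : 'M[R]_(p, n)) :
  row_free D -> (A <= D)%MS -> A *m rinvmx D *m D = A.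
Proof.
by move=> Df /submxP[X ->]; rewrite -(mulmxA X) mulmx_rinv // mulmx1.
Qed.

Lemma smooth_rinvmx k n m (u : 'rV[R]_m) (D : 'rV[R]_m -> 'M[R]_(k, n)) :
  smooth_mx_at u D -> row_free (D u) -> smooth_mx_at u (fun z => rinvmx (D z)).
Proof.
move=> Ds Df; apply: smooth_mx_mul; first exact: smooth_mx_tr.
apply: smooth_mx_inv; last exact: gram_unitmx.
by apply: smooth_mx_mul => //; exact: smooth_mx_tr.
Qed.

Definition restrict_endo k n (D : 'M[R]_(k, n)) (S : 'M[R]_n) : 'M[R]_k := D *m S *m rinvmx D.

Definition restrict_bivector k n (D : 'M[R]_(k, n)) (P : 'M[R]_n) : 'M[R]_k :=
  (rinvmx D)^T *m P *m rinvmx D.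

(** Skewness turns the inclusion of the row space of [P] in that of [D] into one for columns, so [P]
    factors through [D] on both sides. *)
Lemma restrict_bivectorE k n (D : 'M[R]_(k, n)) (P : 'M[R]_n) :
  row_free D -> (P <= D)%MS -> P^T = - P -> P = D^T *m restrict_bivector D P *m D.
Proof.
move=> Df PD PT; rewrite /restrict_bivector; have := mulmxK_rinv Df PD.
move: (rinvmx D) => E PED.
have E' : D^T *m E^T *m P = P.
  rewrite -trmx_mul; apply: (can_inj trmxK).
  by rewrite [LHS]trmx_mul trmxK PT mulNmx mulmxA PED.
by rewrite -[RHS]mulmxA -[_ *m E *m D]mulmxA -[E^T *m _ *m _]mulmxA [P *m _]mulmxA PED mulmxA E'.
Qed.

(** Uniqueness lets any endomorphism intertwined with [S] by [D] inherit the smoothness of the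
    explicit formula. *)
Lemma restrict_endo_uniq k n (D : 'M[R]_(k, n)) (S : 'M[R]_n) (F : 'M[R]_k) :
  row_free D -> F *m D = D *m S -> F = restrict_endo D S.
Proof. by move=> Df FE; rewrite /restrict_endo -FE -mulmxA mulmx_rinv // mulmx1. Qed.

Lemma restrict_bivector_uniq k n (D : 'M[R]_(k, n)) (P : 'M[R]_n) (Q : 'M[R]_k) :
  row_free D -> P = D^T *m Q *m D -> Q = restrict_bivector D P.
Proof.
move=> Df ->; rewrite /restrict_bivector; have := mulmx_rinv Df.
by move: (rinvmx D) => E DE; rewrite !mulmxA -trmx_mul -mulmxA DE trmx1 mul1mx mulmx1.
Qed.

Lemma skew_inv k (A : 'M[R]_k) : A \in unitmx -> A^T = - A -> (invmx A)^T = - invmx A.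
Proof.
move=> Au AT; rewrite trmx_inv AT; apply: (can_inj (mulKmx Au)).
by rewrite mulmxN mulmxV // -{1}[A]opprK mulNmx mulmxV // -AT unitmx_tr.
Qed.

Section Restriction.
Variables (k n : nat) (D : 'M[R]_(k, n)) (P S : 'M[R]_n) (Q F : 'M[R]_k).
Hypotheses (Df : row_free D) (PT : P^T = - P) (PE : P = D^T *m Q *m D).

Lemma pullback_inj (A B : 'M[R]_k) : D^T *m A *m D = D^T *m B *m D -> A = B.
Proof.
move=> /(row_free_inj Df) /(congr1 trmx); rewrite !trmx_mul trmxK => /(row_free_inj Df).
exact: trmx_inj.
Qed.

Lemma restrict_bivector_skew : Q^T = - Q.
Proof. by apply: pullback_inj; rewrite mulmxN mulNmx -PE -PT [in RHS]PE !trmx_mul trmxK mulmxA. Qed.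

Hypothesis (DP : (D == P)%MS).

Lemma rank_bivector : \rank P = k.
Proof. by rewrite -(eqmx_rank DP) (eqP Df). Qed.

Lemma restrict_bivector_unit : Q \in unitmx.
Proof.
rewrite -row_full_unit /row_full eqn_leq rank_leq_row /= -{1}rank_bivector PE.
by rewrite (leq_trans (mxrankM_maxl _ _)) // mxrankM_maxr.
Qed.

Hypotheses (PS : (P *m S)^T = P *m S).

(** P S = (P S)^T = - S^T P has its rows in the row space of [P]. *)
Lemma endo_stable : (D *m S <= D)%MS.
Proof.
have /andP[DP' PD] := DP.
apply: submx_trans PD; have /submxP[X ->] := DP'.
by rewrite -mulmxA -PS trmx_mul PT mulmxN -mulNmx mulmxA submxMl.
Qed.

Hypothesis (FE : F *m D = D *m S).

Let QF : P *m S = D^T *m (Q *m F) *m D.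
Proof. by rewrite PE -!mulmxA FE. Qed.

Lemma restrict_endo_sym : Q *m F = - (F^T *m Q).
Proof.
rewrite -mulmxN -restrict_bivector_skew -trmx_mul; apply: pullback_inj.
by rewrite -QF -PS QF !trmx_mul trmxK !mulmxA.
Qed.

Lemma restrict_endo_form_sym : (F *m invmx Q)^T = F *m invmx Q.
Proof.
have Qu := restrict_bivector_unit.
have QuT : - Q \in unitmx by rewrite -restrict_bivector_skew unitmx_tr.
rewrite trmx_mul trmx_inv restrict_bivector_skew.
apply: (can_inj (mulKmx Qu)); apply: (can_inj (mulmxK Qu)).
have -> : Q *m (F *m invmx Q) *m Q = Q *m F by rewrite -!mulmxA mulVmx // mulmx1.
by rewrite restrict_endo_sym -[X in X *m (_ *m _)]opprK mulNmx mulKVmx // mulNmx.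
Qed.

Hypotheses (SPS : S^T *m P *m S = 0) (PSr : (\rank (P *m S)).*2 = \rank P).

Lemma restrict_endo_square : F *m F = 0.
Proof.
have E0 : F^T *m Q *m F = 0.
  apply: pullback_inj; rewrite mulmx0 mul0mx -SPS PE !mulmxA -trmx_mul FE trmx_mul.
  by rewrite -!mulmxA FE.
rewrite -[F *m F](mulKmx restrict_bivector_unit) [Q *m (F *m F)]mulmxA restrict_endo_sym.
by rewrite mulNmx E0 oppr0 mulmx0.
Qed.

Lemma restrict_endo_rank : (\rank F).*2 = k.
Proof.
rewrite -[RHS]rank_bivector -PSr QF mxrankMfree // -[\rank (D^T *m _)]mxrank_tr.
rewrite trmx_mul trmxK mxrankMfree // trmx_mul mxrankMfree ?mxrank_tr //.
by rewrite row_free_unit unitmx_tr restrict_bivector_unit.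
Qed.

(** F^2 = 0 gives one inclusion, and rank k/2 makes the dimensions equal. *)
Lemma restrict_endo_ker : (F == kermx F)%MS.
Proof.
rewrite -(geq_leqif (mxrank_leqif_eq _)); last by apply/sub_kermxP; exact: restrict_endo_square.
by rewrite mxrank_ker -{1}restrict_endo_rank -addnn addnK.
Qed.

End Restriction.

End LeafAlgebra.

(** * The Jacobi identity at a point, closedness of the inverse form, and exterior derivatives *)

Section PoissonGerm.
Context {R : realType}.

(** The Jacobiator of three functions whose differentials are the constant covectors [al], [be],
    [ga]: each term differentiates P(be, ga) along the vector sharp_P al, cyclically. *)
Definition jacobi_at n (u : 'rV[R]_n) (P : 'rV[R]_n -> 'M[R]_n) (al be ga : 'cV[R]_n) : R :=
  (be^T *m dmx u (al^T *m P u) P *m ga) 0 0 +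
  (ga^T *m dmx u (be^T *m P u) P *m al) 0 0 +
  (al^T *m dmx u (ga^T *m P u) P *m be) 0 0.

Lemma trmx11 (A : 'M[R]_1) : A^T = A.
Proof. by apply/matrixP => i j; rewrite mxE !ord1. Qed.

Lemma dmx_tr n (u v : 'rV[R]_n) p q (A : 'rV[R]_n -> 'M[R]_(p, q)) :
  dmx u v (fun z => (A z)^T) = (dmx u v A)^T.
Proof.
apply/matrixP => i j; rewrite !mxE; congr lied; apply/funext => z; by rewrite mxE.
Qed.

(* The second derivatives of [iota] cancel in the cyclic sum by [hessian_sym]. *)
Lemma jacobi_pullback k n (u : 'rV[R]_k) (iota : 'rV[R]_k -> 'rV[R]_n)
    (P : 'rV[R]_n -> 'M[R]_n) (Q : 'rV[R]_k -> 'M[R]_k) (al be ga : 'cV[R]_n) :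
  smooth_mx_at u iota -> smooth_mx_at (iota u) P -> smooth_mx_at u Q ->
  (Q u)^T = - Q u ->
  (\forall z \near u, P (iota z) = (jacm iota z)^T *m Q z *m jacm iota z) ->
  jacobi_at (iota u) P al be ga =
  jacobi_at u Q (jacm iota u *m al) (jacm iota u *m be) (jacm iota u *m ga).
Proof.
move=> si Ps Qs QT PE; have Ds := smooth_jacm si; pose D := jacm iota.
have PEu : P (iota u) = (D u)^T *m Q u *m D u by exact: nbhs_singleton PE.
pose H (a b c : 'cV[R]_n) :=
  ((D u *m b)^T *m Q u *m dmx u ((D u *m a)^T *m Q u) D *m c) 0 0.
have HC a b c : H a b c = H b a c by rewrite /H hessian_sym.
have T (a b c : 'cV[R]_n) : (b^T *m dmx (iota u) (a^T *m P (iota u)) P *m c) 0 0 =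
    ((D u *m b)^T *m dmx u ((D u *m a)^T *m Q u) Q *m (D u *m c)) 0 0 + H a b c - H a c b.
  have -> : a^T *m P (iota u) = (D u *m a)^T *m Q u *m D u by rewrite PEu trmx_mul !mulmxA.
  rewrite -dmx_comp // (dmx_eq _ PE) dmx_mul //; last first.
    by apply: smooth_mx_mul => //; exact: smooth_mx_tr.
  rewrite dmx_mul //; last exact: smooth_mx_tr.
  rewrite dmx_tr !mulmxDl !mulmxDr !mulmxDl /H.
  set v := (D u *m a)^T *m Q u; set Dv := dmx u v D.
  have -> : b^T *m (Dv^T *m Q u *m D u) *m c = - ((D u *m c)^T *m Q u *m Dv *m b).
    by rewrite -[LHS]trmx11 !trmx_mul !trmxK QT !mulmxA !mulmxN !mulNmx.
  have -> : b^T *m ((D u)^T *m dmx u v Q *m D u) *m c = (D u *m b)^T *m dmx u v Q *m (D u *m c).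
    by rewrite trmx_mul !mulmxA.
  have -> : b^T *m ((D u)^T *m Q u *m Dv) *m c = (D u *m b)^T *m Q u *m Dv *m c.
    by rewrite trmx_mul !mulmxA.
  by rewrite !mxE; ring.
rewrite /jacobi_at !T (HC be al) (HC ga be) (HC ga al).
by move: (H al be ga) (H al ga be) (H be ga al) => x y z; ring.
Qed.

(** Write w for the inverse of Q. Differentiating Q w = 1 gives dQ = - Q dw Q. On the covectors
    obtained from basis vectors through w, the Jacobiator of Q thereby becomes the cyclic sum that
    defines dw. *)
Lemma inverse_closed k (u : 'rV[R]_k) (Q : 'rV[R]_k -> 'M[R]_k) :
  smooth_mx_at u Q -> Q u \in unitmx -> (Q u)^T = - Q u ->
  (forall a b c, jacobi_at u Q a b c = 0) ->
  forall p q r, partial p (fun z => invmx (Q z) q r) u + partial q (fun z => invmx (Q z) r p) u +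
    partial r (fun z => invmx (Q z) p q) u = 0.
Proof.
move=> Qs Qu QT J; pose w z := invmx (Q z).
have ws : smooth_mx_at u w by exact: smooth_mx_inv.
have dQ v : dmx u v Q = - (Q u *m dmx u v w *m Q u).
  have QwE : \forall z \near u, Q z *m w z = 1%:M.
    by apply: filterS (near_unitmx Qs Qu) => z Qz; rewrite mulmxV.
  have := dmx_eq v QwE; rewrite dmx_mul // dmx_cst => /(canRL (addrK _)).
  by rewrite sub0r => E; rewrite -[LHS](mulmxKV Qu) E mulNmx.
have wT : (w u)^T = - w u by exact: skew_inv.
have K (x y z : 'rV[R]_k) : ((y *m w u)^T^T *m dmx u ((x *m w u)^T^T *m Q u) Q *m (z *m w u)^T) 0 0 =
    (y *m dmx u x w *m z^T) 0 0.
  rewrite !trmxK mulmxKV // dQ trmx_mul wT mulmxN mulNmx mulmxA mulmxN mulNmx opprK.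
  by rewrite 2!mulmxA mulmxKV // mulmxK.
move=> p q r.
have pE i j l : partial i (fun z => invmx (Q z) j l) u =
    ((delta_mx 0 j : 'rV[R]_k) *m dmx u (delta_mx 0 i) w *m (delta_mx 0 l : 'rV[R]_k)^T) 0 0.
  by rewrite -rowE trmx_delta -colE !mxE lied_delta.
have := J (delta_mx 0 p *m w u)^T (delta_mx 0 q *m w u)^T (delta_mx 0 r *m w u)^T.
by rewrite /jacobi_at 3!K -3!pE.
Qed.

Definition curl n (u : 'rV[R]_n) (th : 'rV[R]_n -> 'cV[R]_n) : 'M[R]_n :=
  \matrix_(i, j) (partial i (fun z => th z j 0) u - partial j (fun z => th z i 0) u).

Lemma curlE n (u v w : 'rV[R]_n) (th : 'rV[R]_n -> 'cV[R]_n) :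
  v *m curl u th *m w^T = w *m dmx u v th - v *m dmx u w th.
Proof.
have E (x y : 'rV[R]_n) : (y *m dmx u x th) 0 0 =
    \sum_i \sum_j x 0 i * partial i (fun z => th z j 0) u * y 0 j.
  rewrite mxE exchange_big; apply: eq_bigr => j _ /=; rewrite mxE mulr_sumr.
  by apply: eq_bigr => i _; rewrite mulrC.
apply/rowP => j; rewrite ord1 [RHS]mxE [X in _ = _ + X]mxE !E [X in _ = _ - X]exchange_big -sumrB mxE.
under eq_bigr do rewrite mxE mulr_suml.
rewrite exchange_big; apply: eq_bigr => i _ /=; rewrite -sumrB; apply: eq_bigr => l _.
by rewrite !mxE; ring.
Qed.

Lemma bilinear_inj n (A B : 'M[R]_n) :
  (forall v w : 'rV[R]_n, v *m A *m w^T = v *m B *m w^T) -> A = B.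
Proof.
move=> H; apply/matrixP => i j; have := H (delta_mx 0 i) (delta_mx 0 j).
by rewrite -!rowE trmx_delta -!colE => /matrixP/(_ 0 0); rewrite !mxE.
Qed.

(** The exterior derivative commutes with pullback: the second derivatives of [tau] cancel by
    [hessian_sym]. *)
Lemma curl_pullback n m (u : 'rV[R]_n) (tau : 'rV[R]_n -> 'rV[R]_m)
    (th : 'rV[R]_n -> 'cV[R]_n) (th' : 'rV[R]_m -> 'cV[R]_m) :
  smooth_mx_at u tau -> smooth_mx_at (tau u) th' ->
  (\forall z \near u, th z = jacm tau z *m th' (tau z)) ->
  curl u th = jacm tau u *m curl (tau u) th' *m (jacm tau u)^T.
Proof.
move=> ts ths thE; apply: bilinear_inj => v w.
have dE x : dmx u x th = dmx u x (jacm tau) *m th' (tau u) + jacm tau u *m dmx (tau u) (x *m jacm tau u) th'.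
  rewrite (dmx_eq _ thE) dmx_mul //; [by rewrite dmx_comp|exact: smooth_jacm|exact: smooth_mx_comp].
rewrite [LHS]curlE !dE !mulmxDr !mulmxA (hessian_sym ts w v) opprD addrACA subrr add0r.
by rewrite -curlE trmx_mul !mulmxA.
Qed.

End PoissonGerm.

(** * Charts and global sections *)

Section Charts.
Context {R : realType}.

Section Chart.
Variables (n : nat) (M : topologicalType) (a : chart R n M).

Lemma near_param x (P : M -> Prop) : dom a x -> (\forall y \near x, P y) ->
  \forall u \near coord a x, P (param a u).
Proof.
move=> ax xP; have ux : (coord a @` dom a) (coord a x) by exists x.
have pc : {for coord a x, continuous (param a)} by exact: param_continuous ux.
by apply: (pc P); rewrite coordK.
Qed.

Lemma near_coord x (P : 'rV[R]_n -> Prop) : dom a x -> (\forall u \near coord a x, P u) ->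
  \forall y \near x, P (coord a y).
Proof.
move=> ax xP; have cc : {for x, continuous (coord a)} by exact: coord_continuous ax.
exact: (cc P).
Qed.

Lemma near_dom x : dom a x -> \forall y \near x, dom a y.
Proof. by move=> ax; apply: open_nbhs_nbhs; split; [exact: dom_open|]. Qed.

Lemma near_paramK x : dom a x -> \forall u \near coord a x, coord a (param a u) = u.
Proof.
move=> ax; have : nbhs (coord a x) (coord a @` dom a).
  by apply: open_nbhs_nbhs; split; [exact: codom_open|exists x].
by apply: filterS => u [y ay <-]; rewrite coordK.
Qed.

Lemma open_coord_image (U : set M) : open U -> open (coord a @` (dom a `&` U)).
Proof.
move=> oU; rewrite openE => u [x [ax Ux] <-]; rewrite /interior.
have xU : \forall y \near x, U y by exact: open_nbhs_nbhs.
apply: filterS3 (near_param ax xU) (near_param ax (near_dom ax)) (near_paramK ax) => u' Uu au uK.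
by exists (param a u').
Qed.

Lemma dchart_eq x (f g : M -> R) : dom a x -> (\forall y \near x, f y = g y) ->
  dchart a f x = dchart a g x.
Proof.
move=> ax fg; apply/colP => j; rewrite !mxE; apply: partial_eq.
exact: near_param fg.
Qed.

End Chart.

(** * Coordinate representatives, chart changes and Jacobians *)

Section Representatives.
Variables (k n : nat) (N : manifold R k) (M : manifold R n).

Definition rep (i : N -> M) (b : atlas N) (a : atlas M) : 'rV[R]_k -> 'rV[R]_n :=
  fun u => coord a (i (param b u)).

Lemma differentialE (i : N -> M) (b : atlas N) (a : atlas M) y :
  differential i b a y = jacm (rep i b a) (coord b y).
Proof. by apply/matrixP => p j; rewrite !mxE. Qed.

Lemma near_rep (i : N -> M) (b : atlas N) (a : atlas M) y : {for y, continuous i} ->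
  dom b y -> dom a (i y) -> \forall u \near coord b y, param a (rep i b a u) = i (param b u).
Proof.
move=> ic By ay; apply: (near_param (P := fun z => param a (coord a (i z)) = i z)) => //.
by apply: (ic (fun x => param a (coord a x) = x)); apply: filterS (near_dom ay) => x /coordK.
Qed.

Lemma rep_coord (i : N -> M) (b : atlas N) (a : atlas M) y : dom b y ->
  rep i b a (coord b y) = coord a (i y).
Proof. by move=> By; rewrite /rep coordK. Qed.

Lemma smooth_fun_at n' (L : manifold R n') (U : set L) (f : L -> R) (c : atlas L) x : open U ->
  smooth_on U f -> dom c x -> U x -> smooth_at (coord c x) (f \o param c).
Proof.
move=> oU fs cx Ux.
by apply: (smooth_at_smooth (U := coord c @` (dom c `&` U))) (fs c); [exact: open_coord_image|exists x].
Qed.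

Lemma smooth_rep (i : N -> M) (b : atlas N) (a : atlas M) y : smooth_map i ->
  dom b y -> dom a (i y) -> smooth_mx_at (coord b y) (rep i b a).
Proof.
move=> [ic si] By ay p j; rewrite ord1.
apply: (smooth_fun_at (U := i @^-1` dom a) _ (si a j)) => //.
by apply: open_comp; [move=> x _; exact: ic|exact: dom_open].
Qed.

End Representatives.

Section Manifold.
Variables (n : nat) (M : manifold R n).

Lemma smooth_transition (a b : atlas M) x : dom a x -> dom b x ->
  smooth_mx_at (coord a x) (rep (fun z : M => z) a b).
Proof.
move=> ax bx p j; rewrite ord1.
apply: (smooth_at_smooth (U := coord a @` (dom a `&` dom b))); last exact: atlas_smooth.
  by apply: open_coord_image; exact: dom_open.
by exists x.
Qed.

Lemma smooth_chart_change (a b : atlas M) x (f : M -> R) : dom a x -> dom b x ->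
  smooth_at (coord a x) (f \o param a) -> smooth_at (coord b x) (f \o param b).
Proof.
move=> ax bx fs.
apply: (smooth_at_eq (f := fun u => (f \o param a) (rep (fun z : M => z) b a u))).
  have ic : {for x, continuous (fun z : M => z)} by exact: cvg_id.
  by apply: filterS (near_rep ic bx ax) => u /= ->.
apply: smooth_at_comp; first by move=> j; exact: smooth_transition.
by rewrite rep_coord.
Qed.

(** [smooth_on] quantifies over all charts; smoothness of the transition maps reduces it to one
    chart around each point. *)
Lemma smooth_onI (U : set M) (f : M -> R) :
  (forall x, U x -> exists2 a : atlas M, dom a x & smooth_at (coord a x) (f \o param a)) ->
  smooth_on U f.
Proof.
move=> H b; apply/smooth_pointwise => u [x [bx Ux] <-]; apply: smooth_at_point.
by have [a ax fs] := H x Ux; exact: smooth_chart_change fs.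
Qed.

Lemma smooth_mx_param (U : set M) p q (A : M -> 'M[R]_(p, q)) (a : atlas M) x : open U ->
  smooth_mx_on U A -> dom a x -> U x -> smooth_mx_at (coord a x) (fun u => A (param a u)).
Proof. by move=> oU As ax Ux i j; exact: smooth_fun_at (As i j) _ _. Qed.

End Manifold.

Section ChainRule.
Variables (k n : nat) (N : manifold R k) (M : manifold R n).

Lemma jacm_comp m l (u : 'rV[R]_k) (s : 'rV[R]_k -> 'rV[R]_m) (t : 'rV[R]_m -> 'rV[R]_l) :
  smooth_mx_at u s -> smooth_mx_at (s u) t ->
  jacm (fun z => t (s z)) u = jacm s u *m jacm t (s u).
Proof.
move=> ss ts; apply/matrixP => p j; rewrite [LHS]mxE (partial_comp ss (f := fun z => t z 0 j)) //.
by rewrite mxE; apply: eq_bigr => q _; rewrite [in RHS]mxE [in RHS]mxE mxE.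
Qed.

Lemma jacm_eq m l (u : 'rV[R]_m) (s t : 'rV[R]_m -> 'rV[R]_l) :
  (\forall z \near u, s z = t z) -> jacm s u = jacm t u.
Proof.
move=> st; apply/matrixP => p j; rewrite !mxE; apply: partial_eq.
by apply: filterS st => z ->.
Qed.

Lemma differential_jac (i : N -> M) (b : atlas N) (a a' : atlas M) y : smooth_map i ->
  dom b y -> dom a (i y) -> dom a' (i y) ->
  differential i b a' y = differential i b a y *m jac a a' (i y).
Proof.
move=> si By ay a'y; rewrite /jac !differentialE -(rep_coord _ _ By) -jacm_comp; first last.
- by rewrite rep_coord //; exact: smooth_transition.
- exact: smooth_rep.
apply: jacm_eq; have [ic _] := si.
by apply: filterS (near_rep (ic y) By ay) => u; rewrite /rep => ->.
Qed.

Lemma jac_differential (i : N -> M) (b b' : atlas N) (a : atlas M) y : smooth_map i ->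
  dom b y -> dom b' y -> dom a (i y) ->
  differential i b a y = jac b b' y *m differential i b' a y.
Proof.
move=> si By b'y ay; rewrite /jac !differentialE.
rewrite -[coord b' y](rep_coord (fun z : N => z) b' By) -jacm_comp; first last.
- by rewrite rep_coord //; exact: smooth_rep.
- exact: smooth_transition.
apply: jacm_eq; have ic : {for y, continuous (fun z : N => z)} by exact: cvg_id.
by apply: filterS (near_rep ic By b'y) => u; rewrite /rep => ->.
Qed.

Lemma dchart_jac (f : N -> R) (b b' : atlas N) y : dom b y -> dom b' y ->
  smooth_at (coord b' y) (f \o param b') -> dchart b f y = jac b b' y *m dchart b' f y.
Proof.
move=> By b'y fs; apply/colP => p; rewrite mxE.
have ic : {for y, continuous (fun z : N => z)} by exact: cvg_id.
rewrite (partial_eq (g := fun u => (f \o param b') (rep (fun z : N => z) b b' u))); last first.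
  by apply: filterS (near_rep ic By b'y) => u /= ->.
rewrite partial_comp; last 2 first.
- exact: smooth_transition.
- by rewrite rep_coord.
by rewrite [RHS]mxE; apply: eq_bigr => j _; rewrite /jac differentialE rep_coord // [dchart _ _ _ _ _]mxE.
Qed.

End ChainRule.

Section Jacobian.
Variables (n : nat) (M : manifold R n).

Lemma smooth_map_id : smooth_map (fun z : M => z).
Proof.
split; first by move=> x; exact: cvg_id.
move=> a j; apply: smooth_onI => x ax; exists a => //.
apply: (smooth_at_eq (f := fun u => u 0 j)); last exact: smooth_at_coord.
by apply: filterS (near_paramK ax) => u /= ->.
Qed.

Lemma jac_comp (a b c : atlas M) x : dom a x -> dom b x -> dom c x ->
  jac a c x = jac a b x *m jac b c x.
Proof. exact: (@differential_jac n n M M (fun z => z)) smooth_map_id. Qed.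

Lemma jac_id (a : atlas M) x : dom a x -> jac a a x = 1%:M.
Proof.
move=> ax; apply/matrixP => p j; rewrite /jac differentialE !mxE.
rewrite (partial_eq (g := fun u => u 0 j)); last first.
  by apply: filterS (near_paramK ax) => u; rewrite /rep => ->.
exact: partial_entry.
Qed.

Lemma jacK (a b : atlas M) x : dom a x -> dom b x -> jac a b x *m jac b a x = 1%:M.
Proof. by move=> ax bx; rewrite -jac_comp // jac_id. Qed.

Lemma smooth_jac (a b : atlas M) x : dom a x -> dom b x ->
  smooth_mx_at (coord a x) (fun u => jac a b (param a u)).
Proof.
move=> ax bx p j; have js := smooth_jacm (smooth_transition ax bx).
apply: smooth_at_eq (js p j); apply: filterS (near_paramK ax) => u uK.
by rewrite /jac differentialE uK.
Qed.

End Jacobian.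

End Charts.

(** * Global functions, forms and fields with prescribed local behaviour *)

Section GlobalSections.
Context {R : realType}.
Variables (n : nat) (M : manifold R n).

Lemma closed_ball_compact m (c : 'rV[R]_m) (r : R) : compact [set u : 'rV[R]_m | `|u - c| <= r].
Proof.
apply: bounded_closed_compact.
  exists (`|r| + `|c|); split; first exact: num_real.
  move=> s rs u ur; apply: le_trans (ltW rs).
  rewrite -[u](subrK c) (le_trans (ler_normD _ _)) // lerD2r (le_trans ur) //.
  exact: ler_norm.
have -> : [set u : 'rV[R]_m | `|u - c| <= r] = ~` [set u | r < `|u - c|].
  by apply/seteqP; split=> u /=; [move=> ur /(le_lt_trans ur); rewrite ltxx|move/negP; rewrite -leNgt].
exact/open_closedC/open_dist_gt.
Qed.

(** A bump in coordinates, extended by 0. In a Hausdorff space the image of a closed coordinate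
    ball, being compact, is closed, so the extension vanishes near every point outside the chart and
    is smooth there. *)
Lemma manifold_bump (a : atlas M) x : dom a x -> exists chi : M -> R,
  [/\ smooth_on setT chi, \forall y \near x, chi y = 1 &
      forall y, ~ dom a y -> \forall z \near y, chi z = 0].
Proof.
move=> ax; set u := coord a x.
have uV : nbhs u (coord a @` dom a).
  by apply: open_nbhs_nbhs; split; [exact: codom_open|exists x].
have [r r0 rV] : exists2 r : R, 0 < r & forall v : 'rV[R]_n, `|v - u| <= 3 * r -> (coord a @` dom a) v.
  have [e [e0 eV]] := near_dist uV; exists (e / 4); first by rewrite divr_gt0.
  move=> v vu; apply: eV; apply: le_lt_trans vu _; lra.
have [h [hs h1 h0]] := bump u r0.
pose chi y := if `[< dom a y >] then h (coord a y) else 0.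
have chiE y : dom a y -> chi y = h (coord a y) by move=> ay; rewrite /chi asboolT.
have chi0 y : ~ dom a y -> \forall z \near y, chi z = 0.
  move=> ay.
  pose B : set 'rV[R]_n := [set v | `|v - u| <= 3 * r].
  have Bc : compact B by exact: closed_ball_compact.
  have Kc : closed (param a @` B).
    apply: compact_closed; first exact: points_hausdorff.
    apply: continuous_compact => //.
    apply: continuous_in_subspaceT => v; rewrite inE => Bv.
    exact: param_continuous (rV _ Bv).
  have yK : ~ (param a @` B) y by case=> v Bv vy; apply: ay; have [z az zv] := rV v Bv; rewrite -vy -zv coordK.
  have oK : open (~` (param a @` B)) by rewrite openC.
  have : \forall z \near y, ~ (param a @` B) z by apply: open_nbhs_nbhs.
  apply: filterS => z zK; rewrite /chi; case: asboolP => // az; apply: h0.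
  rewrite leNgt; apply/negP => zr; apply: zK; exists (coord a z); first exact: ltW.
  exact: coordK.
exists chi; split => //.
- apply: smooth_onI => y _; have [ay|ay] := pselect (dom a y).
    exists a => //; apply: (smooth_at_eq (f := h)).
      apply: filterS2 (near_paramK ay) (near_param ay (near_dom ay)) => v vK av /=.
      by rewrite chiE // vK.
    by apply: (smooth_at_smooth (U := setT)) => //; exact: openT.
  have [b By] := atlas_cover y; exists b => //.
  apply: (smooth_at_eq (f := fun=> 0)); last exact: smooth_at_cst.
  by apply: filterS (near_param By (chi0 y ay)) => v /= ->.
-
  have := near_coord ax (near_le_dist u r0).
  by apply: filterS2 (near_dom ax) => y ay yr; rewrite chiE // h1.
Qed.

(** The covector is carried from chart [a] to the other charts by their Jacobians and cut off.
    Outside the domain of [a] the Jacobian is meaningless, but the cutoff vanishes on a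
    neighbourhood. *)
Lemma constant_form (a : atlas M) x (al : 'cV[R]_n) : dom a x ->
  exists th : one_form M, th a x = al.
Proof.
move=> ax; have [chi [chis chi1 chi0]] := manifold_bump ax.
pose c (b : atlas M) z : 'cV[R]_n := chi z *: (jac b a z *m al).
have cs (b : atlas M) : smooth_mx_on (dom b) (c b).
  move=> i j; apply: smooth_onI => z bz; exists b => //.
  have [az|az] := pselect (dom a z).
    apply: (smooth_at_eq (f := fun u => chi (param b u) * (jac b a (param b u) *m al) i j)).
      by apply: filterE => u /=; rewrite [RHS]mxE.
    apply: smooth_at_mul; first by apply: (smooth_fun_at (U := setT) _ chis) => //; exact: openT.
    by apply: (smooth_mx_mul (smooth_jac bz az)) => p q; exact: smooth_at_cst.
  apply: (smooth_at_eq (f := fun=> 0)); last exact: smooth_at_cst.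
  by apply: filterS (near_param bz (chi0 z az)) => u u0; rewrite /c /= mxE u0 mul0r.
have cc (b b' : atlas M) z : dom b z -> dom b' z -> c b z = jac b b' z *m c b' z.
  move=> bz b'z; rewrite /c -scalemxAr.
  have [az|az] := pselect (dom a z); first by rewrite (jac_comp bz b'z az) mulmxA.
  by rewrite (nbhs_singleton (chi0 z az)) !scale0r.
exists (OneForm cs cc) => /=.
by rewrite /c (nbhs_singleton chi1) scale1r jac_id // mul1mx.
Qed.

Lemma smooth_field_at p q (A : atlas M -> M -> 'M[R]_(p, q)) (a : atlas M) x :
  smooth_mx_on (dom a) (A a) -> dom a x -> smooth_mx_at (coord a x) (fun u => A a (param a u)).
Proof. by move=> As ax; apply: (smooth_mx_param (dom_open a) As). Qed.

Lemma lie_bracketE (X Y : atlas M -> M -> 'rV[R]_n) (a : atlas M) x : dom a x ->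
  lie_bracket X Y a x = bracketv (coord a x) (fun u => X a (param a u)) (fun u => Y a (param a u)).
Proof.
move=> ax; apply/rowP => j; rewrite !mxE /lied !coordK //.
by congr (_ - _); apply: eq_bigr => l _; rewrite mxE.
Qed.

Lemma nijenhuisE (S : endo_field M) (X Y : vector_field M) (a : atlas M) x : dom a x ->
  nijenhuis S X Y a x = nijenhuis_at (coord a x) (fun u => S a (param a u)) (X a x) (Y a x).
Proof.
move=> ax; rewrite /nijenhuis /apply_endo !lie_bracketE //.
have := nijenhuis_tensorial (smooth_field_at (ef_smooth S a) ax)
  (smooth_field_at (vf_smooth X a) ax) (smooth_field_at (vf_smooth Y a) ax).
by rewrite !coordK.
Qed.

Section Poisson.
Variable P : bivector_field M.

(** The vector is extended through a covector: sharp_P of a global form is a section of im sharp_P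
    by construction, even where the rank of [P] varies. *)
Lemma sharp_field (a : atlas M) x (v : 'rV[R]_n) : dom a x -> (v <= P a x)%MS ->
  exists X : vector_field M, section_of_im_sharp P X /\ X a x = v.
Proof.
move=> ax /submxP[al ->]; have [th thx] := constant_form al^T ax.
pose c (b : atlas M) z : 'rV[R]_n := (th b z)^T *m P b z.
have cs (b : atlas M) : smooth_mx_on (dom b) (c b).
  move=> i j; apply: smooth_onI => z bz; exists b => //.
  apply: (smooth_mx_mul (smooth_mx_tr (smooth_field_at (of1_smooth th b) bz))).
  exact: smooth_field_at (bf_smooth P b) bz.
have cc (b b' : atlas M) z : dom b z -> dom b' z -> c b' z = c b z *m jac b b' z.
  move=> bz b'z; rewrite /c (bf_compat P bz b'z) (of1_compat th bz b'z).
  by rewrite trmx_mul !mulmxA.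
exists (VectorField cs cc); split; first by move=> b z bz /=; exact: submxMl.
by rewrite /= /c thx trmxK.
Qed.

Lemma nijenhuis_im_sharp (S : endo_field M) (a : atlas M) x (v w : 'rV[R]_n) :
  locally_lagrangian_poisson P S -> dom a x -> (v <= P a x)%MS -> (w <= P a x)%MS ->
  nijenhuis_at (coord a x) (fun u => S a (param a u)) v w = 0.
Proof.
move=> MPS ax vP wP; have [X [XP <-]] := sharp_field ax vP; have [Y [YP <-]] := sharp_field ax wP.
by rewrite -nijenhuisE //; exact: (llp_nijenhuis MPS).
Qed.

Lemma endo_sharp_sym (S : endo_field M) (a : atlas M) x :
  locally_lagrangian_poisson P S -> dom a x -> (P a x *m S a x)^T = P a x *m S a x.
Proof.
move=> MPS ax; apply: bilinear_inj => v w.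
have [al alE] := constant_form v^T ax; have [be beE] := constant_form w^T ax.
have := llp_sym MPS al be ax; rewrite alE beE !trmxK => E.
rewrite -mulmxA -trmx_mul -[LHS]trmx11 [LHS]trmx_mul trmxK.
by move: E; rewrite !mulmxA => ->.
Qed.

Lemma endo_sharp_isotropic (S : endo_field M) (a : atlas M) x :
  locally_lagrangian_poisson P S -> dom a x -> (S a x)^T *m P a x *m S a x = 0.
Proof.
move=> MPS ax; apply: bilinear_inj => v w.
have [al alE] := constant_form v^T ax; have [be beE] := constant_form w^T ax.
have := llp_isotropic MPS al be ax; rewrite alE beE trmx_mul trmxK => E.
by rewrite mulmx0 mul0mx -E !mulmxA.
Qed.

(** The Jacobi identity is assumed for global functions. A differential that is constant near [x]
    ensures that iterated brackets at [x] involve no derivatives but those of [P]. *)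
Lemma linear_function (a : atlas M) x (al : 'cV[R]_n) : dom a x ->
  exists f : M -> R, smooth_on setT f /\ \forall y \near x, dchart a f y = al.
Proof.
move=> ax; have [chi [chis chi1 chi0]] := manifold_bump ax.
exists (fun y => chi y * (coord a y *m al) 0 0); split.
  apply: smooth_onI => y _; have [ay|ay] := pselect (dom a y).
    exists a => //; apply: smooth_at_mul.
      by apply: (smooth_fun_at (U := setT) _ chis) => //; exact: openT.
    apply: (smooth_at_eq (f := fun u : 'rV[R]_n => \sum_j u 0 j * al j 0)).
      by apply: filterS (near_paramK ay) => u uK; rewrite /= uK mxE.
    apply: smooth_at_sum => j _; apply: smooth_at_mul; first exact: smooth_at_coord.
    exact: smooth_at_cst.
  have [b By] := atlas_cover y; exists b => //.
  apply: (smooth_at_eq (f := fun=> 0)); last exact: smooth_at_cst.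
  by apply: filterS (near_param By (chi0 y ay)) => u u0 /=; rewrite u0 mul0r.
have chi1' : \forall y \near x, \forall z \near y, chi z = 1 by exact: nbhs_interior.
apply: filterS2 (near_dom ax) chi1' => y ay chiy; apply/colP => i; rewrite mxE.
rewrite (partial_eq (g := fun u : 'rV[R]_n => \sum_j u 0 j * al j 0)); last first.
  apply: filterS2 (near_paramK ay) (near_param ay chiy) => u uK u1 /=.
  by rewrite u1 mul1r uK mxE.
rewrite partial_sum; last by move=> j; apply: smooth_at_mul; [exact: smooth_at_coord|exact: smooth_at_cst].
rewrite (bigD1 i) //= big1 ?addr0 => [|j ji].
  rewrite partial_mul ?partial_entry ?partial_cst ?eqxx ?mul1r ?mulr0 ?addr0 //.
    exact: smooth_at_coord.
  exact: smooth_at_cst.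
rewrite partial_mul ?partial_entry ?partial_cst 1?eq_sym ?(negbTE ji) ?mul0r ?mulr0 ?addr0 //.
  exact: smooth_at_coord.
exact: smooth_at_cst.
Qed.

Lemma poisson_jacobi (a : atlas M) x (al be ga : 'cV[R]_n) : is_poisson P -> dom a x ->
  jacobi_at (coord a x) (fun u => P a (param a u)) al be ga = 0.
Proof.
move=> HP ax.
have T (f g h : M -> R) (u v w : 'cV[R]_n) : dchart a f x = u ->
    (\forall y \near x, dchart a g y = v) -> (\forall y \near x, dchart a h y = w) ->
    poisson_bracket P a f (poisson_bracket P a g h) x =
    (v^T *m dmx (coord a x) (u^T *m P a x) (fun u => P a (param a u)) *m w) 0 0.
  move=> fu gv hw; rewrite /poisson_bracket fu.
  rewrite (dchart_eq (g := fun y => (v^T *m P a y *m w) 0 0)) //; last first.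
    by apply: filterS2 gv hw => y -> ->.
  have Ps := smooth_field_at (bf_smooth P a) ax.
  rewrite (_ : v^T *m dmx _ _ _ *m w = dmx (coord a x) (u^T *m P a x) (fun z => v^T *m P a (param a z) *m w)).
    by rewrite !mxE; apply: eq_bigr => l _; rewrite [X in _ * X]mxE.
  rewrite dmx_mul; last 2 first.
  - by apply: smooth_mx_mul => //; exact: smooth_mx_cst.
  - exact: smooth_mx_cst.
  rewrite dmx_mul //; last exact: smooth_mx_cst.
  by rewrite !dmx_cst mul0mx add0r mulmx0 addr0.
have [f [fs fa]] := linear_function al ax; have [g [gs gb]] := linear_function be ax.
have [h [hs hc]] := linear_function ga ax.
rewrite /jacobi_at coordK // -(T f g h) //; last exact: nbhs_singleton fa.
rewrite -(T g h f) //; last exact: nbhs_singleton gb.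
rewrite -(T h f g) //; last exact: nbhs_singleton hc.
exact: HP.
Qed.

End Poisson.

End GlobalSections.

(** * The leaf *)

Section Leaf.
Context {R : realType}.
Variables (n : nat) (M : manifold R n) (P : bivector_field M) (S : endo_field M).
Hypothesis MPS : locally_lagrangian_poisson P S.
Variables (k : nat) (N : manifold R k) (i : N -> M).
Hypothesis leafi : integral_manifold P i.

Let i_smooth : smooth_map i := im_smooth leafi.

Section Point.
Variables (b : atlas N) (a : atlas M) (y : N).
Hypotheses (By : dom b y) (ay : dom a (i y)).

Let Df : row_free (differential i b a y). Proof. exact: (im_immersion leafi). Qed.
Let DP : (differential i b a y == P a (i y))%MS. Proof. exact: (im_tangent leafi). Qed.
Let PT : (P a (i y))^T = - P a (i y). Proof. exact: bf_skew. Qed.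

Lemma leaf_endo_stable : (differential i b a y *m S a (i y) <= differential i b a y)%MS.
Proof. exact: (endo_stable PT DP (endo_sharp_sym MPS ay)). Qed.

Lemma leaf_endo_at : let D := differential i b a y in
  restrict_endo D (S a (i y)) *m D = D *m S a (i y).
Proof. by apply: mulmxK_rinv => //; exact: leaf_endo_stable. Qed.

Lemma leaf_bivector_at : let D := differential i b a y in
  P a (i y) = D^T *m restrict_bivector D (P a (i y)) *m D.
Proof. by apply: restrict_bivectorE => //; case/andP: DP. Qed.

Lemma near_leaf : \forall u \near coord b y, [/\ dom b (param b u), coord b (param b u) = u,
  dom a (i (param b u)) & param a (rep i b a u) = i (param b u)].
Proof.
have [ic _] := i_smooth.
have ai : \forall z \near y, dom a (i z) by apply: ic; exact: near_dom.
apply: filterS3 (filterI (near_paramK By) (near_rep (ic y) By ay)) (near_param By (near_dom By)) (near_param By ai).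
by move=> u [uK ru] bu aiu.
Qed.

End Point.

Lemma chart_choice m (L : manifold R m) : exists c : L -> atlas L, forall x, dom (c x) x.
Proof. by have /choice[c Hc] := @atlas_cover _ _ L; exists c. Qed.

Lemma smooth_along p q (A : atlas M -> M -> 'M[R]_(p, q)) (b : atlas N) (a : atlas M) y :
  smooth_mx_on (dom a) (A a) -> dom b y -> dom a (i y) ->
  smooth_mx_at (coord b y) (fun u => A a (param a (rep i b a u))).
Proof.
move=> As By ay; apply: (smooth_mx_comp (smooth_rep i_smooth By ay) (A := fun u => A a (param a u))).
by rewrite rep_coord //; exact: smooth_field_at.
Qed.

Lemma smooth_differential (b : atlas N) (a : atlas M) y : dom b y -> dom a (i y) ->
  smooth_mx_at (coord b y) (jacm (rep i b a)).
Proof. by move=> By ay; apply: smooth_jacm; exact: smooth_rep. Qed.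

(** At each point the restriction is computed in a chosen chart of [M], with no regularity in the
    choice. The relation with [S] then holds in every chart and determines the result, so smoothness
    near [y] can be checked with one fixed chart. *)
Lemma leaf_endo : exists F : endo_field N, restricts_to S i F.
Proof.
have [c Hc] := chart_choice M.
have [G GE] : exists G : atlas N -> N -> 'M[R]_k, forall (b : atlas N) (a : atlas M) y, dom b y -> dom a (i y) ->
    G b y *m differential i b a y = differential i b a y *m S a (i y).
  exists (fun b y => restrict_endo (differential i b (c (i y)) y) (S (c (i y)) (i y))) => b a y By ay.
  rewrite (differential_jac i_smooth By (Hc (i y)) ay) mulmxA leaf_endo_at //.
  by rewrite -!mulmxA (ef_compat S (Hc (i y)) ay).
have Gs (b : atlas N) : smooth_mx_on (dom b) (G b).
  move=> p q; apply: smooth_onI => y By; exists b => //; set a := c (i y); have ay : dom a (i y) := Hc _.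
  pose D := jacm (rep i b a).
  have Du : D (coord b y) = differential i b a y by rewrite differentialE.
  have Ds : smooth_mx_at (coord b y) D by exact: smooth_differential.
  apply: (smooth_at_eq (f := fun u => restrict_endo (D u) (S a (param a (rep i b a u))) p q)).
    apply: filterS (near_leaf By ay) => u [bu uK au iu] /=; rewrite iu.
    have -> : D u = differential i b a (param b u) by rewrite differentialE uK.
    by rewrite -(restrict_endo_uniq _ (GE b a _ bu au)) //; exact: (im_immersion leafi).
  apply: smooth_mx_mul.
    by apply: smooth_mx_mul => //; exact: smooth_along (ef_smooth S a) By ay.
  by apply: smooth_rinvmx => //; rewrite Du; exact: (im_immersion leafi).
have Gc (b b' : atlas N) y : dom b y -> dom b' y -> G b y *m jac b b' y = jac b b' y *m G b' y.
  move=> By b'y; have ay := Hc (i y).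
  apply: (row_free_inj (im_immersion leafi b'y ay)).
  by rewrite -!mulmxA GE // -jac_differential // GE // (jac_differential i_smooth By b'y ay) mulmxA.
by exists (EndoField Gs Gc).
Qed.

(** * The bivector of the leaf and the inverse 2-form *)

Definition leaf_bivector (Q : atlas N -> N -> 'M[R]_k) :=
  forall (b : atlas N) (a : atlas M) y, dom b y -> dom a (i y) ->
    P a (i y) = (differential i b a y)^T *m Q b y *m differential i b a y.

Lemma leaf_bivector_exists : exists Q, leaf_bivector Q.
Proof.
have [c Hc] := chart_choice M.
exists (fun b y => restrict_bivector (differential i b (c (i y)) y) (P (c (i y)) (i y))).
move=> b a y By ay; rewrite (differential_jac i_smooth By (Hc (i y)) ay).
rewrite (bf_compat P (Hc (i y)) ay) {1}(leaf_bivector_at By (Hc (i y))).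
by rewrite trmx_mul !mulmxA.
Qed.

Section Bivector.
Variable Q : atlas N -> N -> 'M[R]_k.
Hypothesis QE : leaf_bivector Q.

Section AtPoint.
Variables (b : atlas N) (y : N).
Hypothesis By : dom b y.

Lemma leaf_bivector_skew : (Q b y)^T = - Q b y.
Proof.
have [a ay] := atlas_cover (i y).
exact: (restrict_bivector_skew (im_immersion leafi By ay) (bf_skew P ay) (QE By ay)).
Qed.

Lemma leaf_bivector_unit : Q b y \in unitmx.
Proof.
have [a ay] := atlas_cover (i y).
exact: (restrict_bivector_unit (im_immersion leafi By ay) (QE By ay) (im_tangent leafi By ay)).
Qed.

Lemma smooth_leaf_bivector : smooth_mx_at (coord b y) (fun u => Q b (param b u)).
Proof.
have [a ay] := atlas_cover (i y); pose D := jacm (rep i b a).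
have Du : D (coord b y) = differential i b a y by rewrite differentialE.
have Es : smooth_mx_at (coord b y) (fun u => rinvmx (D u)).
  apply: smooth_rinvmx; first exact: smooth_differential.
  by rewrite Du; exact: (im_immersion leafi).
move=> p q.
apply: (smooth_at_eq (f := fun u => restrict_bivector (D u) (P a (param a (rep i b a u))) p q)).
  apply: filterS (near_leaf By ay) => u [bu uK au iu] /=; rewrite iu.
  have DuE : D u = differential i b a (param b u) by rewrite differentialE uK.
  have Df : row_free (D u) by rewrite DuE; exact: (im_immersion leafi).
  by rewrite DuE -(restrict_bivector_uniq _ (QE bu au)) // -DuE.
apply: smooth_mx_mul => //; apply: smooth_mx_mul; first exact: smooth_mx_tr.
exact: smooth_along (bf_smooth P a) By ay.
Qed.

Lemma leaf_bivector_jacobi (al be ga : 'cV[R]_k) :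
  jacobi_at (coord b y) (fun u => Q b (param b u)) al be ga = 0.
Proof.
have [a ay] := atlas_cover (i y); pose D := differential i b a y.
(* Every covector of the leaf is the restriction of an ambient one, so the ambient Jacobi identity
   covers all cases. *)
have DK (v : 'cV[R]_k) : v = D *m (rinvmx D *m v).
  by rewrite mulmxA mulmx_rinv ?mul1mx //; exact: (im_immersion leafi).
rewrite (DK al) (DK be) (DK ga) /D differentialE.
rewrite -(jacobi_pullback (P := fun u => P a (param a u))).
- by rewrite rep_coord // poisson_jacobi //; exact: llp_poisson MPS.
- exact: smooth_rep.
- by rewrite rep_coord //; exact: smooth_field_at (bf_smooth P a) ay.
- exact: smooth_leaf_bivector.
- by rewrite coordK // leaf_bivector_skew.
- apply: filterS (near_leaf By ay) => u [bu uK au iu] /=.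
  by rewrite iu (QE bu au) differentialE uK.
Qed.

End AtPoint.

Lemma leaf_two_form : exists w : two_form N, forall b y, w b y = invmx (Q b y).
Proof.
pose w (b : atlas N) y := invmx (Q b y).
have ws (b : atlas N) : smooth_mx_on (dom b) (w b).
  move=> p q; apply: smooth_onI => y By; exists b => //.
  apply: (smooth_mx_inv (smooth_leaf_bivector By)).
  by rewrite coordK // leaf_bivector_unit.
have wT (b : atlas N) y : dom b y -> (w b y)^T = - w b y.
  by move=> By; apply: skew_inv; [exact: leaf_bivector_unit|exact: leaf_bivector_skew].
have wc (b b' : atlas N) y : dom b y -> dom b' y ->
    w b y = jac b b' y *m w b' y *m (jac b b' y)^T.
  move=> By b'y; have [a ay] := atlas_cover (i y).
  (* The contravariant law for [Q], by injectivity of pushing forward to [M]; inverting it gives the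
     covariant law of the form. *)
  have QQ : Q b' y = (jac b b' y)^T *m Q b y *m jac b b' y.
    apply: (pullback_inj (im_immersion leafi b'y ay)).
    by rewrite -(QE b'y ay) (QE By ay) (jac_differential i_smooth By b'y ay) trmx_mul !mulmxA.
  have Ju : jac b b' y \in unitmx by exact: (mulmx1_unit (jacK By b'y)).1.
  have JTu : (jac b b' y)^T \in unitmx by rewrite unitmx_tr.
  have QJ : Q b y *m jac b b' y = invmx (jac b b' y)^T *m Q b' y by rewrite QQ -mulmxA mulKmx.
  apply: (can_inj (mulKmx (leaf_bivector_unit By))).
  rewrite mulmxV ?leaf_bivector_unit // !mulmxA QJ mulmxK ?leaf_bivector_unit //.
  by rewrite mulVmx.
by exists (TwoForm ws wT wc).
Qed.

End Bivector.

(** * The tangent and Lagrangian structure of the leaf *)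

Section Lagrangian.
Variables (F : endo_field N) (Q : atlas N -> N -> 'M[R]_k) (w : two_form N).
Hypotheses (FE : restricts_to S i F) (QE : leaf_bivector Q).
Hypothesis wE : forall b y, w b y = invmx (Q b y).

Lemma leaf_nijenhuis (b : atlas N) y (v v' : 'rV[R]_k) : dom b y ->
  nijenhuis_at (coord b y) (fun u => F b (param b u)) v v' = 0.
Proof.
move=> By; have [a ay] := atlas_cover (i y).
have /andP[DP _] := im_tangent leafi By ay.
apply: (row_free_inj (im_immersion leafi By ay)); rewrite differentialE mul0mx.
rewrite (nijenhuis_pullback _ _ (S := fun u => S a (param a u))).
- rewrite rep_coord //.
  have DP' (x : 'rV[R]_k) : (x *m jacm (rep i b a) (coord b y) <= P a (i y))%MS.
    by rewrite -differentialE; apply: submx_trans DP; exact: submxMl.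
  exact: (nijenhuis_im_sharp MPS).
- exact: smooth_rep.
- exact: smooth_field_at (ef_smooth F b) By.
- by rewrite rep_coord //; exact: smooth_field_at (ef_smooth S a) ay.
- apply: filterS (near_leaf By ay) => u [bu uK au iu].
  by have := FE bu au; rewrite iu differentialE uK.
Qed.

Section AtPoint.
Variables (b : atlas N) (y : N).
Hypothesis By : dom b y.

Lemma leaf_endo_square : F b y *m F b y = 0.
Proof.
have [a ay] := atlas_cover (i y).
exact: (restrict_endo_square (im_immersion leafi By ay) (bf_skew P ay) (QE By ay)
  (im_tangent leafi By ay) (endo_sharp_sym MPS ay) (FE By ay) (endo_sharp_isotropic MPS ay)).
Qed.

Lemma leaf_endo_ker : (F b y == kermx (F b y))%MS.
Proof.
have [a ay] := atlas_cover (i y).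
exact: (restrict_endo_ker (im_immersion leafi By ay) (bf_skew P ay) (QE By ay)
  (im_tangent leafi By ay) (endo_sharp_sym MPS ay) (FE By ay) (endo_sharp_isotropic MPS ay)
  (llp_rank MPS ay)).
Qed.

Lemma leaf_endo_form_sym : (F b y *m w b y)^T = F b y *m w b y.
Proof.
have [a ay] := atlas_cover (i y); rewrite wE.
exact: (restrict_endo_form_sym (im_immersion leafi By ay) (bf_skew P ay) (QE By ay)
  (im_tangent leafi By ay) (endo_sharp_sym MPS ay) (FE By ay)).
Qed.

Lemma leaf_form_closed p q r :
  partial p (fun u => w b (param b u) q r) (coord b y) +
  partial q (fun u => w b (param b u) r p) (coord b y) +
  partial r (fun u => w b (param b u) p q) (coord b y) = 0.
Proof.
have wE' p' q' : (fun u => w b (param b u) p' q') = (fun u => invmx (Q b (param b u)) p' q').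
  by apply/funext => u; rewrite wE.
rewrite !wE'; apply: (inverse_closed (smooth_leaf_bivector QE By)).
- by rewrite coordK //; exact: leaf_bivector_unit.
- by rewrite coordK //; exact: leaf_bivector_skew.
- exact: leaf_bivector_jacobi.
Qed.

End AtPoint.

Lemma near_param_dom (b : atlas N) y (A : N -> Prop) : dom b y -> (forall z, dom b z -> A z) ->
  \forall u \near coord b y, A (param b u).
Proof. by move=> By H; apply: filterS (near_param By (near_dom By)) => u /H. Qed.

Lemma leaf_tangent_germ (b : atlas N) y : dom b y -> tangent_germ (coord b y) (fun u => F b (param b u)).
Proof.
move=> By; split.
- exact: smooth_field_at (ef_smooth F b) By.
- by apply: (near_param_dom By (A := fun z => (F b z == kermx (F b z))%MS)) => z bz; exact: leaf_endo_ker.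
- apply: filterS2 (near_paramK By) (near_param By (near_dom By)) => u uK bu v v'.
  by rewrite -{1}uK leaf_nijenhuis.
Qed.

Lemma leaf_tangent_structure : tangent_structure F.
Proof.
split; [exact: leaf_endo_square|exact: leaf_endo_ker|].
by move=> X Y b y By; rewrite nijenhuisE // leaf_nijenhuis.
Qed.

Lemma leaf_symplectic : symplectic w.
Proof.
split=> b y By; first by rewrite wE unitmx_inv; exact: leaf_bivector_unit.
by move=> p q r; rewrite !mxE; exact: leaf_form_closed.
Qed.

Lemma leaf_formP : leaf_form P i w.
Proof.
move=> b a y By ay al be v v' vE v'E; have Df := im_immersion leafi By ay.
have PE := QE By ay; have Qu := leaf_bivector_unit QE By.
(* A tangent vector of the leaf that maps to sharp_P of [c] is the image under [Q] of the
   restriction of [c]; this makes the value independent of the covector chosen. *)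
have E (x : 'rV[R]_k) (c : 'cV[R]_n) : x *m differential i b a y = c^T *m P a (i y) ->
    x = (differential i b a y *m c)^T *m Q b y.
  by move=> xE; apply: (row_free_inj Df); rewrite xE PE trmx_mul !mulmxA.
rewrite wE (E _ _ vE) mulmxK // (E _ _ v'E) [(_ *m Q b y)^T]trmx_mul trmxK.
rewrite (leaf_bivector_skew QE By) mulNmx mulmxN PE [(_ *m al)^T]trmx_mul.
by rewrite !mulmxA.
Qed.

Lemma ext_d1E (th : atlas N -> N -> 'cV[R]_k) (b : atlas N) y :
  ext_d1 th b y = curl (coord b y) (fun u => th b (param b u)).
Proof. by apply/matrixP => p q; rewrite !mxE. Qed.

Lemma ext_d1_jac (th : atlas N -> N -> 'cV[R]_k) (b b' : atlas N) y : dom b y -> dom b' y ->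
  smooth_mx_at (coord b y) (fun u => th b (param b u)) ->
  (\forall z \near y, th b' z = jac b' b z *m th b z) ->
  ext_d1 th b' y = jac b' b y *m ext_d1 th b y *m (jac b' b y)^T.
Proof.
move=> By b'y ths thE; have ic : {for y, continuous (fun z : N => z)} by exact: cvg_id.
rewrite !ext_d1E /jac differentialE.
rewrite (curl_pullback (tau := rep (fun z : N => z) b' b) (th' := fun u => th b (param b u))).
- by rewrite rep_coord.
- exact: smooth_transition.
- by rewrite rep_coord.
- apply: filterS3 (near_param b'y thE) (near_paramK b'y) (near_rep ic b'y By) => u thu uK ru.
  by rewrite thu ru /jac differentialE uK.
Qed.

(** The Lagrangian is found in one chart [b] around [y]. In any other chart the equation follows
    because [w] and d(dL o F) transform by the same law; on [U] the function is smooth enough for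
    [ext_d1_jac]. *)
Lemma leaf_lagrangian y : exists (U : set N) (L : N -> R),
  [/\ open U, U y, smooth_on U L &
      forall (b : atlas N) (z : N), dom b z -> U z -> w b z = ext_d1 (d_comp L F) b z].
Proof.
have [b By] := atlas_cover y.
have [||||L [Ls LE]] := local_lagrangian (w := fun u => w b (param b u)) (leaf_tangent_germ By).
- exact: smooth_field_at (tf_smooth w b) By.
- by apply: (near_param_dom By (A := fun z => (w b z)^T = - w b z)) => z bz; exact: tf_skew.
- apply: (near_param_dom By (A := fun z => (F b z *m w b z)^T = F b z *m w b z)) => z bz.
  exact: leaf_endo_form_sym.
- move=> p q r; apply: filterS2 (near_paramK By) (near_param By (near_dom By)) => u uK bu.
  by have := leaf_form_closed bu p q r; rewrite uK.
have /near_open[U [oU Uy HU]] := @filterI _ _ (nbhs_filter _) _ _ (near_dom By)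
  (near_coord By (@filterI _ _ (nbhs_filter _) _ _ (smooth_at_near Ls) (near_forall2 LE))).
have bU z : U z -> dom b z by move=> /HU[].
exists U, (fun z => L (coord b z)).
have Lp z : U z -> \forall u \near coord b z, ((fun z => L (coord b z)) \o param b) u = L u.
  by move=> Uz; apply: filterS (near_paramK (bU z Uz)) => u /= ->.
have Lsm z : U z -> smooth_at (coord b z) ((fun z => L (coord b z)) \o param b).
  move=> Uz; have [_ [Lz _]] := HU z Uz; apply: smooth_at_eq Lz.
  by apply: filterS (Lp z Uz) => u ->.
split => //; first by apply: smooth_onI => z Uz; exists b; [exact: bU|exact: Lsm].
move=> b' z b'z Uz; have bz := bU z Uz.
have UU : \forall z' \near z, U z' by exact: open_nbhs_nbhs.
(* Identification of the form dL o F on the manifold with the coordinate expression in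
   [local_lagrangian]. It is needed on a neighbourhood because it is differentiated next. *)
have thb : \forall u \near coord b z, d_comp (fun z => L (coord b z)) F b (param b u) =
    \col_j \sum_l F b (param b u) j l * partial l L u.
  apply: filterS2 (near_param bz UU) (near_paramK bz) => u Uu uK.
  apply/colP => j; rewrite [LHS]mxE [RHS]mxE; apply: eq_bigr => l _; rewrite mxE; congr (_ * _).
  by rewrite uK; apply: partial_eq; have := Lp _ Uu; rewrite uK.
have ths : smooth_mx_at (coord b z) (fun u => d_comp (fun z => L (coord b z)) F b (param b u)).
  move=> j c; apply: (smooth_at_eq (f := fun u => \sum_l F b (param b u) j l * partial l L u)).
    by apply: filterS thb => u ->; rewrite mxE.
  apply: smooth_at_sum => l _; apply: smooth_at_mul.
    exact: (smooth_field_at (ef_smooth F b) bz).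
  by apply: smooth_at_partial; have [_ []] := HU z Uz.
rewrite (tf_compat w b'z bz) (ext_d1_jac bz b'z ths); last first.
  apply: filterS2 UU (near_dom b'z) => z' Uz' b'z'; have bz' := bU z' Uz'.
  rewrite /d_comp (dchart_jac b'z' bz') ?mulmxA; last exact: Lsm.
  by rewrite (ef_compat F b'z' bz').
congr (_ *m _ *m _); rewrite ext_d1E; apply/matrixP => p q.
have [_ [_ LEz]] := HU z Uz; have := LEz p q; rewrite coordK // => ->.
rewrite mxE; congr (_ - _); apply: partial_eq; apply: filterS thb => u ->; by rewrite mxE.
Qed.

End Lagrangian.

End Leaf.

Theorem proposition4p2 (R : realType) (n : nat) (M : manifold R n)
    (P : bivector_field M) (S : endo_field M)
    (MPS : locally_lagrangian_poisson P S)
    (k : nat) (N : manifold R k) (i : N -> M)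
    (leafN : symplectic_leaf P i) :
  preserves_tangent S i /\
  exists (F : endo_field N) (omega : two_form N),
    [/\ restricts_to S i F,
        leaf_form P i omega &
        locally_lagrangian_symplectic F omega].
Proof.
have [leafi _] := leafN; have [F FE] := leaf_endo MPS leafi.
have [Q QE] := leaf_bivector_exists leafi; have [w wE] := leaf_two_form leafi QE.
split; first by move=> b a y By ay; exact: (leaf_endo_stable MPS leafi).
exists F, w; split => //; first exact: (leaf_formP leafi QE wE).
split.
- exact: (leaf_tangent_structure MPS leafi FE QE).
- exact: (leaf_symplectic MPS leafi QE wE).
- exact: (leaf_lagrangian MPS leafi FE QE wE).
Qed.
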